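(* The Markov semigroup $\{T(t)\}_{t\ge0}$ in $C(\Omega)$ described in the context gives rise to a diffusion process $\boldsymbol\omega_{z,z'}(t)$ in $\Omega$: a strong Markov process with transition semigroup $\{T(t)\}$, which can start from any point or any probability distribution on $\Omega$, and whose sample paths are continuous almost surely.
   Context: Young diagrams: $\mathbb Y_n$ is the set of Young diagrams with $n$ boxes; $\mu\nearrow\lambda$ (equivalently $\lambda\searrow\mu$) means $\mu\subset\lambda$, $|\lambda|=|\mu|+1$; $(z)_\theta=\prod_{(i,j)\in\theta}(z+j-i)$ for a skew diagram $\theta$ ($(i,j)$ = row $i$, column $j$); $\dim\lambda$ = number of standard Young tableaux of shape $\lambda$. Modified Frobenius coordinates $\lambda=(a_1,\dots,a_d\mid b_1,\dots,b_d)$: $d$ the number of diagonal boxes, $a_i=\lambda_i-i+\frac12$, $b_i=\lambda'_i-i+\frac12$. $(z,z')$ is fixed in the principal series ($z\notin\mathbb R$, $z'=\bar z$) or complementary series ($z,z'\in(N,N+1)$, $N\in\mathbb Z$). $p^\downarrow(\nu,\lambda)=\dim\lambda/\dim\nu$ if $\lambda\nearrow\nu$, else 0; for $\lambda\in\mathbb Y_n$, $p^\uparrow(\lambda,\nu)=\frac{(z)_{\nu/\lambda}(z')_{\nu/\lambda}}{zz'+n}\frac{\dim\nu}{(n+1)\dim\lambda}$ if $\nu\searrow\lambda$, else 0; $(T_ng)(\lambda)=\sum_{\nu\in\mathbb Y_{n+1}}p^\uparrow(\lambda,\nu)\sum_{\tilde\lambda\in\mathbb Y_n}p^\downarrow(\nu,\tilde\lambda)g(\tilde\lambda)$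 on real functions on $\mathbb Y_n$ (norm $\|g\|_n=\max|g|$). Thoma simplex $\Omega$: pairs $\omega=(\alpha,\beta)$ of nonincreasing sequences of nonnegative reals with $\sum_i(\alpha_i+\beta_i)\le1$, topology from $[0,1]^\infty\times[0,1]^\infty$; $C(\Omega)$ with sup norm. $\iota_n(\lambda)=(\alpha,\beta)$ with $\alpha_i=a_i/n$, $\beta_i=b_i/n$ for $i\le d$, 0 otherwise; $\pi_nf=f\circ\iota_n$. $\Lambda^\circ=\mathbb R[q_1,q_2,\dots]\subset C(\Omega)$ with moment coordinates $q_k(\omega)=\sum_i\alpha_i^{k+1}+(-1)^k\sum_i\beta_i^{k+1}$ (equivalently $\Lambda/(p_1-1)$ with $p^\circ_{k+1}=q_k$, $s^\circ_\mu$ the images of Schur functions). $A=A_{z,z'}:\Lambda^\circ\to\Lambda^\circ$ is the operator $A s^\circ_\mu=-m(m-1+zz')s^\circ_\mu+\sum_{\mu_\bullet\nearrow\mu}(z)_{\mu/\mu_\bullet}(z')_{\mu/\mu_\bullet}s^\circ_{\mu_\bullet}$, $m=|\mu|$; it satisfies $\|n^2(T_n-\mathbf 1)\pi_nf-\pi_n(Af)\|_n\to0$ for $f\in\Lambda^\circ$, is closable in $C(\Omega)$, and its closure generates a strongly continuous conservative Markov semigroup $\{T(t)\}$ in $C(\Omega)$ (contractions preserving nonnegativity and fixing $1$) with $\|T_n^{[n^2t]}\pi_nf-\pi_n(T(t)f)\|_n\to0$ for all $f\in C(\Omega)$. *)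

(* Defs.v *)
From HB Require Import structures.
From mathcomp Require Import all_boot all_order all_algebra.
From mathcomp Require Import all_classical all_reals all_analysis.
From mathcomp Require complex.
Import complex.ComplexField.
Unset Printing Implicit Defensive.
Import Order.TTheory GRing.Theory Num.Theory.
Import numFieldNormedType.Exports.
Local Open Scope classical_set_scope.
Local Open Scope ring_scope.

(* ambient space [0,1]^oo x [0,1]^oo (we use R^nat x R^nat with the product
   topology; Omega is a subset of [0,1]^oo x [0,1]^oo so both give the same
   subspace topology on Omega) *)
Definition thomaX (R : realType) := ({ptws nat -> R} * {ptws nat -> R})%type.

Definition thoma_set (R : realType) : set (thomaX R) :=
  [set w | (forall i, 0 <= w.1 i) /\ (forall i, 0 <= w.2 i) /\
           (forall i, w.1 i.+1 <= w.1 i) /\ (forall i, w.2 i.+1 <= w.2 i) /\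
           (forall N, \sum_(i < N) (w.1 i + w.2 i) <= 1)].

Lemma thoma_set0 (R : realType) : thoma_set R (fun _ => 0, fun _ => 0).
Proof.
split; first by move=> i.
split; first by move=> i.
split; first by move=> i.
split; first by move=> i.
by move=> N; rewrite big1 // => i _; rewrite addr0.
Qed.

Definition Omega (R : realType) : topologicalType := set_type (thoma_set R).

Definition omega0 (R : realType) : Omega R :=
  @exist _ _ (fun _ => 0, fun _ => 0) (mem_set (thoma_set0 R)).

HB.instance Definition _ (R : realType) := isPointed.Build (Omega R) (omega0 R).

Definition alpha (R : realType) (w : Omega R) : nat -> R := (sval w).1.
Definition beta (R : realType) (w : Omega R) : nat -> R := (sval w).2.

Definition OmegaB (R : realType) := g_sigma_algebraType (@open (Omega R)).

Definition is_partition (n : nat) (l : seq nat) : bool :=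
  [&& sorted (fun a b : nat => (b <= a)%N) l, all (fun x => (0 < x)%N) l & sumn l == n].

(* Y_n : every partition of n has at most n rows, each of length <= n *)
Definition Yd (n : nat) : seq (seq nat) :=
  undup [seq l <- [seq [seq val i | i <- tval t & (0 < val i)%N] | t : n.-tuple 'I_n.+1]
        | is_partition n l].

Definition covers (nu lam : seq nat) : bool :=
  [&& sumn nu == (sumn lam).+1, (size lam <= size nu)%N &
      all (fun i => nth 0 lam i <= nth 0 nu i)%N (iota 0 (size nu))].

(* standard Young tableaux of shape l (n = |l|): t_k is the (0-indexed) box
   (row, column) containing the entry k+1 *)
Definition is_SYT (l : seq nat) (t : (sumn l).-tuple ('I_(sumn l) * 'I_(sumn l))) : bool :=
  [&& uniq t, all (fun b : 'I_(sumn l) * 'I_(sumn l) => (b.2 < nth 0 l b.1)%N) t &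
      [forall k : 'I_(sumn l), forall m : 'I_(sumn l),
         (((tnth t m).1 <= (tnth t k).1) && ((tnth t m).2 <= (tnth t k).2))%N ==> (m <= k)%N]].

Definition dimY (l : seq nat) : nat := #|[set t | is_SYT l t]|.

(* content j - i of the box nu/lam (row i, column j, 1-indexed), when nu covers lam *)
Definition box_content (nu lam : seq nat) : int :=
  \sum_(i < size nu) ((nth 0 nu i - nth 0 lam i)%:Z * ((nth 0 nu i)%:Z - i%:Z - 1)).

Definition pdown (R : realType) (nu lam : seq nat) : R :=
  if covers nu lam then (dimY lam)%:R / (dimY nu)%:R else 0.

(* (z)_{nu/lam} (z')_{nu/lam} / (z z' + n) * dim nu / ((n+1) dim lam); the
   complex numbers involved are real in the principal/complementary series *)
Definition pup (R : realType) (z z' : complex.complex R) (n : nat) (lam nu : seq nat) : R :=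
  if covers nu lam then
    complex.Re ((z + (box_content nu lam)%:~R) * (z' + (box_content nu lam)%:~R))
      / (complex.Re (z * z') + n%:R)
      * (dimY nu)%:R / (n.+1%:R * (dimY lam)%:R)
  else 0.

Definition Tn (R : realType) (z z' : complex.complex R) (n : nat)
    (g : seq nat -> R) (lam : seq nat) : R :=
  \sum_(nu <- Yd n.+1) pup R z z' n lam nu * \sum_(lt <- Yd n) pdown R nu lt * g lt.

Definition frob_d (l : seq nat) : nat := count (fun i => i < nth 0 l i)%N (iota 0 (size l)).
Definition conjp (l : seq nat) (k : nat) : nat := count (fun x => k < x)%N l.

(* alpha_i = (lambda_i - i + 1/2)/n, beta_i = (lambda'_i - i + 1/2)/n (1-indexed i <= d) *)
Definition iota_pt (R : realType) (n : nat) (l : seq nat) : thomaX R :=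
  (fun k => if (k < frob_d l)%N then ((nth 0 l k)%:R - k%:R - 2^-1) / n%:R else 0,
   fun k => if (k < frob_d l)%N then ((conjp l k)%:R - k%:R - 2^-1) / n%:R else 0).

(* on Y_n (n >= 1) the point iota_pt n l lies in Omega; elsewhere a junk value *)
Definition iota_n (R : realType) (n : nat) (l : seq nat) : Omega R :=
  match pselect (thoma_set R (iota_pt R n l)) with
  | left p => @exist _ _ (iota_pt R n l) (mem_set p)
  | right _ => omega0 R
  end.

Definition pi_n (R : realType) (n : nat) (f : Omega R -> R) : seq nat -> R :=
  fun l => f (iota_n R n l).

Definition principal_or_complementary (R : realType) (z z' : complex.complex R) : Prop :=
  (complex.Im z != 0 /\ z' = complex.Complex (complex.Re z) (- complex.Im z)) \/
  (exists N : int, [/\ complex.Im z = 0, complex.Im z' = 0,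
     N%:~R < complex.Re z < (N + 1)%:~R & N%:~R < complex.Re z' < (N + 1)%:~R]).

Definition filtration {d} (Th : measurableType d) (R : realType) (F : R -> set (set Th)) : Prop :=
  (forall t, sigma_algebra setT (F t)) /\ (forall t, F t `<=` measurable) /\
  (forall s t, 0 <= s -> s <= t -> F s `<=` F t).

Definition stopping_time {d} (Th : measurableType d) (R : realType)
    (F : R -> set (set Th)) (tau : Th -> \bar R) : Prop :=
  (forall th, (0 <= tau th)%E) /\
  (forall t, 0 <= t -> F t [set th | (tau th <= t%:E)%E]).

Definition F_tau {d} (Th : measurableType d) (R : realType)
    (F : R -> set (set Th)) (tau : Th -> \bar R) (A : set Th) : Prop :=
  measurable A /\ (forall t, 0 <= t -> F t (A `&` [set th | (tau th <= t%:E)%E])).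

(* Main.v *)
Require Import Defs.
From HB Require Import structures.
From mathcomp Require Import all_boot all_order all_algebra.
From mathcomp Require Import all_classical all_reals all_analysis.
From mathcomp Require Import measurable_realfun.
From mathcomp Require Import ring lra zify.
From mathcomp Require complex.
Import complex.ComplexField.
Import Order.TTheory GRing.Theory Num.Theory.
Import numFieldNormedType.Exports.
Local Open Scope classical_set_scope.
Local Open Scope ring_scope.

(** For the up-down chain on [Y_n], Frobenius' formula for [dim] together with Kerov's
    relation between transition and co-transition moments gives the exact one-step action on
    content power sums.  In the moment coordinates [q_k] the drift is therefore [O(1/n^2)],
    while jumps are [O(1/n)] because one step moves one box.  Iterating [n^2 t] times and
    passing to the limit along diagrams approximating a point [w] (they are dense in [Omega])
    yields [T(t)((q_k - q_k(w))^4)(w) <= C t^2].  Since the [q_k] separate the points of the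
    compact space [Omega], this is Kolmogorov's criterion: a Daniell measure on the product
    space [R -> Omega] is carried by paths which are Hoelder along dyadic times, hence extend
    to continuous paths.  The strong Markov property follows from the Feller property by
    discretising the stopping time from above along dyadic times. *)

(** * Interpolation identities *)

(** A second-moment bound would only be linear in [t], which is too weak for Kolmogorov's criterion;
    the fourth moment gives [t ^+ 2] and still needs nothing beyond a bound on the drift and on
    squared jumps. The delicate point is the drift. Its two leading contributions, a transition
    moment of order [j + 2] and a co-transition moment of order [j], are each one power of [n] too
    large; Kerov's relation makes them agree to leading order. The convergence hypothesis controls
    [T t f] only at images of diagrams, and continuity of both sides carries the estimate to every
    starting point. On path space the product is compact, so Dini's theorem supplies the countable
    subadditivity that Daniell's construction requires. The continuous version is defined on an
    event that depends on the whole path, so it is not adapted to the raw coordinates: the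
    filtration is generated by the continuous process itself, and its Markov property is recovered
    as a limit of the one for dyadic samples. *)

Section Lagrange.
Variables (F : fieldType) (N : nat) (a : 'I_N -> F).
Hypothesis inj_a : injective a.

Definition lagden (i : 'I_N) : F := \prod_(j | j != i) (a i - a j).

Lemma lagden_neq0 i : lagden i != 0.
Proof.
apply/prodf_neq0 => j ji; rewrite subr_eq0; apply/eqP => /inj_a ij.
by rewrite ij eqxx in ji.
Qed.

Lemma lagrange_interpolation (r : {poly F}) : (size r <= N)%N ->
  r = \sum_i (r.[a i] / lagden i) *: \prod_(j | j != i) ('X - (a j)%:P).
Proof.
move=> sr; apply/eqP; rewrite -subr_eq0; apply/eqP.
set d := _ - _.
have sz i : size (\prod_(j | j != i) ('X - (a j)%:P)) = N.
  rewrite -big_filter size_prod_XsubC size_filter -sum1_count sum1_card cardC1 card_ord.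
  by rewrite prednK //; case: (N) i => // -[].
have sd : (size d <= N)%N.
  rewrite (leq_trans (size_polyD _ _)) // geq_max sr size_polyN /=.
  rewrite (leq_trans (size_sum _ _ _)) //; apply/bigmax_leqP => i _.
  by rewrite (leq_trans (size_scale_leq _ _)) // sz.
have rd : all (root d) [seq a i | i <- enum 'I_N].
  apply/allP => _ /mapP[i _ ->]; rewrite /root /d hornerD hornerN horner_sum.
  rewrite (bigD1 i) //= [X in _ - (_ + X)]big1 ?addr0 => [|k ki].
    rewrite hornerZ horner_prod.
    under eq_bigr do rewrite hornerXsubC.
    by rewrite -/(lagden i) mulfVK ?lagden_neq0 ?subrr.
  rewrite hornerZ horner_prod (bigD1 i) //=; last by rewrite eq_sym.
  by rewrite hornerXsubC subrr mul0r mulr0.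
apply/eqP/negPn/negP => d0.
have := max_poly_roots d0 rd; rewrite map_inj_uniq ?enum_uniq //.
by move=> /(_ isT); rewrite size_map size_enum_ord ltnNge sd.
Qed.

(** Each basis product is monic of degree [N.-1]. Sums of weights thereby become computations of a
    single coefficient. *)
Lemma lagrange_lead (r : {poly F}) : (size r <= N)%N ->
  r`_N.-1 = \sum_i r.[a i] / lagden i.
Proof.
move=> sr; rewrite {1}(lagrange_interpolation _ sr) coef_sum.
apply: eq_bigr => i _; rewrite coefZ.
have -> : (\prod_(j | j != i) ('X - (a j)%:P))`_N.-1 = 1; last by rewrite mulr1.
have /monicP := monic_prod_XsubC (index_enum 'I_N) (fun j => j != i) a.
rewrite lead_coefE -big_filter size_prod_XsubC size_filter -sum1_count.
by rewrite sum1_card cardC1 card_ord.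
Qed.

Lemma lagrange_fraction (r : {poly F}) x : (size r <= N)%N ->
  (forall j, x != a j) ->
  r.[x] / \prod_j (x - a j) = \sum_i r.[a i] / lagden i / (x - a i).
Proof.
move=> sr xa; rewrite {1}(lagrange_interpolation _ sr) horner_sum mulr_suml.
apply: eq_bigr => i _; rewrite hornerZ horner_prod -!mulrA; congr (_ * (_ * _)).
under eq_bigr do rewrite hornerXsubC.
rewrite [X in _ / X](bigD1 i) //= invfM mulrCA divff ?mulr1 //.
by apply/prodf_neq0 => j _; rewrite subr_eq0.
Qed.

End Lagrange.

(** The coefficients are [1], [- e_1] and [e_2], with [2 e_2] written through power sums.
    Multiplying by ['X] keeps the index at [size s] and avoids truncated subtraction for short
    lists. *)
Lemma prodXsubC_top_coefs (F : comNzRingType) (s : seq F) :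
  let P := \prod_(x <- s) ('X - x%:P) in
  [/\ P`_(size s) = 1, ('X * P)`_(size s) = - \sum_(x <- s) x
    & 2 * ('X * ('X * P))`_(size s) = (\sum_(x <- s) x) ^+ 2 - \sum_(x <- s) x ^+ 2].
Proof.
rewrite /=; elim: s => [|c s [IH1 IH2 IH3]].
  by rewrite !big_nil !coefXM coef1 /= ?mulr0 ?oppr0 ?expr0n /= ?subrr ?addr0.
rewrite !big_cons; set Q := \prod_(x <- s) _ in IH1 IH2 IH3 *.
have QS : Q`_(size s).+1 = 0 by rewrite nth_default // size_prod_XsubC.
have E k (G : {poly F}) : (('X - c%:P) * G)`_k = ('X * G)`_k - c * G`_k.
  by rewrite mulrBl coefB coefCM.
have XS k (G : {poly F}) : ('X * G)`_k.+1 = G`_k by rewrite coefXM.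
split=> /=.
- by rewrite E XS IH1 QS mulr0 subr0.
- by rewrite XS E IH1 IH2 mulr1 opprD addrC.
- rewrite XS mulrCA E mulrBr IH3 IH2; ring.
Qed.

(** * Sums of co-transition and transition weights *)

Section ShiftedWeights.
Variables (F : realFieldType) (N : nat) (a : 'I_N -> F).
Hypothesis inj_a : injective a.

(** For the shifted rows of a diagram with [n] boxes, [downw i] is [n] times the ratio of dimensions
    after removing a box from row [i], and [upw i] is the Plancherel growth probability of adding
    one. Both vanish when the move is not allowed. *)
Definition downw (i : 'I_N) : F :=
  a i * \prod_(j | j != i) ((a i - 1 - a j) / (a i - a j)).
Definition upw (i : 'I_N) : F :=
  (a i + 1)^-1 * \prod_(j | j != i) ((a i + 1 - a j) / (a i - a j)).

Let q : {poly F} := \prod_j ('X - (a j)%:P).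
Let p : {poly F} := \prod_j ('X - (a j + 1)%:P).
(** At a node only ['X * p] survives, which produces the weights. The roots of [p] exceed those of
    [q] by [N] in total, so the factor ['X - N] is the one that cancels the coefficients of degree
    [N + 1] and [N]. *)
Let r := 'X * p - ('X - N%:R%:P) * q.

Let r_at i : r.[a i] = - (downw i * lagden F N a i).
Proof.
rewrite /r /p /q /downw /lagden hornerD hornerN !hornerM hornerX.
rewrite !horner_prod [X in _ - _ * X](bigD1 i) //= !hornerXsubC subrr mul0r mulr0 subr0.
rewrite (bigD1 i) //= hornerXsubC prodf_div -mulrA mulfVK ?lagden_neq0 //.
rewrite (_ : a i - (a i + 1) = -1) ?mulN1r ?mulrN; last by ring.
congr (- (_ * _)).
by apply: eq_bigr => j _; rewrite hornerXsubC; ring.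
Qed.

Let r_coef j : r`_j = ('X * p)`_j - ('X * q)`_j + N%:R * q`_j.
Proof. by rewrite /r mulrBl !coefB coefCM opprB addrA addrAC. Qed.

Let q_coefs : [/\ q`_N = 1, ('X * q)`_N = - \sum_j a j
    & 2 * ('X * ('X * q))`_N = (\sum_j a j) ^+ 2 - \sum_j a j ^+ 2].
Proof.
have := prodXsubC_top_coefs _ [seq a j | j <- index_enum 'I_N].
by rewrite /= size_map -[X in size X]enumT size_enum_ord !big_map.
Qed.

Let p_coefs : [/\ p`_N = 1, ('X * p)`_N = - \sum_j (a j + 1)
    & 2 * ('X * ('X * p))`_N = (\sum_j (a j + 1)) ^+ 2 - \sum_j (a j + 1) ^+ 2].
Proof.
have := prodXsubC_top_coefs _ [seq a j + 1 | j <- index_enum 'I_N].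
by rewrite /= size_map -[X in size X]enumT size_enum_ord !big_map.
Qed.

Let size_r : (size r <= N)%N.
Proof.
have [q1 q2 _] := q_coefs; have [p1 p2 _] := p_coefs.
have sz (b : 'I_N -> F) : size (\prod_j ('X - (b j)%:P)) = N.+1.
  by rewrite size_prod_XsubC -[X in size X]enumT size_enum_ord.
have zp k : (N < k)%N -> p`_k = 0 by move=> Nk; rewrite nth_default // sz.
have zq k : (N < k)%N -> q`_k = 0 by move=> Nk; rewrite nth_default // sz.
apply/leq_sizeP => j; rewrite leq_eqVlt => /orP[/eqP <-|].
  rewrite r_coef q1 q2 p2 big_split /= sumr_const card_ord; ring.
rewrite leq_eqVlt => /orP[/eqP <-|Nj]; rewrite r_coef !coefXM /=.
  by rewrite p1 q1 zq // subrr mulr0 addr0.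
case: j Nj => //= j Nj.
by rewrite zp // !zq ?(ltnW Nj) // subrr mulr0 addr0.
Qed.

Let r_lead : 2 * ('X * r)`_N = N%:R * (N%:R - 1) - 2 * \sum_j a j.
Proof.
have [q1 q2 q3] := q_coefs; have [p1 p2 p3] := p_coefs.
have -> : ('X * r)`_N = ('X * ('X * p))`_N - ('X * ('X * q))`_N + N%:R * ('X * q)`_N.
  rewrite /r mulrBr mulrBl mulrBr !coefB [X in _ - (_ - X)](_ : _ = N%:R * ('X * q)`_N).
    by ring.
  by rewrite mulrCA coefCM.
rewrite mulrDr mulrBr p3 q3 q2.
have -> : \sum_j (a j + 1) ^+ 2 = \sum_j a j ^+ 2 + 2 * \sum_j a j + N%:R.
  have -> : N%:R = \sum_(j < N) 1 :> F by rewrite sumr_const card_ord.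
  rewrite mulr_sumr -!big_split /=.
  by apply: eq_bigr => j _; ring.
rewrite big_split /= sumr_const card_ord; ring.
Qed.

Lemma sum_downw : \sum_i downw i = \sum_i a i - N%:R * (N%:R - 1) / 2.
Proof.
have : r`_N.-1 = - \sum_i downw i.
  rewrite (lagrange_lead _ _ _ inj_a _ size_r) -sumrN; apply: eq_bigr => i _.
  by rewrite r_at mulNr mulfK ?lagden_neq0.
case: (posnP N) => [N0|N_gt0 rl].
  have e0 (i : 'I_N) : False by case: i => m; rewrite N0.
  by rewrite !big1 ?N0 ?mul0r ?subr0 // => i; case: (e0 i).
have := r_lead; rewrite coefXM -[(N == 0)%N]negbK -lt0n N_gt0 /= rl; lra.
Qed.

(** At a root of [p] the polynomial [r] reduces to its second term, a multiple of the denominator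
    [q] of the partial fractions. *)
Lemma sum_downw_fraction x : (forall j, x != a j) ->
  (exists j, x = a j + 1) -> \sum_i downw i / (x - a i) = x - N%:R.
Proof.
move=> xa [j xj].
have := lagrange_fraction _ _ _ inj_a _ _ size_r xa.
have -> : r.[x] = - ((x - N%:R) * \prod_j (x - a j)).
  rewrite /r /p /q hornerD hornerN !hornerM hornerXsubC !horner_prod.
  rewrite (bigD1 j) //= hornerXsubC xj subrr mul0r mulr0 sub0r; congr (- (_ * _)).
  by apply: eq_bigr => i _; rewrite hornerXsubC.
rewrite mulNr mulfK; last by apply/prodf_neq0 => i _; rewrite subr_eq0.
move=> E; apply: oppr_inj; rewrite E -sumrN; apply: eq_bigr => i _.
by rewrite r_at mulNr mulfK ?lagden_neq0 // mulNr.
Qed.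

(* The factor [X + 1] coming from the vanishing shifted part has been cancelled. *)
Variable i0 : 'I_N.
Hypothesis a_i0 : a i0 = 0.
Hypothesis a_ge0 : forall i, 0 <= a i.
Let s : {poly F} := \prod_(j | j != i0) ('X - (a j - 1)%:P).

Let size_s : size s = N.
Proof.
rewrite /s -big_filter -(big_map (fun j => a j - 1) xpredT (fun x => 'X - x%:P)).
rewrite size_prod_XsubC size_map size_filter -sum1_count sum1_card cardC1 card_ord.
by rewrite prednK //; case: (N) i0 => // -[].
Qed.

Let s_at i : s.[a i] / lagden F N a i = upw i.
Proof.
rewrite /s /upw prodf_div mulrA -/(lagden F N a i); congr (_ / _).
apply: (mulfI (x := a i + 1)); first by rewrite gt_eqF // ltr_wpDl.
rewrite mulVKf; last by rewrite gt_eqF // ltr_wpDl.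
rewrite {1}(_ : a i + 1 = a i + 1 - a i0); last by rewrite a_i0 subr0.
rewrite horner_prod; under eq_bigr do rewrite hornerXsubC opprB addrA [_ + 1]addrC.
transitivity (\prod_j (a i + 1 - a j)).
  rewrite [RHS](bigD1 i0) //=; congr (_ * _); apply: eq_bigr => j _; ring.
by rewrite (bigD1 i) //= [X in X * _]addrAC subrr add0r mul1r.
Qed.

(** The weights are the Lagrange weights of the monic polynomial [s] of degree [N.-1], so they add
    up to its leading coefficient. *)
Lemma sum_upw : \sum_i upw i = 1.
Proof.
have := lagrange_lead _ _ _ inj_a s; rewrite size_s leqnn => /(_ isT).
under [X in _ = X -> _]eq_bigr do rewrite s_at.
move <-; rewrite -[X in s`_X.-1]size_s -lead_coefE.
by apply/eqP/monic_prod_XsubC.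
Qed.

Lemma sum_upw_fraction x : (forall j, x != a j) ->
  (exists2 j, j != i0 & x = a j - 1) -> \sum_i upw i / (x - a i) = 0.
Proof.
move=> xa [j ji xj].
have := lagrange_fraction _ _ _ inj_a s x; rewrite size_s leqnn => /(_ isT xa).
under [X in _ = X -> _]eq_bigr do rewrite s_at.
move <-; rewrite /s horner_prod (bigD1 j) //= hornerXsubC xj subrr.
by rewrite !mul0r.
Qed.

End ShiftedWeights.

(** * Partitions as row functions, and moves of one box *)

Notation rw l i := (nth 0%N l i).

Section Partitions.
Local Open Scope nat_scope.

Lemma rw_antitone n l i j : is_partition n l -> i <= j -> rw l j <= rw l i.
Proof.
move=> /and3P[ls _ _] ij; have [jl|lj] := ltnP j (size l); last by rewrite (nth_default _ lj).
apply: (sorted_leq_nth _ _ 0 ls) => //; last by rewrite inE (leq_ltn_trans ij).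
by move=> a b c /= ba ac; apply: leq_trans ac ba.
Qed.

Lemma rw_gt0 n l i : is_partition n l -> (0 < rw l i) = (i < size l).
Proof.
move=> /and3P[_ /allP lp _]; have [il|li] := ltnP i (size l).
  by rewrite lp // mem_nth.
by rewrite nth_default.
Qed.

Lemma partition_ext n m l l' : is_partition n l -> is_partition m l' ->
  (forall i, rw l i = rw l' i) -> l = l'.
Proof.
move=> pl pl' E; apply: (eq_from_nth (x0 := 0)) => [|i _]; last exact: E.
have H i : (i < size l) = (i < size l') by rewrite -(rw_gt0 _ _ _ pl) -(rw_gt0 _ _ _ pl') E.
by apply/eqP; case: ltngtP => //; rewrite ?H ?ltnn // -H ltnn.
Qed.

Lemma sumn_rw l N : size l <= N -> sumn l = \sum_(i < N) rw l i.
Proof.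
move=> lN; rewrite sumnE (big_nth 0) big_mkord.
rewrite (big_ord_widen _ (fun i => rw l i) lN) [RHS](bigID (fun i : 'I_N => i < size l)) /=.
rewrite [X in _ + X]big1 ?addn0 // => i; rewrite -leqNgt => li.
by rewrite nth_default.
Qed.

Lemma size_partition n l : is_partition n l -> size l <= n.
Proof.
move=> /and3P[_ /allP lp /eqP <-]; elim: l lp => //= x l IH lp.
by rewrite -addn1 addnC leq_add ?lp ?mem_head // IH // => y yl; rewrite lp // inE yl orbT.
Qed.

Lemma rw_partition_le n l i : is_partition n l -> rw l i <= n.
Proof.
move=> pl; have [il|li] := ltnP i (size l); last by rewrite nth_default.
have /and3P[_ _ /eqP <-] := pl.
rewrite (sumn_rw _ _ (leqnn _)) (bigD1 (Ordinal il)) //= leq_addr //.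
Qed.

(** A hook bound: each of the [i] rows above row [i] contains at least one box. It keeps contents
    and box coordinates below [n]. *)
Lemma rw_add_index_le n l i : is_partition n l -> 0 < rw l i -> rw l i + i <= n.
Proof.
move=> pl rp; have il : i < size l by rewrite -(rw_gt0 _ _ _ pl).
have /and3P[_ _ /eqP <-] := pl.
rewrite (sumn_rw _ _ (leqnn _)) (bigD1 (Ordinal il)) //= leq_add2l.
have : \sum_(j < size l | (j < i)) 1 <= \sum_(j < size l | j != Ordinal il) rw l j.
  rewrite [X in _ <= X](bigID (fun j : 'I__ => j < i)) /=.
  apply: leq_trans (leq_addr _ _); rewrite [X in _ <= X](eq_bigl (fun j : 'I__ => j < i)).
    by apply: leq_sum => j _; rewrite (rw_gt0 _ _ _ pl).
  by move=> j /=; rewrite -val_eqE /= neq_ltn; case: ltngtP.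
apply: leq_trans; rewrite -(big_ord_widen _ (fun=> 1) (ltnW il)).
by rewrite sum1_card card_ord.
Qed.

Lemma mem_Yd n l : (l \in Yd n) = is_partition n l.
Proof.
rewrite mem_undup mem_filter; case pl: (is_partition n l) => //=.
have sl := size_partition _ _ pl.
have lN i : rw l i < n.+1 by rewrite ltnS (rw_partition_le _ _ _ pl).
apply/mapP; exists [tuple Ordinal (lN i) | i < n]; first by rewrite mem_enum.
rewrite /= -(@eq_filter _ (preim val (fun x => 0 < x))) //.
rewrite -filter_map -map_comp.
have -> : [seq (val \o (fun i : 'I_n => Ordinal (lN i))) i | i <- enum 'I_n] = mkseq (nth 0 l) n.
  by rewrite /mkseq -val_enum_ord -[in RHS]map_comp.
have -> : mkseq (nth 0 l) n = l ++ nseq (n - size l) 0.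
  apply: (eq_from_nth (x0 := 0)); first by rewrite size_mkseq size_cat size_nseq subnKC.
  move=> i; rewrite size_mkseq => i_n; rewrite nth_mkseq // nth_cat.
  by case: ltnP => // il; rewrite nth_nseq nth_default // if_same.
rewrite filter_cat; have /and3P[_ lp _] := pl.
rewrite (all_filterP lp) -[LHS]cats0; congr (_ ++ _).
by elim: (n - size l).
Qed.

Lemma uniq_Yd n : uniq (Yd n). Proof. exact: undup_uniq. Qed.

(** Cutting at the first zero makes all listed rows positive, as [is_partition] demands; diagrams
    can then be built and compared through their row functions alone. *)
Definition shape_of (f : nat -> nat) N := mkseq f (find (fun i => f i == 0) (iota 0 N)).

Lemma rw_shape_of f N i : (forall i, f i.+1 <= f i) -> f N = 0 -> rw (shape_of f N) i = f i.
Proof.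
move=> fa fN; rewrite /shape_of; set k := find _ _.
have fm : {homo f : i j / i <= j >-> j <= i}.
  by apply: homo_leq => // a b c; rewrite /= => h1 h2; apply: leq_trans h2 h1.
have fk : f k = 0.
  have kN : k <= N by rewrite -[X in _ <= X](size_iota 0); apply: find_size.
  move: kN; rewrite leq_eqVlt => /orP[/eqP -> //|kN].
  have : has (fun i => f i == 0) (iota 0 N) by rewrite has_find size_iota.
  by move/(nth_find 0); rewrite nth_iota // add0n => /eqP.
have [ik|ki] := ltnP i k; first by rewrite nth_mkseq.
rewrite nth_default ?size_mkseq //.
by apply/esym/eqP; rewrite -leqn0 -fk fm.
Qed.

Lemma shape_of_partition f N : (forall i, f i.+1 <= f i) -> f N = 0 ->
  is_partition (\sum_(i < N) f i) (shape_of f N).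
Proof.
move=> fa fN; apply/and3P; split.
- rewrite /shape_of; set k := find _ _; apply/(sortedP 0) => i.
  by rewrite size_mkseq => ik; rewrite !nth_mkseq // ltnW.
- rewrite /shape_of; apply/allP => _ /mapP[i + ->].
  rewrite mem_iota add0n => /= ik; rewrite lt0n.
  have iN : i < N by rewrite (leq_trans ik) // -[X in _ <= X](size_iota 0) find_size.
  by have := before_find 0 ik; rewrite nth_iota // => ->.
- have sN : size (shape_of f N) <= N.
    by rewrite size_mkseq -[X in _ <= X](size_iota 0) find_size.
  by rewrite (sumn_rw _ _ sN); apply/eqP/eq_bigr => i _; rewrite rw_shape_of.
Qed.

Definition addable (l : seq nat) i := (i == 0) || (rw l i < rw l i.-1).
Definition removable (l : seq nat) i := rw l i.+1 < rw l i.
Definition addbox (l : seq nat) i := shape_of (fun j => rw l j + (j == i)) (size l).+1.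
Definition rembox (l : seq nat) i := shape_of (fun j => rw l j - (j == i)) (size l).

Lemma addable_le n l i : is_partition n l -> addable l i -> i <= size l.
Proof.
case: i => // i pl /=; rewrite /addable /= => h.
by rewrite -(rw_gt0 _ _ _ pl) (leq_ltn_trans _ h).
Qed.

Lemma removable_lt l i : removable l i -> i < size l.
Proof. by rewrite /removable ltnNge => h; rewrite ltnNge; apply: contra h => h; rewrite !nth_default // ltnW. Qed.

Section Boxes.
Variables (n : nat) (l : seq nat).
Hypothesis pl : is_partition n l.

Let anti i : rw l i.+1 <= rw l i. Proof. exact: rw_antitone pl _. Qed.

Section AddBox.
Variable i : nat.
Hypothesis ai : addable l i.

Let zero_at : rw l (size l).+1 + ((size l).+1 == i) = 0.
Proof.
by rewrite nth_default // gtn_eqF // ltnS (addable_le _ _ _ pl ai).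
Qed.

Let add_anti k : rw l k.+1 + (k.+1 == i) <= rw l k + (k == i).
Proof.
have [E|ki] := eqVneq k.+1 i; last by rewrite addn0 (leq_trans (anti k)) // leq_addr.
by move: ai; rewrite -E /addable /= addn1 => h; rewrite (leq_trans h) // leq_addr.
Qed.

Lemma rw_addbox j : rw (addbox l i) j = rw l j + (j == i).
Proof. exact: (rw_shape_of _ _ _ add_anti zero_at). Qed.

Lemma addbox_partition : is_partition n.+1 (addbox l i).
Proof.
have := shape_of_partition _ _ add_anti zero_at.
rewrite big_split /= -(sumn_rw l) //; have /and3P[_ _ /eqP ->] := pl.
rewrite (bigD1 (Ordinal (_ : i < (size l).+1))) ?ltnS ?(addable_le _ _ _ pl ai) //= => ilt.
by rewrite eqxx big1 ?addn0 ?addn1 // => j; rewrite -val_eqE /= => /negbTE ->.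
Qed.

End AddBox.

Section RemBox.
Variable i : nat.
Hypothesis ri : removable l i.

Let rem_anti k : rw l k.+1 - (k.+1 == i) <= rw l k - (k == i).
Proof.
have [E|ki] := eqVneq k i.
  by move: ri; rewrite -E /removable gtn_eqF // subn0; lia.
by rewrite subn0 (leq_trans (leq_subr _ _)).
Qed.

Let zero_at : rw l (size l) - (size l == i) = 0.
Proof. by rewrite nth_default. Qed.

Lemma rw_rembox j : rw (rembox l i) j = rw l j - (j == i).
Proof. exact: (rw_shape_of _ _ _ rem_anti zero_at). Qed.

Lemma rembox_partition : is_partition n.-1 (rembox l i).
Proof.
have := shape_of_partition _ _ rem_anti zero_at.
set s := \sum_(_ < _) _; suff -> : s = n.-1 by [].
have /and3P[_ _ /eqP nl] := pl; rewrite -nl (sumn_rw l (size l)) //.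
have il := removable_lt _ _ ri.
rewrite /s (bigD1 (Ordinal il)) // [in RHS](bigD1 (Ordinal il)) //= eqxx subn1.
rewrite (eq_bigr (fun j : 'I__ => rw l j)); last first.
  by move=> j; rewrite -val_eqE /= => /negbTE ->; rewrite subn0.
by move: ri; rewrite /removable; case: (rw l i).
Qed.

End RemBox.

End Boxes.

Lemma addboxK n l i : is_partition n l -> addable l i ->
  removable (addbox l i) i /\ rembox (addbox l i) i = l.
Proof.
move=> pl al; have pa := addbox_partition _ _ pl _ al.
have ra : removable (addbox l i) i.
  rewrite /removable !(rw_addbox _ _ pl) // eqxx gtn_eqF // addn0 addn1 ltnS.
  exact: rw_antitone pl _.
split=> //; apply: (partition_ext _ _ _ _ (rembox_partition _ _ pa _ ra) pl) => j.
by rewrite (rw_rembox _ _ pa) // (rw_addbox _ _ pl) // addnK.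
Qed.

Lemma remboxK n l i : is_partition n l -> removable l i ->
  addable (rembox l i) i /\ addbox (rembox l i) i = l.
Proof.
move=> pl rl; have pr := rembox_partition _ _ pl _ rl.
have al : addable (rembox l i) i.
  case: i rl pr => // i rl pr; rewrite /addable !(rw_rembox _ _ pl) // eqxx /= ltn_eqF // subn0.
  have := rw_antitone _ _ i i.+1 pl (leqnSn i).
  by move: rl; rewrite /removable; lia.
split=> //; apply: (partition_ext _ _ _ _ (addbox_partition _ _ pr _ al) pl) => j.
rewrite (rw_addbox _ _ pr) // (rw_rembox _ _ pl) //.
have [->|] := eqVneq j i; last by rewrite subn0 addn0.
by move: rl; rewrite /removable; lia.
Qed.

Lemma sumn_partition n l : is_partition n l -> sumn l = n.
Proof. by case/and3P => _ _ /eqP. Qed.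

Lemma covers_rw n nu l : is_partition n l -> is_partition n.+1 nu -> covers nu l ->
  exists i, forall j, rw nu j = rw l j + (j == i).
Proof.
move=> pl pn /and3P[_ sz /allP le].
have le' j : rw l j <= rw nu j.
  have [jn|nj] := ltnP j (size nu); first by rewrite le // mem_iota.
  by rewrite !nth_default // (leq_trans sz).
have : \sum_(j < size nu) (rw nu j - rw l j) == 1.
  rewrite sumnB //.
  rewrite -!sumn_rw // (sumn_partition _ _ pn) (sumn_partition _ _ pl) subSnn //.
case/sum_nat_eq1 => i [_ E1 E0]; exists (val i) => j.
have [jn|nj] := ltnP j (size nu); last first.
  by rewrite !nth_default ?(leq_trans sz) // gtn_eqF // (leq_trans _ nj) ?ltn_ord.
have [ji|ji] := eqVneq (Ordinal jn) i.
  by rewrite -ji /= eqxx addn1; move: E1 (le' i); rewrite -ji /=; lia.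
have := E0 _ ji isT; have := le' j; rewrite -val_eqE /= in ji.
by rewrite (negbTE ji) /=; lia.
Qed.

Lemma coversP n nu l : is_partition n l -> is_partition n.+1 nu ->
  reflect (exists2 i, addable l i & nu = addbox l i) (covers nu l).
Proof.
move=> pl pn; apply: (iffP idP) => [/(covers_rw _ _ _ pl pn)[i E]|[i al ->]].
  have al : addable l i.
    case: i E => // i E; rewrite /addable /=.
    have := rw_antitone _ _ i i.+1 pn (leqnSn i).
    by rewrite !E eqxx ltn_eqF // addn0 addn1.
  exists i => //; apply: (partition_ext _ _ _ _ pn (addbox_partition _ _ pl _ al)) => j.
  by rewrite (rw_addbox _ _ pl).
have pa := addbox_partition _ _ pl _ al.
apply/and3P; split.
- by rewrite (sumn_partition _ _ pa) (sumn_partition _ _ pl).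
- rewrite leqNgt; apply/negP => h.
  have : 0 < rw l (size (addbox l i)) by rewrite (rw_gt0 _ _ _ pl).
  suff -> : rw l (size (addbox l i)) = 0 by [].
  have := nth_default 0 (leqnn (size (addbox l i))).
  by rewrite (rw_addbox _ _ pl) // => /eqP; rewrite addn_eq0 => /andP[/eqP].
- by apply/allP => j _; rewrite (rw_addbox _ _ pl) // leq_addr.
Qed.

End Partitions.

Lemma box_content_addbox n l i : is_partition n l -> addable l i ->
  box_content (addbox l i) l = (rw l i)%:Z - i%:Z.
Proof.
move=> pl al; have pa := addbox_partition _ _ pl _ al.
have isz : (i < size (addbox l i))%N.
  by rewrite -(rw_gt0 _ _ _ pa) (rw_addbox _ _ pl) // eqxx addn1.
rewrite /box_content (bigD1 (Ordinal isz)) //= big1 => [|j].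
  by rewrite (rw_addbox _ _ pl) // eqxx addr0 addKn; lia.
rewrite -val_eqE /= (rw_addbox _ _ pl) // => /negbTE ->.
by rewrite addn0 subnn mul0r.
Qed.

(** A covering diagram is determined by the row that receives the box, and that row has index at
    most [n]. This turns sums over lists of partitions into sums over ordinals, on which the weights
    live. *)
Lemma sum_covers_up (V : nmodType) n l N (G : seq nat -> V) :
  is_partition n l -> (n < N)%N ->
  \sum_(nu <- Yd n.+1 | covers nu l) G nu = \sum_(i < N | addable l i) G (addbox l i).
Proof.
move=> pl nN; rewrite -(big_mkord (addable l) (fun i => G (addbox l i))).
rewrite -[LHS]big_filter -[RHS]big_filter -(big_map (addbox l) xpredT).
apply/perm_big/uniq_perm.
- by rewrite filter_uniq // uniq_Yd.
- rewrite map_inj_in_uniq ?filter_uniq ?iota_uniq // => i j.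
  rewrite !mem_filter => /andP[ai _] /andP[aj _] /(congr1 (fun l' => rw l' i)).
  by rewrite !(rw_addbox _ _ pl) // eqxx; have [->//|] := eqVneq i j; lia.
move=> nu; rewrite mem_filter mem_Yd; apply/andP/mapP => [[cv pn]|[i]].
  have /(coversP _ _ _ pl pn)[i ai ->] := cv; exists i => //.
  rewrite mem_filter ai mem_index_iota /= (leq_ltn_trans (addable_le _ _ _ pl ai)) //.
  by rewrite (leq_ltn_trans (size_partition _ _ pl)).
rewrite mem_filter => /andP[ai _ ->]; have pa := addbox_partition _ _ pl _ ai.
by split=> //; apply/(coversP _ _ _ pl pa); exists i.
Qed.

Lemma sum_covers_down (V : nmodType) n nu N (G : seq nat -> V) :
  is_partition n.+1 nu -> (n < N)%N ->
  \sum_(l <- Yd n | covers nu l) G l = \sum_(i < N | removable nu i) G (rembox nu i).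
Proof.
move=> pn nN; rewrite -(big_mkord (removable nu) (fun i => G (rembox nu i))).
rewrite -[LHS]big_filter -[RHS]big_filter -(big_map (rembox nu) xpredT).
apply/perm_big/uniq_perm.
- by rewrite filter_uniq // uniq_Yd.
- rewrite map_inj_in_uniq ?filter_uniq ?iota_uniq // => i j.
  rewrite !mem_filter => /andP[ai _] /andP[aj _] /(congr1 (fun l' => rw l' i)).
  rewrite !(rw_rembox _ _ pn) // eqxx; have [->//|] := eqVneq i j.
  by move: ai; rewrite /removable; lia.
move=> l; rewrite mem_filter mem_Yd; apply/andP/mapP => [[cv pl]|[i]].
  have /(coversP _ _ _ pl pn)[i ai E] := cv; exists i.
    have [ri _] := addboxK _ _ _ pl ai.
    rewrite mem_filter E ri mem_index_iota /= (leq_ltn_trans _ nN) //.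
    by rewrite (leq_trans (addable_le _ _ _ pl ai)) // (size_partition _ _ pl).
  by have [_] := addboxK _ _ _ pl ai; rewrite E => ->.
rewrite mem_filter => /andP[ri _ ->]; have pr := rembox_partition _ _ pn _ ri.
have [ai E] := remboxK _ _ _ pn ri.
by split=> //; apply/(coversP _ _ _ pr pn); exists i.
Qed.

(** * Frobenius' dimension formula *)

Section StandardTableaux.
Local Open Scope nat_scope.

Let box := (nat * nat)%type.
Let above (b c : box) := ~~ ((c.1 <= b.1) && (c.2 <= b.2)).

(** The boxes are listed in the order of their entries. With coordinates in [nat] the ambient type
    does not depend on [l], so boxes can be appended and deleted, unlike in [is_SYT]. *)
Definition tableau (l : seq nat) (s : seq box) :=
  [&& all (fun b => b.2 < rw l b.1) s, size s == sumn l & pairwise above s].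

Let above_irr : irreflexive above. Proof. by move=> b; rewrite /above !leqnn. Qed.

Let tableau_uniq l s : tableau l s -> uniq s.
Proof. by case/and3P => _ _; apply: pairwise_uniq. Qed.

Definition boxes (l : seq nat) : seq box :=
  [seq (i, j) | i <- iota 0 (size l), j <- iota 0 (rw l i)].

Lemma mem_boxes l b : (b \in boxes l) = (b.2 < rw l b.1).
Proof.
apply/allpairsPdep/idP => [[i [j [il jl ->]]]|h]; first by rewrite mem_iota in jl.
exists b.1, b.2; rewrite !mem_iota !add0n /=; split=> //; last by case: b h.
rewrite ltnNge; apply/negP => /(nth_default 0) E; by rewrite E in h.
Qed.

Lemma size_boxes l : size (boxes l) = sumn l.
Proof.
rewrite size_allpairs_dep; congr sumn; apply: (eq_from_nth (x0 := 0)).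
  by rewrite size_map size_iota.
move=> i; rewrite size_map size_iota => il.
by rewrite (nth_map 0) ?size_iota // nth_iota // size_iota.
Qed.

Let tableau_all l s b : tableau l s -> (b \in s) = (b.2 < rw l b.1).
Proof.
move=> ts; have us := tableau_uniq _ _ ts; case/and3P: ts => /allP sl /eqP ss _.
rewrite -mem_boxes.
have sub : {subset s <= boxes l} by move=> c cs; rewrite mem_boxes sl.
have le : size (boxes l) <= size s by rewrite size_boxes ss.
by have [_ ->] := uniq_min_size us sub le.
Qed.

(** No box weakly south-east of the box with the largest entry can precede it, so that box ends its
    row and its column. *)
Lemma tableau_rcons n l s b : is_partition n.+1 l ->
  tableau l (rcons s b) =
    [&& removable l b.1, b.2 == (rw l b.1).-1 & tableau (rembox l b.1) s].
Proof.
move=> pl; apply/idP/and3P => [ts|[rb /eqP eb ts]].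
  have al := tableau_all _ _ _ ts.
  have us := tableau_uniq _ _ ts; case/and3P: ts.
  rewrite all_rcons size_rcons pairwise_rcons (sumn_partition _ _ pl) => /andP[bl sl] /eqP[ss].
  move=> /andP[/allP ab ps].
  have nb c : c.2 < rw l c.1 -> b.1 <= c.1 -> b.2 <= c.2 -> c = b.
    move=> cl h1 h2; have := cl; rewrite -al mem_rcons inE => /orP[/eqP //|cs].
    by have := ab _ cs; rewrite /above h1 h2.
  have eb : b.2 = (rw l b.1).-1.
    have [h|h] := leqP (rw l b.1) b.2.+1; first by apply/eqP; rewrite eqn_leq; lia.
    by have /(congr1 snd) /= := nb (b.1, b.2.+1) h (leqnn _) (leqnSn _); lia.
  have rb : removable l b.1.
    rewrite /removable ltnNge; apply/negP => h.
    have /(congr1 fst) /= := nb (b.1.+1, b.2) (leq_trans bl h) (leqnSn _) (leqnn _); lia.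
  split=> //; first exact/eqP.
  apply/and3P; split=> //; last by rewrite (sumn_partition _ _ (rembox_partition _ _ pl _ rb)) ss.
  apply/allP => c cs; rewrite (rw_rembox _ _ pl) //.
  have cl := allP sl _ cs; have [e|_] := eqVneq c.1 b.1; last by rewrite subn0.
  have : c.2 != b.2.
    apply: contraTneq us => e2; rewrite rcons_uniq negb_and negbK.
    suff -> : b = c by rewrite cs.
    by rewrite [b]surjective_pairing [c]surjective_pairing e e2.
  by move: cl; rewrite eb e subn1; move: (c.2) (rw l b.1) => x y; lia.
have /and3P[/allP sr /eqP ss ps] := ts.
have bl : b.2 < rw l b.1 by rewrite eb; move: rb; rewrite /removable; lia.
have sr' c : c \in s -> c.2 < rw l c.1.
  by move/sr; rewrite (rw_rembox _ _ pl) // => /leq_trans -> //; exact: leq_subr.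
apply/and3P; split.
- by rewrite all_rcons bl; apply/allP.
- by rewrite size_rcons ss (sumn_partition _ _ pl) (sumn_partition _ _ (rembox_partition _ _ pl _ rb)).
- rewrite pairwise_rcons ps andbT; apply/allP => c cs; apply/negP => /andP[h1 h2].
  have := sr _ cs; rewrite (rw_rembox _ _ pl) //.
  have [e|ne] := eqVneq c.1 b.1; first by rewrite e; lia.
  have /(rw_antitone _ _ _ _ pl) h3 : b.1.+1 <= c.1 by rewrite ltn_neqAle eq_sym ne.
  rewrite subn0 => /(leq_ltn_trans h2)/leq_trans/(_ h3) h4.
  have := leq_ltn_trans h4 rb; rewrite eb.
  by case: (rw l b.1) => //= m; rewrite ltnn.
Qed.

Let untype m (t : seq ('I_m * 'I_m)) : seq box := [seq (val b.1, val b.2) | b <- t].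

Let untype_inj m : injective (@untype m).
Proof. by apply: inj_map => -[i j] [i' j'] [/val_inj -> /val_inj ->]. Qed.

Lemma is_SYT_tableau l (t : (sumn l).-tuple ('I_(sumn l) * 'I_(sumn l))) :
  is_SYT l t = tableau l (untype _ t).
Proof.
rewrite /is_SYT /tableau size_map size_tuple eqxx /= all_map.
have <- : pairwise above (untype _ t) = [forall k : 'I_(sumn l), forall m : 'I_(sumn l),
   (((tnth t m).1 <= (tnth t k).1) && ((tnth t m).2 <= (tnth t k).2))%N ==> (m <= k)%N].
  pose x0 : box := (0, 0).
  have nt (k : 'I_(sumn l)) : nth x0 (untype _ t) k = (val (tnth t k).1, val (tnth t k).2).
    rewrite (nth_map (tnth t k)) ?size_tuple //.
    by rewrite -(tnth_nth (tnth t k)).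
  apply/(pairwiseP x0)/'forall_'forall_implyP => [h k m h2|h k m].
    rewrite leqNgt; apply/negP => km.
    have := h k m; rewrite !inE !size_map !size_tuple => /(_ (ltn_ord _) (ltn_ord _) km).
    by rewrite !nt /above h2.
  rewrite !inE !size_map !size_tuple => kl ml km.
  have := h (Ordinal kl) (Ordinal ml); have := nt (Ordinal kl); have := nt (Ordinal ml).
  move=> /= -> -> h2; apply/negP => /h2; by rewrite leqNgt km.
case pw: (pairwise above _); rewrite ?andbF // !andbT.
by rewrite (map_uniq (pairwise_uniq above_irr pw)).
Qed.

Let syts l : seq (seq box) := [seq untype _ (tval t) | t in [pred t | is_SYT l t]].

Let mem_syts n l s : is_partition n l -> (s \in syts l) = tableau l s.
Proof.
move=> pl; apply/fintype.imageP/idP => [[t]|ts]; first by rewrite inE is_SYT_tableau => ? ->.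
(* The hook bound makes every box fit into the ordinals used by [is_SYT]. *)
have lt b : b \in s -> (b.1 < sumn l) && (b.2 < sumn l).
  rewrite (tableau_all _ _ _ ts) (sumn_partition _ _ pl) => bl.
  have := rw_partition_le _ _ b.1 pl; have := rw_add_index_le _ _ b.1 pl; lia.
have [m0|m_gt0] := posnP (sumn l).
  have s0 : s = [::] by apply: size0nil; case/and3P: ts => _ /eqP -> _.
  have e : size (Nil ('I_(sumn l) * 'I_(sumn l))) == sumn l by rewrite m0.
  by exists (Tuple e); rewrite ?inE ?is_SYT_tableau /= /untype /= -?s0.
pose o : 'I_(sumn l) := Ordinal m_gt0.
pose w := [seq (insubd o b.1, insubd o b.2) | b <- s].
have e : size w == sumn l by rewrite size_map; case/and3P: ts.
have ws : untype _ w = s.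
  rewrite /untype -map_comp -[RHS]map_id; apply/eq_in_map => b /lt /andP[b1 b2] /=.
  by rewrite !val_insubd b1 b2; case: b {b1 b2}.
by exists (Tuple e); rewrite ?inE ?is_SYT_tableau /= ws.
Qed.

Let uniq_syts l : uniq (syts l).
Proof.
by rewrite map_inj_uniq ?enum_uniq // => t t' /untype_inj /val_inj.
Qed.

Let size_syts l : size (syts l) = dimY l.
Proof. by rewrite size_image /dimY; apply: eq_card => t; rewrite !inE; apply/idP/idP; rewrite ?inE. Qed.

Lemma dimY_nil : dimY [::] = 1.
Proof.
rewrite -size_syts; have : perm_eq (syts [::]) [:: [::]].
  apply: uniq_perm => // s; rewrite (mem_syts 0) // inE.
  by apply/idP/eqP => [/and3P[_ /eqP/size0nil]|->].
by move/perm_size.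
Qed.

(** The branching rule: tableaux are sorted by the row of their last box. *)
Lemma dimY_rec n l N : is_partition n.+1 l -> n < N ->
  dimY l = \sum_(i < N | removable l i) dimY (rembox l i).
Proof.
move=> pl nN; rewrite -size_syts.
pose f i := [seq rcons s (i, (rw l i).-1) | s <- syts (rembox l i)].
have : perm_eq (syts l) (flatten [seq f i | i <- [seq i <- iota 0 N | removable l i]]).
  apply: uniq_perm => //.
    apply: (allpairs_uniq_dep (f := fun i s => rcons s (i, (rw l i).-1))) => //.
    - by rewrite filter_uniq // iota_uniq.
    - by move=> [i s] [j t] _ _ /= /rcons_inj[<- <-].
  move=> s; rewrite (mem_syts _ _ _ pl); apply/idP/flattenP => [ts|[_ /mapP[i + ->]]].
    have [s' [b E]] : exists s' b, s = rcons s' b.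
      case/lastP: s ts => [/and3P[_ /eqP]|s' b _]; last by exists s', b.
      by rewrite (sumn_partition _ _ pl).
    have := ts; rewrite E (tableau_rcons n) // => /and3P[rb /eqP eb ts'].
    exists (f b.1); first apply: map_f.
      rewrite mem_filter rb mem_iota /= add0n.
      apply: leq_trans (removable_lt _ _ rb) (leq_trans (size_partition _ _ pl) nN).
    apply/mapP; exists s'; last by rewrite -eb -surjective_pairing.
    by rewrite (mem_syts _ _ _ (rembox_partition _ _ pl _ rb)).
  rewrite mem_filter => /andP[ri _] /mapP[s']; rewrite (mem_syts _ _ _ (rembox_partition _ _ pl _ ri)).
  by move=> ts' ->; rewrite (tableau_rcons n) //= ri eqxx.
move/perm_size ->; rewrite size_flatten /shape -map_comp sumnE big_map big_filter.
rewrite -(big_mkord (removable l) (fun i => dimY (rembox l i))) /index_iota subn0.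
by apply: eq_bigr => i _; rewrite /f /= size_map size_syts.
Qed.

End StandardTableaux.

Section FrobeniusFormula.
Variable F : realFieldType.

Definition vdm N (a : 'I_N -> F) := \prod_(i < N) \prod_(j < N | (i < j)%N) (a i - a j).

(** Only the factors that involve [k] change. The cross-multiplied form avoids divisions by
    differences of nodes. *)
Lemma vdm_shift N (a b : 'I_N -> F) k : (forall j, j != k -> b j = a j) ->
  vdm _ b * \prod_(j | j != k) (a k - a j) = vdm _ a * \prod_(j | j != k) (b k - a j).
Proof.
move=> ba.
(* The pairs are sorted into those avoiding [k], those with [k] as first index, and those with [k]
   as second index. *)
have split_vdm (c : 'I_N -> F) : vdm _ c =
    \prod_(i | i != k) \prod_(j < N | (i < j)%N && (j != k)) (c i - c j) *
    (\prod_(j < N | (k < j)%N) (c k - c j) * \prod_(i < N | (i < k)%N) (c i - c k)).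
  rewrite /vdm (bigD1 k) //= [RHS]mulrCA; congr (_ * _).
  have -> : \prod_(i < N | (i < k)%N) (c i - c k) =
            \prod_(i | i != k) (if (i < k)%N then c i - c k else 1).
    rewrite -big_mkcondr; apply: eq_bigl => i; rewrite -val_eqE /=; lia.
  rewrite -big_split; apply: eq_bigr => i ik /=.
  have [ltik|leki] := ltnP i k.
    rewrite (bigD1 k) //= mulrC; congr (_ * _).
  rewrite mulr1; apply: eq_bigl => j; rewrite -val_eqE /=; lia.
have split_ne (c : 'I_N -> F) : \prod_(j | j != k) c j =
    \prod_(j < N | (k < j)%N) c j * \prod_(j < N | (j < k)%N) c j.
  rewrite (bigID (fun j : 'I_N => (k < j)%N)) /=; congr (_ * _);
    apply: eq_bigl => j; rewrite -val_eqE /=; lia.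
have eS : \prod_(i < N | i != k) \prod_(j < N | (i < j)%N && (j != k)) (b i - b j) =
          \prod_(i < N | i != k) \prod_(j < N | (i < j)%N && (j != k)) (a i - a j).
  by apply: eq_bigr => i ik; apply: eq_bigr => j /andP[_ jk]; rewrite !ba.
have e1 : \prod_(j < N | (k < j)%N) (b k - b j) = \prod_(j < N | (k < j)%N) (b k - a j).
  by apply: eq_bigr => j kj; rewrite (ba j) // -val_eqE /= gtn_eqF.
have e2 : \prod_(i < N | (i < k)%N) (b i - b k) * \prod_(j < N | (j < k)%N) (a k - a j) =
          \prod_(i < N | (i < k)%N) (a i - a k) * \prod_(j < N | (j < k)%N) (b k - a j).
  rewrite -!big_split /=; apply: eq_bigr => j jk.
  by rewrite (ba j); [ring | rewrite -val_eqE /= ltn_eqF].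
rewrite !split_vdm (split_ne (fun j => a k - a j)) (split_ne (fun j => b k - a j)) eS e1.
move: e2; set Y := \prod_(i < N | _) (b i - _).
set Z := \prod_(j < N | (j < k)%N) (a k - _); set W := \prod_(j < N | (j < k)%N) (b k - _).
set U := \prod_(j < N | (j < k)%N) (a j - _) => e2.
set S := \prod_(i < N | i != k) _; set P := \prod_(j < N | (k < j)%N) (b k - _).
set Q := \prod_(j < N | (k < j)%N) (a k - _).
transitivity (S * P * Q * (Y * Z)); [ring | rewrite e2; ring].
Qed.

(** The shift by the staircase makes the rows strictly decreasing, hence usable as distinct
    interpolation nodes. *)
Definition ell N (l : seq nat) (i : nat) : nat := (rw l i + (N.-1 - i))%N.
Definition ellF N (l : seq nat) (i : 'I_N) : F := (ell N l i)%:R.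

Lemma ell_lt N n l i j : is_partition n l -> (i < j < N)%N -> (ell N l j < ell N l i)%N.
Proof.
move=> pl /andP[ij jN]; have := rw_antitone _ _ _ _ pl (ltnW ij).
by rewrite /ell; lia.
Qed.

Lemma ellF_inj N n l : is_partition n l -> injective (ellF N l).
Proof.
move=> pl i j /eqP; rewrite eqr_nat => /eqP E; apply/val_inj.
case: (ltngtP i j) => // ij.
  by have := ell_lt N _ _ i j pl; rewrite ij ltn_ord E ltnn => /(_ isT).
by have := ell_lt N _ _ j i pl; rewrite ij ltn_ord E ltnn => /(_ isT).
Qed.

Lemma vdm_ellF_gt0 N n l : is_partition n l -> 0 < vdm _ (ellF N l).
Proof.
move=> pl; apply: prodr_gt0 => i _; apply: prodr_gt0 => j ij.
by rewrite subr_gt0 ltr_nat (ell_lt _ _ _ _ _ pl) // ij ltn_ord.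
Qed.

Lemma sum_ellF N n l : is_partition n l -> (size l <= N)%N ->
  \sum_i ellF N l i = n%:R + N%:R * (N%:R - 1) / 2.
Proof.
move=> pl lN; rewrite /ellF /ell -natr_sum big_split /= -(sumn_rw _ _ lN).
rewrite (sumn_partition _ _ pl) natrD; congr (_ + _).
rewrite (reindex_inj rev_ord_inj) /=.
rewrite (eq_bigr (fun i : 'I_N => i : nat)) => [|i _]; last by have := ltn_ord i; lia.
have := bin2_sum N; rewrite -(big_mkord xpredT id) => ->.
have : (2 * 'C(N, 2))%N%:R = N%:R * (N%:R - 1) :> F.
  have -> : (2 * 'C(N, 2) = N ^_ 2)%N by rewrite -bin_ffact mulnC.
  by rewrite ffactnS ffactn1; case: (N) => [|M]; rewrite ?mul0n ?mul0r // natrM -natr1 addrK.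
by rewrite natrM => E; lra.
Qed.

Let fctp N l : F := \prod_(i < N) (ell N l i)`!%:R.

Let fctp_gt0 N l : 0 < fctp N l.
Proof. by apply: prodr_gt0 => i _; rewrite ltr0n fact_gt0. Qed.

Section Shift.
Variables (N n : nat) (l : seq nat).
Hypothesis pl : is_partition n l.

Lemma ellF_addbox (i j : 'I_N) : addable l i ->
  ellF N (addbox l i) j = ellF N l j + (j == i)%:R.
Proof. by move=> al; rewrite /ellF /ell (rw_addbox _ _ pl) // -natrD addnAC. Qed.

Lemma ellF_rembox (i j : 'I_N) : removable l i ->
  ellF N (rembox l i) j = ellF N l j - (j == i)%:R.
Proof.
move=> ri; have [ai E] := remboxK _ _ _ pl ri.
have pr := rembox_partition _ _ pl _ ri.
by rewrite -[in RHS]E /ellF /ell (rw_addbox _ _ pr) // addnAC [in RHS]natrD addrK.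
Qed.

Lemma vdm_rembox (i : 'I_N) : removable l i ->
  vdm _ (ellF N l) * downw F N (ellF N l) i = ellF N l i * vdm _ (ellF N (rembox l i)).
Proof.
move=> ri.
have h : forall j, j != i -> ellF N (rembox l i) j = ellF N l j.
  by move=> j ji; rewrite ellF_rembox // (negbTE ji) subr0.
have := vdm_shift _ _ _ _ h; rewrite ellF_rembox // eqxx => E.
have d0 := lagden_neq0 _ _ _ (ellF_inj N _ _ pl) i.
rewrite /downw prodf_div mulrCA; congr (_ * _); apply: (mulIf d0).
by rewrite E /lagden -[LHS]mulrA mulfVK.
Qed.

Lemma vdm_addbox (i : 'I_N) : addable l i ->
  vdm _ (ellF N l) * upw F N (ellF N l) i = (ellF N l i + 1)^-1 * vdm _ (ellF N (addbox l i)).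
Proof.
move=> ri.
have h : forall j, j != i -> ellF N (addbox l i) j = ellF N l j.
  by move=> j ji; rewrite ellF_addbox // (negbTE ji) addr0.
have := vdm_shift _ _ _ _ h; rewrite ellF_addbox // eqxx => E.
have d0 := lagden_neq0 _ _ _ (ellF_inj N _ _ pl) i.
rewrite /upw prodf_div mulrCA; congr (_ * _); apply: (mulIf d0).
by rewrite E /lagden -[LHS]mulrA mulfVK.
Qed.

Lemma fctp_addbox (i : 'I_N) : addable l i ->
  fctp N (addbox l i) = (ellF N l i + 1) * fctp N l.
Proof.
move=> ai; rewrite /fctp (bigD1 i) //= [in RHS](bigD1 i) //= mulrA; congr (_ * _).
  by rewrite /ell (rw_addbox _ _ pl) // eqxx addnAC addn1 factS natrM -natr1.
by apply: eq_bigr => j; rewrite -val_eqE /= /ell (rw_addbox _ _ pl) // => /negbTE ->; rewrite addn0.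
Qed.

(** If row [i] is as long as the next one, their shifted rows differ by exactly one and a numerator
    vanishes; for the last index the shifted row itself is zero. *)
Lemma downw_eq0 (i : 'I_N) : (size l <= N)%N -> ~~ removable l i -> downw F N (ellF N l) i = 0.
Proof.
move=> lN ri; have E : rw l i.+1 = rw l i.
  by have := rw_antitone _ _ i i.+1 pl (leqnSn i); move: ri; rewrite /removable; lia.
have [iN|Ni] := ltnP i.+1 N.
  rewrite /downw (bigD1 (Ordinal iN)) ?mulrA //=; last by rewrite -val_eqE /= gtn_eqF.
  rewrite [X in X / _](_ : _ = 0) ?mul0r ?mulr0 ?mul0r // /ellF /ell /= E.
  rewrite (_ : N.-1 - i = (N.-1 - i.+1).+1)%N; last by lia.
  by rewrite addnS -natr1; ring.
rewrite /downw (_ : ellF N l i = 0) ?mul0r // /ellF /ell -E nth_default ?(leq_trans lN) //.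
by have := ltn_ord i; rewrite (_ : N.-1 - i = 0)%N //; lia.
Qed.

Lemma upw_eq0 (i : 'I_N) : ~~ addable l i -> upw F N (ellF N l) i = 0.
Proof.
case: i => -[|i] iN //; rewrite /addable /= => ri; have E : rw l i.+1 = rw l i.
  by have := rw_antitone _ _ i i.+1 pl (leqnSn i); move: ri; lia.
have iN' : (i < N)%N by apply: ltnW.
rewrite /upw (bigD1 (Ordinal iN')) ?mulrA //=; last by rewrite -val_eqE /= ltn_eqF.
rewrite [X in X / _](_ : _ = 0) ?mul0r ?mulr0 ?mul0r // /ellF /ell /= E.
rewrite (_ : N.-1 - i = (N.-1 - i.+1).+1)%N; last by lia.
by rewrite addnS -natr1; ring.
Qed.

End Shift.

(* The normalisation constant of Frobenius' formula is left unevaluated: only ratios matter. *)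
Lemma dimY_formula N n l : is_partition n l -> (n <= N)%N ->
  (dimY l)%:R * fctp N l * vdm _ (ellF N [::]) = n`!%:R * vdm _ (ellF N l) * fctp N [::].
Proof.
elim: n l => [|n IH] l pl nN.
  have -> : l = [::] by apply: size0nil; apply/eqP; rewrite -leqn0 (size_partition _ _ pl).
  by rewrite dimY_nil !mul1r mulrC.
have lN := leq_trans (size_partition _ _ pl) nN.
have step (i : 'I_N) : removable l i ->
    (dimY (rembox l i))%:R * fctp N l * vdm _ (ellF N [::]) =
    n`!%:R * (vdm _ (ellF N l) * downw F N (ellF N l) i) * fctp N [::].
  move=> ri; have pr := rembox_partition _ _ pl _ ri.
  have [ai E] := remboxK _ _ _ pl ri.
  rewrite -{2}E (fctp_addbox _ _ _ pr) // (vdm_rembox _ _ _ pl) //.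
  rewrite (ellF_rembox _ _ _ pl) // eqxx subrK.
  rewrite [_ * (_ * _)]mulrCA -!mulrA; have := IH _ pr (ltnW nN).
  by rewrite -!mulrA => ->; ring.
rewrite (dimY_rec n l N pl nN) natr_sum !mulr_suml (eq_bigr _ step).
rewrite -mulr_suml -mulr_sumr -mulr_sumr; congr (_ * _).
rewrite mulrCA [RHS]mulrC; congr (_ * _).
have -> : \sum_(i < N | removable l i) downw F N (ellF N l) i = \sum_i downw F N (ellF N l) i.
  rewrite [RHS](bigID (fun i : 'I_N => removable l i)) /= [X in _ + X]big1 ?addr0 // => i.
  exact: (downw_eq0 N n.+1).
(* The weights of a diagram with [n.+1] boxes add up to [n.+1], which is the quotient of the two
   factorials. *)
rewrite sum_downw; last exact: (ellF_inj N n.+1).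
by rewrite (sum_ellF N n.+1) // addrK factS natrM mulrC.
Qed.

Lemma dimY_gt0 n l : is_partition n l -> (0 < dimY l)%N.
Proof.
move=> pl; have := dimY_formula n n l pl (leqnn _).
case: (dimY l) => // /esym/eqP; rewrite !mul0r gt_eqF //.
by rewrite !mulr_gt0 ?(vdm_ellF_gt0 _ _ _ pl) // ltr0n fact_gt0.
Qed.

Lemma dimY_rembox N n l (i : 'I_N) : is_partition n.+1 l -> (n < N)%N -> removable l i ->
  n.+1%:R * (dimY (rembox l i))%:R / (dimY l)%:R = downw F N (ellF N l) i.
Proof.
move=> pl nN ri; have pr := rembox_partition _ _ pl _ ri.
have [ai E] := remboxK _ _ _ pl ri.
have f1 := dimY_formula N _ _ pl nN; have f2 := dimY_formula N _ _ pr (ltnW nN).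
have v0 := vdm_ellF_gt0 N 0 [::] isT; have v1 := vdm_ellF_gt0 N _ _ pl.
have c0 := fctp_gt0 N [::]; have c1 := fctp_gt0 N l.
have d0 : 0 < (dimY l)%:R :> F by rewrite ltr0n (dimY_gt0 _ _ pl).
have n0 : 0 < n`!%:R :> F by rewrite ltr0n fact_gt0.
apply: (mulfI (lt0r_neq0 v1)); rewrite (vdm_rembox _ _ _ pl) //.
apply: (mulfI (lt0r_neq0 n0)); apply: (mulfI (lt0r_neq0 c0)).
have -> : fctp N [::] * (n`!%:R * (ellF N l i * vdm N (ellF N (rembox l i)))) =
          ellF N l i * (n`!%:R * vdm N (ellF N (rembox l i)) * fctp N [::]) by ring.
have e1 := ellF_addbox N _ _ pr i i ai; have f3 := fctp_addbox N _ _ pr i ai.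
rewrite E ?eqxx in e1 f3; rewrite -f2 e1.
set r' := rembox l i in e1 f3 *.
have -> : (ellF N r' i + 1) * ((dimY r')%:R * fctp N r' * vdm N (ellF N [::])) =
          (dimY r')%:R * fctp N l * vdm N (ellF N [::]) by rewrite f3; ring.
have -> : fctp N [::] * (n`!%:R * (vdm N (ellF N l) * (n.+1%:R * (dimY r')%:R / (dimY l)%:R))) =
          (dimY r')%:R / (dimY l)%:R * (n.+1`!%:R * vdm N (ellF N l) * fctp N [::]).
  by rewrite factS natrM; ring.
by rewrite -f1; field; rewrite gt_eqF.
Qed.

Lemma dimY_addbox N n l (i : 'I_N) : is_partition n l -> (n < N)%N -> addable l i ->
  (dimY (addbox l i))%:R / (n.+1%:R * (dimY l)%:R) = upw F N (ellF N l) i.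
Proof.
move=> pl nN ai; have pa := addbox_partition _ _ pl _ ai.
have f1 := dimY_formula N _ _ pl (ltnW nN); have f2 := dimY_formula N _ _ pa nN.
have v0 := vdm_ellF_gt0 N 0 [::] isT; have v1 := vdm_ellF_gt0 N _ _ pl.
have c0 := fctp_gt0 N [::]; have c1 := fctp_gt0 N l.
have d0 : 0 < (dimY l)%:R :> F by rewrite ltr0n (dimY_gt0 _ _ pl).
have n0 : 0 < n.+1`!%:R :> F by rewrite ltr0n fact_gt0.
have e0 : 0 < ellF N l i + 1 by rewrite ltr_wpDl // /ellF ler0n.
apply: (mulfI (lt0r_neq0 v1)); rewrite (vdm_addbox _ _ _ pl) //.
apply: (mulfI (lt0r_neq0 n0)); apply: (mulfI (lt0r_neq0 c0)).
have -> : fctp N [::] * (n.+1`!%:R * ((ellF N l i + 1)^-1 * vdm N (ellF N (addbox l i)))) =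
          (ellF N l i + 1)^-1 * (n.+1`!%:R * vdm N (ellF N (addbox l i)) * fctp N [::]) by ring.
rewrite -f2 (fctp_addbox _ _ _ pl) //.
have -> : fctp N [::] * (n.+1`!%:R * (vdm N (ellF N l) * ((dimY (addbox l i))%:R / (n.+1%:R * (dimY l)%:R)))) =
          (dimY (addbox l i))%:R / (dimY l)%:R * (n`!%:R * vdm N (ellF N l) * fctp N [::]).
  have n1 : n.+1%:R != 0 :> F by rewrite pnatr_eq0.
  rewrite factS natrM; move: n.+1%:R n1 => m m0; field.
  by rewrite m0 gt_eqF.
by rewrite -f1; field; rewrite !gt_eqF.
Qed.

End FrobeniusFormula.

(** * Transition and co-transition moments *)

Section Contents.
Variable F : realFieldType.

(** Contents of the box that row [i] could gain and of its last box: the shifted row minus [N.-1],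
    respectively minus [N]. *)
Definition upc (l : seq nat) (i : nat) : F := (rw l i)%:R - i%:R.
Definition downc (l : seq nat) (i : nat) : F := (rw l i)%:R - i%:R - 1.

Section Moments.
Variables (n N : nat) (l : seq nat).
Hypotheses (pl : is_partition n l) (nN : (n < N)%N).

Let a := ellF F N l.
Let rho := upw F N a.
Let pi := downw F N a.
Definition upmoment (m : nat) : F := \sum_(i < N) rho i * upc l i ^+ m.
Definition downmoment (m : nat) : F := \sum_(i < N) pi i * downc l i ^+ m.

Let a_inj : injective a. Proof. exact: (ellF_inj _ _ n). Qed.
Let lN : (size l <= N)%N. Proof. exact: leq_trans (size_partition _ _ pl) (ltnW nN). Qed.

Let aE (i : 'I_N) : a i = upc l i + N.-1%:R.
Proof.
rewrite /a /ellF /ell /upc natrD natrB; first by ring.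
by have := ltn_ord i; lia.
Qed.

Let NS : N.-1%:R + 1 = N%:R :> F.
Proof. by rewrite natr1 prednK // (leq_ltn_trans _ nN). Qed.

Let N1 : (N.-1 < N)%N. Proof. by rewrite prednK // (leq_ltn_trans _ nN). Qed.
Let i0 : 'I_N := Ordinal N1.

Let a_i0 : a i0 = 0.
Proof.
rewrite /a /ellF /ell /= subnn addn0 nth_default //.
by rewrite (leq_trans (size_partition _ _ pl)) // -ltnS prednK // (leq_ltn_trans _ nN).
Qed.

Let a_ge0 i : 0 <= a i. Proof. exact: ler0n. Qed.

Lemma sum_upweights : \sum_i rho i = 1.
Proof. exact: (sum_upw _ _ _ a_inj _ a_i0 a_ge0). Qed.

Lemma sum_downweights : \sum_i pi i = n%:R.
Proof. by rewrite sum_downw // (sum_ellF _ _ n) // addrK. Qed.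

Lemma upweight_ge0 i : 0 <= rho i.
Proof.
have [ai|nai] := boolP (addable l i); last by rewrite /rho (upw_eq0 _ _ n).
by rewrite /rho -(dimY_addbox _ _ n) // divr_ge0 // ?mulr_ge0.
Qed.

Lemma downweight_ge0 i : 0 <= pi i.
Proof.
have [ai|nai] := boolP (removable l i); last by rewrite /pi (downw_eq0 _ _ n).
case: n pl nN => [|n'] pl' nN'.
  have E : l = [::] by apply: size0nil; apply/eqP; rewrite -leqn0 (size_partition _ _ pl').
  by move: ai; rewrite E /removable !nth_nil.
by rewrite /pi -(dimY_rembox _ _ n') // ?mulr_ge0 ?invr_ge0 // ltnW.
Qed.

Lemma upc_norm_le (i : nat) : addable l i -> `|upc l i| <= n%:R.
Proof.
move=> ai; have := rw_partition_le _ _ i pl; rewrite -(ler_nat F).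
have := leq_trans (addable_le _ _ _ pl ai) (size_partition _ _ pl); rewrite -(ler_nat F).
have : 0 <= i%:R :> F by []. have : 0 <= (rw l i)%:R :> F by [].
by rewrite /upc ler_norml; lra.
Qed.

Lemma downc_norm_le (i : nat) : removable l i -> `|downc l i| <= n%:R.
Proof.
move=> ri; have r0 : (0 < rw l i)%N by move: ri; rewrite /removable; case: (rw l i).
have := rw_add_index_le _ _ _ pl r0; rewrite -(ler_nat F) natrD.
have : 1 <= (rw l i)%:R :> F by rewrite ler1n.
have : 0 <= i%:R :> F by [].
by rewrite /downc ler_norml; lra.
Qed.

(** This is [sum_downw_fraction] at [a i + 1]. A nonzero [rho i] is what guarantees that this point
    is not a node. *)
Let rho_frac (i : 'I_N) : rho i * upc l i = \sum_k rho i * pi k / (upc l i - downc l k).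
Proof.
have [->|r0] := eqVneq (rho i) 0; first by rewrite mul0r big1 // => k _; rewrite !mul0r.
have ne j : a i + 1 != a j.
  have [->|ji] := eqVneq j i.
    by rewrite -subr_eq0 addrAC subrr add0r oner_eq0.
  move: r0; rewrite /rho /upw mulf_eq0 negb_or => /andP[_ /prodf_neq0/(_ _ ji)].
  by rewrite mulf_eq0 negb_or => /andP[+ _]; rewrite subr_eq0.
have := sum_downw_fraction _ _ _ a_inj _ ne (ex_intro _ i erefl).
move=> E.
rewrite {1}(_ : upc l i = \sum_k pi k / (a i + 1 - a k)); last first.
  by rewrite E aE -NS; ring.
rewrite mulr_sumr; apply: eq_bigr => k _; rewrite mulrA; congr (_ / _).
by rewrite !aE /downc /upc; ring.
Qed.

(** The dual identity, [sum_upw_fraction] at [a k - 1], which is not a node when [pi k] is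
    nonzero. *)
Let pi_frac (k : 'I_N) : \sum_i rho i * pi k / (upc l i - downc l k) = 0.
Proof.
have [->|p0] := eqVneq (pi k) 0; first by rewrite big1 // => i _; rewrite mulr0 mul0r.
have ne j : a k - 1 != a j.
  have [->|jk] := eqVneq j k.
    by rewrite -subr_eq0 addrAC subrr add0r oppr_eq0 oner_eq0.
  move: p0; rewrite /pi /downw mulf_eq0 negb_or => /andP[_ /prodf_neq0/(_ _ jk)].
  by rewrite mulf_eq0 negb_or => /andP[+ _]; rewrite subr_eq0.
have ki0 : k != i0.
  by apply: contraNneq p0 => ->; rewrite /pi /downw a_i0 mul0r.
have := sum_upw_fraction _ _ _ a_inj _ a_i0 a_ge0 _ ne (ex_intro2 _ _ k ki0 erefl).
move=> E; transitivity (- pi k * \sum_i upw F N a i / (a k - 1 - a i)); last by rewrite E mulr0.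
rewrite mulr_sumr; apply: eq_bigr => i _.
rewrite !aE -/rho [X in _ = _ * (_ / X)](_ : _ = - (upc l i - downc l k)); last first.
  by rewrite /downc /upc; ring.
by rewrite invrN; ring.
Qed.

(* Kerov's relation between the transition and co-transition moments of a diagram. *)
Lemma kerov_moments m :
  upmoment m.+1 = \sum_(s < m) upmoment (m.-1 - s) * downmoment s.
Proof.
(* One factor [upc l i] is traded for the double sum of [rho_frac]. Subtracting the null double sum
   [Z] then leaves the divided difference of [x ^+ m], which is a polynomial. *)
have L : upmoment m.+1 = \sum_i \sum_k rho i * pi k / (upc l i - downc l k) * upc l i ^+ m.
  apply: eq_bigr => i _; rewrite exprS mulrA rho_frac mulr_suml.
  by apply: eq_bigr.
have Z : \sum_i \sum_k rho i * pi k / (upc l i - downc l k) * downc l k ^+ m = 0.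
  rewrite exchange_big big1 //= => k _.
  by rewrite -mulr_suml pi_frac mul0r.
rewrite L -[LHS]subr0 -[X in _ - X = _]Z -sumrB.
have -> : \sum_(s < m) upmoment (m.-1 - s) * downmoment s =
  \sum_i \sum_k rho i * pi k * \sum_(s < m) upc l i ^+ (m.-1 - s) * downc l k ^+ s.
  transitivity (\sum_(s < m) \sum_i \sum_k rho i * pi k * (upc l i ^+ (m.-1 - s) * downc l k ^+ s)).
    apply: eq_bigr => s _; rewrite /upmoment mulr_suml; apply: eq_bigr => i _.
    by rewrite /downmoment mulr_sumr; apply: eq_bigr => k _; ring.
  rewrite exchange_big; apply: eq_bigr => i _; rewrite exchange_big; apply: eq_bigr => k _.
  by rewrite mulr_sumr.
apply: eq_bigr => i _; rewrite -sumrB; apply: eq_bigr => k _.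
have [->|r0] := eqVneq (rho i * pi k) 0; first by rewrite !mul0r subrr.
rewrite -mulrBr -[_ / _ * _]mulrA; congr (_ * _).
rewrite subrXX mulKf //.

(* The cancelled denominator has to be nonzero: nonzero weights make row [i] addable and row [k]
   removable, and such corners never share a content. *)
move: r0; rewrite mulf_eq0 negb_or => /andP[r0 p0].
have [ai|nai] := boolP (addable l i); last by rewrite /rho (upw_eq0 _ _ n) ?eqxx in r0.
have [rk|nrk] := boolP (removable l k); last by rewrite /pi (downw_eq0 _ _ n) ?eqxx in p0.
rewrite /upc /downc.
have -> : (rw l i)%:R - i%:R - ((rw l k)%:R - k%:R - 1) = (rw l i + k.+1)%:R - (rw l k + i)%:R :> F.
  by rewrite !natrD -natr1; ring.
rewrite subr_eq0 eqr_nat; apply/eqP => E.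
have [ik|ki] := leqP i k.
  by have := rw_antitone _ _ _ _ pl ik; lia.
have := rw_antitone _ _ k.+1 i pl ki; move: rk ai; rewrite /removable /addable.
case: (val i) ki E => // i' ki E /=.
have [e|ne] := eqVneq i' k; first by rewrite e in E; lia.
have : (k.+1 <= i')%N by rewrite ltn_neqAle eq_sym ne.
by move=> /(rw_antitone _ _ _ _ pl); lia.
Qed.

Lemma upmoment1 : upmoment 1 = 0.
Proof. by rewrite kerov_moments big_ord0. Qed.

Lemma upmoment0 : upmoment 0 = 1.
Proof. by rewrite -sum_upweights; apply: eq_bigr => i _; rewrite mulr1. Qed.

Lemma downmoment0 : downmoment 0 = n%:R.
Proof. by rewrite -sum_downweights; apply: eq_bigr => i _; rewrite mulr1. Qed.

Lemma upmoment2 : upmoment 2 = n%:R.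
Proof. by rewrite kerov_moments big_ord1 upmoment0 downmoment0 mul1r. Qed.

(** Splitting off a square and using that the second moment is exactly [n] saves one power of [n]
    over the bound from the size of contents. *)
Lemma upmoment_le m : `|upmoment m.+1| <= n%:R ^+ m.
Proof.
case: m => [|m]; first by rewrite upmoment1 normr0.
rewrite exprS -{1}upmoment2 mulr_suml (le_trans (ler_norm_sum _ _ _)) //.
apply: ler_sum => i _; have [ai|nai] := boolP (addable l i); last first.
  by rewrite /rho (upw_eq0 _ _ n) // !mul0r normr0.
rewrite normrM (ger0_norm (upweight_ge0 i)) -[X in _ <= X]mulrA.
apply: ler_wpM2l; first exact: upweight_ge0.
rewrite (_ : m.+2 = 2 + m)%N // exprD normrM (ger0_norm (sqr_ge0 _)).
by apply: ler_wpM2l; rewrite ?sqr_ge0 // normrX lerXn2r ?nnegrE // upc_norm_le.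
Qed.

Lemma downmoment_le m : `|downmoment m| <= n%:R ^+ m.+1.
Proof.
rewrite exprS -{1}downmoment0 mulr_suml (le_trans (ler_norm_sum _ _ _)) //.
apply: ler_sum => i _; have [ai|nai] := boolP (removable l i); last first.
  by rewrite /pi (downw_eq0 _ _ n) // !mul0r normr0.
rewrite normrM (ger0_norm (downweight_ge0 i)) -[X in _ <= X]mulrA.
apply: ler_wpM2l; first exact: downweight_ge0.
by rewrite expr0 mul1r normrX lerXn2r ?nnegrE // downc_norm_le.
Qed.

(** The last term of Kerov's sum is [downmoment m] itself, because the zeroth transition moment is
    [1]; each of the [m] other terms is at most [n ^ m]. This is the cancellation behind the drift
    estimate, since [downmoment m] alone is only bounded by [n ^ (m + 1)]. *)
Lemma upmoment_downmoment m : `|upmoment m.+2 - downmoment m| <= m%:R * n%:R ^+ m.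
Proof.
rewrite kerov_moments big_ord_recr /= subnn upmoment0 mul1r addrK.
rewrite (le_trans (ler_norm_sum _ _ _)) //.
rewrite mulr_natl -[X in _ *+ X](card_ord m) -sumr_const; apply: ler_sum => s _.
have sm := ltn_ord s.
rewrite normrM (_ : m - s = (m - s.+1).+1)%N; last by lia.
rewrite [in X in _ <= X](_ : m = m - s.+1 + s.+1)%N; last by lia.
by rewrite exprD ler_pM // ?upmoment_le ?downmoment_le.
Qed.

End Moments.
End Contents.

(** * Drift of content power sums under one up-down step *)

Section UpDownChain.
Variable F : realFieldType.
Local Notation upc := (upc F).
Local Notation downc := (downc F).

Definition csum (g : F -> F) (l : seq nat) : F :=
  \sum_(i < size l) \sum_(j < rw l i) g (j%:R - i%:R).

Lemma csumE g l N : (size l <= N)%N ->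
  csum g l = \sum_(i < N) \sum_(j < rw l i) g (j%:R - i%:R).
Proof.
move=> lN; rewrite /csum (big_ord_widen _ (fun i => \sum_(j < rw l i) g (j%:R - i%:R)) lN).
rewrite [RHS](bigID (fun i : 'I_N => (i < size l)%N)) /= [X in _ + X]big1 ?addr0 // => i.
by rewrite -leqNgt => li; rewrite nth_default // big_ord0.
Qed.

Lemma csum_addbox g n l i : is_partition n l -> addable l i ->
  csum g (addbox l i) = csum g l + g (upc l i).
Proof.
move=> pl al; have pa := addbox_partition _ _ pl _ al.
pose N := (size l).+1; have iN : (i < N)%N by rewrite ltnS (addable_le _ _ _ pl).
have aN : (size (addbox l i) <= N)%N.
  rewrite leqNgt -(rw_gt0 _ _ _ pa) (rw_addbox _ _ pl) // nth_default //.
  by rewrite gtn_eqF.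
rewrite (csumE _ _ _ aN) (csumE _ _ N) // (bigD1 (Ordinal iN)) //= [in RHS](bigD1 (Ordinal iN)) //=.
rewrite (rw_addbox _ _ pl) // eqxx addn1 big_ord_recr /= -/(upc l i).
rewrite -!addrA; congr (_ + _); rewrite addrC; congr (_ + _).
apply: eq_bigr => j; rewrite -val_eqE /= (rw_addbox _ _ pl) // => /negbTE ->.
by rewrite addn0.
Qed.

Lemma upc_rembox n l k : is_partition n l -> removable l k ->
  upc (rembox l k) k = downc l k.
Proof.
move=> pl rk; rewrite /upc /downc (rw_rembox _ _ pl) // eqxx natrB /=; first by ring.
by move: rk; rewrite /removable; case: (rw l k).
Qed.

Lemma csum_rembox g n l k : is_partition n l -> removable l k ->
  csum g (rembox l k) = csum g l - g (downc l k).
Proof.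
move=> pl rk; have pr := rembox_partition _ _ pl _ rk; have [ak E] := remboxK _ _ _ pl rk.
by rewrite -{2}E (csum_addbox _ _ _ _ pr) // (upc_rembox _ _ _ pl) // addrK.
Qed.

Lemma csum_norm_le g n l (C : F) : is_partition n l ->
  (forall c, `|c| <= n%:R -> `|g c| <= C) -> `|csum g l| <= n%:R * C.
Proof.
move=> pl gC; rewrite -(sumn_partition _ _ pl) (sumn_rw _ _ (leqnn _)) natr_sum mulr_suml.
rewrite (le_trans (ler_norm_sum _ _ _)) //; apply: ler_sum => i _.
have -> : (rw l i)%:R * C = \sum_(j < rw l i) C by rewrite sumr_const card_ord mulr_natl.
rewrite (le_trans (ler_norm_sum _ _ _)) //; apply: ler_sum => j _; apply: gC.
have r0 : (0 < rw l i)%N by rewrite (leq_ltn_trans _ (ltn_ord j)).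
have := rw_add_index_le _ _ _ pl r0; have := ltn_ord j; rewrite -!(ltr_nat F) -!(ler_nat F) natrD.
have : 0 <= i%:R :> F by []. have : 0 <= j%:R :> F by [].
by rewrite ler_norml; lra.
Qed.

Lemma addableS l i : addable l i.+1 = removable l i. Proof. by []. Qed.

Definition diff2 (g : F -> F) c := g (c + 1) - g c - (g c - g (c - 1)).

(** Adding a box of content [c] changes the difference of corner sums by [diff2 g c], and [g 0] is
    its value at the empty diagram. The proof telescopes along each row. *)
Lemma corner_sum g n l N : is_partition n l -> (n < N)%N ->
  \sum_(i < N | addable l i) g (upc l i) - \sum_(i < N | removable l i) g (downc l i) =
  g 0 + csum (diff2 g) l.
Proof.
case: N => // N pl; rewrite ltnS => nN; have lN := leq_trans (size_partition _ _ pl) nN.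
have rN i : (N <= i)%N -> rw l i = 0%N by move=> Ni; rewrite nth_default // (leq_trans lN).
have h l' : \sum_(i < N.+1) g (upc l' i) - \sum_(i < N) g (downc l' i) =
   g (upc l' N) + \sum_(i < N) (g (upc l' i) - g (downc l' i)).
  by rewrite big_ord_recr /= sumrB; ring.
(* If row [i] is not removable, row [i.+1] is equally long and [upc l i.+1 = downc l i]; the terms
   that are not corners therefore cancel in pairs. *)
have -> : \sum_(i < N.+1 | addable l i) g (upc l i) -
          \sum_(i < N.+1 | removable l i) g (downc l i) =
          \sum_(i < N.+1) g (upc l i) - \sum_(i < N) g (downc l i).
  rewrite big_mkcond [X in _ - X]big_mkcond big_ord_recl [X in _ - X = _]big_ord_recr /=.
  rewrite [X in _ - (_ + X)](_ : _ = 0); last by rewrite /removable !rN.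
  rewrite addr0 [in RHS]big_ord_recl /= -!addrA; congr (_ + _); rewrite -!sumrB.
  apply: eq_bigr => i _; rewrite /bump /= add1n addableS; case: ifPn => // ri.
  rewrite subrr; suff -> : upc l i.+1 = downc l i by rewrite subrr.
  rewrite /upc /downc; have -> : rw l i.+1 = rw l i.
    by have := rw_antitone _ _ i i.+1 pl (leqnSn i); move: ri; rewrite /removable; lia.
  by rewrite -natr1; ring.
rewrite h (csumE _ _ _ lN).
(* The same identity for the empty diagram is subtracted, so that each row can be telescoped from
   length zero. *)
have := h [::]; have tel : \sum_(i < N.+1) g (upc [::] i) - \sum_(i < N) g (downc [::] i) = g 0.
  rewrite big_ord_recl /= -addrA -[RHS]addr0; congr (_ + _).
    by rewrite /upc nth_nil subrr.
  apply/eqP; rewrite subr_eq0; apply/eqP/eq_bigr => i _.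
  by rewrite /bump /= add1n /upc /downc !nth_nil -natr1; congr g; ring.
rewrite tel => ->; rewrite -addrA -big_split /=.
have -> : upc l N = upc [::] N by rewrite /upc rN // nth_nil.
congr (_ + _); apply: eq_bigr => i _.

pose G (j : nat) := g (j%:R - i%:R) - g (j%:R - i%:R - 1).
rewrite (eq_bigr (fun j : 'I__ => G j.+1 - G j)) => [|j _]; last first.
  by rewrite /G (_ : j.+1%:R - i%:R = j%:R - i%:R + 1) ?addrK // -natr1; ring.
rewrite -(big_mkord xpredT (fun j => G j.+1 - G j)) telescope_sumr // /G /upc /downc nth_nil.
ring.
Qed.

(** The order is [n ^ (m - 2)]; the factor [n ^ 2] on the left avoids truncated exponents for small
    [m]. *)
Lemma diff2_expr_bound m : exists2 C : F, 0 <= C & forall (n : nat) (c : F), (0 < n)%N ->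
  `|c| <= n%:R -> `|diff2 (fun x => x ^+ m) c| * n%:R ^+ 2 <= C * n%:R ^+ m.
Proof.
(* The induction carries the symmetric first difference along, because the second difference of
   [x ^+ m.+1] at [c] is [c] times that of [x ^+ m] plus this first difference. *)
suff [C C0 H] : exists2 C : F, 0 <= C & forall (n : nat) (c : F), (0 < n)%N ->
    `|c| <= n%:R -> `|(c + 1) ^+ m - (c - 1) ^+ m| * n%:R <= C * n%:R ^+ m /\
    `|diff2 (fun x => x ^+ m) c| * n%:R ^+ 2 <= C * n%:R ^+ m.
  by exists C => // n c n0 cn; have [] := H n c n0 cn.
elim: m => [|m [C C0 IH]].
  by exists 0 => // n c _ _; rewrite /diff2 !subrr normr0 !mul0r.
exists (2 * C + 2 * 2 ^+ m) => [|n c n0 cn].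
  by rewrite addr_ge0 // mulr_ge0 // exprn_ge0.
have n1 : 1 <= n%:R :> F by rewrite ler1n.
have [IE ID] := IH _ _ n0 cn.
set E := _ - _ in IE.
have b (e : F) : `|e| <= 1 -> `|(c + e) ^+ m| <= 2 ^+ m * n%:R ^+ m.
  move=> e1; rewrite normrX -exprMn lerXn2r ?nnegrE ?mulr_ge0 //.
  by rewrite (le_trans (ler_normD _ _)) //; lra.
have cE : `|c * E| * n%:R <= C * n%:R ^+ m.+1.
  by rewrite normrM -mulrA exprS [C * _]mulrCA ler_pM // mulr_ge0.
have X0 : 0 <= n%:R ^+ m.+1 :> F by rewrite exprn_ge0.
have P0 : 0 <= 2 ^+ m * n%:R ^+ m.+1 :> F by rewrite mulr_ge0 ?exprn_ge0.
have CX0 : 0 <= C * n%:R ^+ m.+1 :> F by rewrite mulr_ge0.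
split.
  have -> : (c + 1) ^+ m.+1 - (c - 1) ^+ m.+1 = c * E + ((c + 1) ^+ m + (c - 1) ^+ m).
    by rewrite /E !exprS; ring.
  have h : `|(c + 1) ^+ m + (c - 1) ^+ m| * n%:R <= 2 * (2 ^+ m * n%:R ^+ m.+1).
    rewrite exprS [n%:R * _]mulrC !mulrA ler_wpM2r // (le_trans (ler_normD _ _)) //.
    have := b 1; have := b (-1); rewrite normrN normr1 lexx => /(_ isT) h1 /(_ isT) h2.
    by rewrite -mulrA; move: h1 h2; set u := 2 ^+ m * _; lra.
  rewrite (le_trans (ler_wpM2r (ler0n _ _) (ler_normD _ _))) // mulrDl.
  by move: P0 CX0 h cE; lra.
have -> : diff2 (fun x => x ^+ m.+1) c = c * diff2 (fun x => x ^+ m) c + E.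
  by rewrite /diff2 /E !exprS; ring.
rewrite (le_trans (ler_wpM2r (exprn_ge0 _ (ler0n _ _)) (ler_normD _ _))) // mulrDl.
have h1 : `|c * diff2 (fun x => x ^+ m) c| * n%:R ^+ 2 <= C * n%:R ^+ m.+1.
  by rewrite normrM -mulrA [n%:R ^+ m.+1]exprS [C * _]mulrCA ler_pM // mulr_ge0 // exprn_ge0.
have h2 : `|E| * n%:R ^+ 2 <= C * n%:R ^+ m.+1.
  rewrite (_ : _ * n%:R ^+ 2 = n%:R * (`|E| * n%:R)); last by ring.
  by rewrite exprS [C * _]mulrCA ler_wpM2l.
by move: P0 CX0 h1 h2; lra.
Qed.

Section Chain.
Variables (A B : F).
Hypothesis B_ge0 : 0 <= B.
(** The product of [z + c] and [z' + c], with [A] the sum and [B] the product of the two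
    parameters. *)
Definition jumpw (c : F) := c ^+ 2 + A * c + B.
Definition stepup n l i := jumpw (upc l i) / (B + n%:R) *
  ((dimY (addbox l i))%:R / (n.+1%:R * (dimY l)%:R)).
Definition stepdown nu k : F := (dimY (rembox nu k))%:R / (dimY nu)%:R.

Definition updown n (g : seq nat -> F) l := \sum_(i < n.+2 | addable l i) stepup n l i *
  \sum_(k < n.+2 | removable (addbox l i) k) stepdown (addbox l i) k * g (rembox (addbox l i) k).

Lemma dimYF_gt0 n l : is_partition n l -> 0 < (dimY l)%:R :> F.
Proof. by move=> pl; rewrite ltr0n (dimY_gt0 F _ _ pl). Qed.

Lemma sum_stepdown n N nu : is_partition n.+1 nu -> (n < N)%N ->
  \sum_(k < N | removable nu k) stepdown nu k = 1.
Proof.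
move=> pn nN; rewrite -mulr_suml -natr_sum -(dimY_rec _ _ _ pn) // divff //.
by rewrite gt_eqF // (dimYF_gt0 _ _ pn).
Qed.

Lemma sum_upc_dimY g n N l : is_partition n l -> (n < N)%N ->
  \sum_(i < N | addable l i) g (upc l i) * (dimY (addbox l i))%:R =
  n.+1%:R * (dimY l)%:R * \sum_(i < N) upw F N (ellF F N l) i * g (upc l i).
Proof.
move=> pl nN; have d0 := dimYF_gt0 _ _ pl.
rewrite [X in _ * X](bigID (fun i : 'I_N => addable l i)) /= [X in _ + X]big1 ?addr0; last first.
  by move=> i ai; rewrite (upw_eq0 _ _ n) // mul0r.
rewrite mulr_sumr; apply: eq_bigr => i ai; rewrite -(dimY_addbox _ _ n) //.
have : n.+1%:R != 0 :> F by rewrite pnatr_eq0.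
move: (n.+1%:R : F) => m m0; field; by rewrite m0 gt_eqF.
Qed.

Lemma sum_downc_dimY g n N l : is_partition n.+1 l -> (n < N)%N ->
  \sum_(k < N | removable l k) g (downc l k) * (dimY (rembox l k))%:R * n.+1%:R =
  (dimY l)%:R * \sum_(k < N) downw F N (ellF F N l) k * g (downc l k).
Proof.
move=> pl nN; have d0 := dimYF_gt0 _ _ pl.
rewrite [X in _ * X](bigID (fun i : 'I_N => removable l i)) /= [X in _ + X]big1 ?addr0; last first.
  move=> i ai; rewrite (downw_eq0 _ _ n.+1) ?mul0r //.
  exact: leq_trans (size_partition _ _ pl) nN.
rewrite mulr_sumr; apply: eq_bigr => i ai; rewrite -(dimY_rembox _ _ n) //.
by field; rewrite gt_eqF.
Qed.

(** The transition moments of orders 0, 1 and 2 are [1], [0] and [n]; this is why the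
    up-probabilities are normalised by [B + n]. *)
Lemma sum_jumpw n N l : is_partition n l -> (n < N)%N ->
  \sum_(i < N | addable l i) jumpw (upc l i) * (dimY (addbox l i))%:R =
  (B + n%:R) * (n.+1%:R * (dimY l)%:R).
Proof.
move=> pl nN; rewrite (sum_upc_dimY _ n) // mulrC; congr (_ * _).
transitivity (upmoment F N l 2 + A * upmoment F N l 1 + B * upmoment F N l 0); last first.
  by rewrite (upmoment2 _ n) // (upmoment1 _ n) // (upmoment0 _ n) //; ring.
rewrite /upmoment !mulr_sumr -!big_split /=.
by apply: eq_bigr => i _; rewrite /jumpw; ring.
Qed.

Lemma sum_stepup n l : is_partition n l -> 0 < B + n%:R ->
  \sum_(i < n.+2 | addable l i) stepup n l i = 1.
Proof.
move=> pl Bn; have := sum_jumpw n n.+2 l pl (leqnSn _).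
have d0 := dimYF_gt0 _ _ pl; have n0 : n.+1%:R != 0 :> F by rewrite pnatr_eq0.
move=> /(congr1 (fun x => x / ((B + n%:R) * (n.+1%:R * (dimY l)%:R)))).
rewrite divff ?mulf_neq0 ?(gt_eqF d0) ?(gt_eqF Bn) // => <-.
rewrite mulr_suml; apply: eq_bigr => i _; rewrite /stepup.
by move: (n.+1%:R : F) n0 => m m0; field; rewrite m0 !gt_eqF.
Qed.

Lemma updown_swap l n i k : is_partition n l -> i != k ->
  (addable l i && removable (addbox l i) k) = (removable l k && addable (rembox l k) i).
Proof.
move=> pl ik; apply/idP/idP => /andP[].
  move=> ai; rewrite /removable !(rw_addbox _ _ pl) // [k == i]eq_sym (negbTE ik) addn0 => h.
  have rk : removable l k by rewrite /removable (leq_ltn_trans _ h) // leq_addr.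
  rewrite -/(removable l k) rk /addable; case: i ai ik h => //= i ai ik; rewrite !(rw_rembox _ _ pl) //.
  rewrite (negbTE ik) subn0 eqSS; have [->|_] := eqVneq i k; last by rewrite subn0.
  by lia.
move=> rk h; have ai : addable l i.
  move: h; rewrite /addable; case: i ik => //= i ik; rewrite !(rw_rembox _ _ pl) //.
  by rewrite (negbTE ik) subn0 => /leq_trans; apply; rewrite leq_subr.
rewrite ai /removable !(rw_addbox _ _ pl) // [k == i]eq_sym (negbTE ik) addn0.
case: i ai ik h => [|i] ai ik; first by rewrite addn0.
rewrite /addable /= !(rw_rembox _ _ pl) // (negbTE ik) subn0 eqSS [k == i]eq_sym.
by have [->|_] := eqVneq i k; [lia | rewrite addn0].
Qed.

Lemma rembox_addboxC l n i k : is_partition n l -> i != k -> addable l i ->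
  removable (addbox l i) k -> rembox (addbox l i) k = addbox (rembox l k) i.
Proof.
move=> pl ik ai ri; have pa := addbox_partition _ _ pl _ ai.
have := updown_swap l n i k pl ik; rewrite ai ri => /esym/andP[rk ai'].
have pr := rembox_partition _ _ pl _ rk.
apply: (partition_ext _ _ _ _ (rembox_partition _ _ pa _ ri) (addbox_partition _ _ pr _ ai')) => j.
rewrite (rw_rembox _ _ pa) // (rw_addbox _ _ pl) // (rw_addbox _ _ pr) // (rw_rembox _ _ pl) //.
have [->|_] := eqVneq j k; last by rewrite !subn0.
by rewrite eq_sym (negbTE ik) !addn0.
Qed.

(* Exchanging the box added with the box removed turns the sum over down-steps after an
   up-step into the sum of the total up-weights of the smaller diagrams. *)
Lemma updown_exchange phi n l N (pl : is_partition n.+1 l) (nN : (n.+1 < N)%N) :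
  \sum_(i < N | addable l i) jumpw (upc l i) *
    (\sum_(k < N | removable (addbox l i) k)
      (dimY (rembox (addbox l i) k))%:R * phi (downc (addbox l i) k)) =
  (B + n%:R) * n.+1%:R * (\sum_(k < N | removable l k) phi (downc l k) * (dimY (rembox l k))%:R) +
  (dimY l)%:R * (jumpw 0 * phi 0 + csum (diff2 (fun c => jumpw c * phi c)) l).
Proof.
rewrite -(corner_sum (fun c => jumpw c * phi c) _ _ _ pl nN).
under eq_bigr do rewrite mulr_sumr.
rewrite pair_big_dep /= (bigID (fun p : 'I_N * 'I_N => p.1 == p.2)) /=.
set L1 := \sum_(p | _) _; set L2 := \sum_(p | _) _.
(* If the box just added is removed again, the chain returns to [l]. *)
have -> : L1 = (dimY l)%:R * \sum_(i < N | addable l i) jumpw (upc l i) * phi (upc l i).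
  rewrite /L1 mulr_sumr (reindex_onto (fun i : 'I_N => (i, i)) (fun p => p.1)) /=; last first.
    by move=> [i k] /andP[_ /eqP /= ->].
  rewrite (eq_bigl (fun i : 'I_N => addable l i)); last first.
    move=> i /=; rewrite !eqxx !andbT; apply/andb_idr => ai.
    by have [] := addboxK _ _ _ pl ai.
  apply: eq_bigr => i ai; have [ri E] := addboxK _ _ _ pl ai.
  rewrite E -(upc_rembox _ _ _ (addbox_partition _ _ pl _ ai)) // E; ring.
(* For different rows the two moves commute, so the removal can be performed before the addition. *)
have -> : L2 = \sum_(k < N | removable l k) \sum_(i < N | addable (rembox l k) i && (i != k))
     phi (downc l k) * (jumpw (upc (rembox l k) i) * (dimY (addbox (rembox l k) i))%:R).
  rewrite pair_big_dep /= /L2 (reindex_onto (fun p : 'I_N * 'I_N => (p.2, p.1))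
    (fun p => (p.2, p.1))) /=; last by move=> [].
  apply: eq_big => [[k i]|[k i]] /=.
    rewrite eqxx andbT andbA; have [->|ik] := eqVneq i k; first by rewrite !andbF.
    by rewrite !andbT (updown_swap l n.+1 i k pl) // -val_eqE.
  rewrite -val_eqE /= => /andP[/andP[/andP[ai rk] ik] _].
  rewrite (rembox_addboxC l n.+1) //.
  have := updown_swap l n.+1 i k pl ik; rewrite ai rk => /esym/andP[rk' ai'].
  rewrite /downc /upc (rw_addbox _ _ pl) // (rw_rembox _ _ pl) // [_ == val i]eq_sym (negbTE ik).
  by rewrite addn0 subn0; ring.
(* The inner sum is the full up-weight of the smaller diagram, known from [sum_jumpw], minus its
   term [i = k]. These missing terms pair with [L1] to form a corner sum. *)
have -> : \sum_(k < N | removable l k) \sum_(i < N | addable (rembox l k) i && (i != k))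
     phi (downc l k) * (jumpw (upc (rembox l k) i) * (dimY (addbox (rembox l k) i))%:R) =
   \sum_(k < N | removable l k) ((B + n%:R) * n.+1%:R * (phi (downc l k) * (dimY (rembox l k))%:R)
     - (dimY l)%:R * (jumpw (downc l k) * phi (downc l k))).
  apply: eq_bigr => k rk; have pr := rembox_partition _ _ pl _ rk.
  have [ak E] := remboxK _ _ _ pl rk.
  have := sum_jumpw _ N _ pr (ltnW nN); rewrite (bigD1 k) //= E (upc_rembox _ _ _ pl) // => S.
  by rewrite -mulr_sumr -[\sum_(i < N | _) _](addKr (jumpw (downc l k) * (dimY l)%:R)) S; ring.
rewrite sumrB -!mulr_sumr; ring.
Qed.

Lemma jumpw_diff2 j c : diff2 (fun c => jumpw c * c ^+ j) c =
  diff2 (fun c => c ^+ j.+2) c + A * diff2 (fun c => c ^+ j.+1) c + B * diff2 (fun c => c ^+ j) c.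
Proof. by rewrite /diff2 /jumpw !exprS; ring. Qed.

Lemma jumpw_pow_diff2_bound j : exists2 C : F, 0 <= C & forall (n : nat) (c : F), (0 < n)%N ->
  `|c| <= n%:R -> `|diff2 (fun c => jumpw c * c ^+ j) c| <= C * n%:R ^+ j.
Proof.
have [C2 C20 H2] := diff2_expr_bound j.+2; have [C1 C10 H1] := diff2_expr_bound j.+1.
have [C0 C00 H0] := diff2_expr_bound j.
exists (C2 + `|A| * C1 + `|B| * C0) => [|n c n0 cn]; first by rewrite !addr_ge0 ?mulr_ge0.
have n1 : 1 <= n%:R :> F by rewrite ler1n.
have n2 : 0 < n%:R ^+ 2 :> F by rewrite exprn_gt0 // (lt_le_trans ltr01).
rewrite jumpw_diff2 -(ler_pM2r n2).
rewrite (le_trans (ler_wpM2r (ltW n2) (ler_normD _ _))) //.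
rewrite mulrDl; have ht := ler_wpM2r (ltW n2) (ler_normD (diff2 (fun c => c ^+ j.+2) c) (A * diff2 (fun c => c ^+ j.+1) c)).
rewrite normrM mulrDl -!mulrA in ht; rewrite !normrM -!mulrA.
have h2 := H2 _ _ n0 cn.
have h1 := ler_wpM2l (normr_ge0 A) (H1 _ _ n0 cn).
have h0 := ler_wpM2l (normr_ge0 B) (H0 _ _ n0 cn).
have P0 : 0 <= n%:R ^+ j :> F by rewrite exprn_ge0.
have e1 : n%:R ^+ j.+1 <= n%:R ^+ j.+2 :> F by rewrite [X in _ <= X]exprS ler_peMl ?exprn_ge0.
have e0 : n%:R ^+ j <= n%:R ^+ j.+2 :> F.
  by rewrite (le_trans _ e1) // [X in _ <= X]exprS ler_peMl ?exprn_ge0.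
have f1 := ler_wpM2l (mulr_ge0 (normr_ge0 A) C10) e1.
have f0 := ler_wpM2l (mulr_ge0 (normr_ge0 B) C00) e0.
have E2 : n%:R ^+ j.+2 = n%:R ^+ j * n%:R ^+ 2 :> F by rewrite -exprD addn2.
rewrite E2 in h2 f1 f0; move: ht h2 h1 h0 f1 f0; lra.
Qed.

(** Moving one box changes this power sum by order [n ^ j]; the mean change is smaller by a further
    factor [n], and it is smaller than the natural scale [n ^ (j + 1)] by a factor [n ^ 2]. *)
Lemma updown_drift j : exists2 C : F, 0 <= C & forall n l, is_partition n.+1 l ->
  `|updown n.+1 (csum (fun c => c ^+ j)) l - csum (fun c => c ^+ j) l| * n.+1%:R <= C * n.+1%:R ^+ j.
Proof.
have [D D0 HD] := jumpw_pow_diff2_bound j.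
(* The summands bound, in this order, the difference of moments, the multiple [2 - B] of
   [downmoment], the [A] and [B] parts of [jumpw], the value at content zero, and the second
   differences. *)
exists (2 * j%:R + 2 + `|B| + 2 * `|A| + 2 * `|B| + `|B| + D) => [|n l pl].
  by rewrite !addr_ge0 ?mulr_ge0.
pose phi c : F := c ^+ j; pose N := n.+3.
have nN : (n.+1 < N)%N by [].
have m0 : 0 < n.+1%:R :> F by rewrite ltr0n.
have m1 : 1 <= n.+1%:R :> F by rewrite ler1n.
have Bn : 0 < B + n.+1%:R by rewrite ltr_wpDl.
have d0 := dimYF_gt0 _ _ pl.
have k0 : 0 < (B + n.+1%:R) * (n.+2%:R * (dimY l)%:R) by rewrite !mulr_gt0 // ltr0n.
have drift : updown n.+1 (csum phi) l - csum phi l =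
   \sum_(i < N | addable l i) stepup n.+1 l i * (phi (upc l i) -
     \sum_(k < N | removable (addbox l i) k) stepdown (addbox l i) k * phi (downc (addbox l i) k)).
  rewrite -[X in _ - X]mul1r -(sum_stepup n.+1 l pl Bn) mulr_suml -sumrB.
  apply: eq_bigr => i ai; have pa := addbox_partition _ _ pl _ ai.
  rewrite -mulrBr; congr (_ * _).
  rewrite (eq_bigr (fun k : 'I_N => stepdown (addbox l i) k * csum phi (addbox l i) -
     stepdown (addbox l i) k * phi (downc (addbox l i) k))); last first.
    by move=> k rk; rewrite (csum_rembox _ _ _ _ pa) // mulrBr.
  rewrite sumrB -mulr_suml (sum_stepdown n.+1 N _ pa) // mul1r (csum_addbox _ _ _ _ pl) //.
  ring.
(* Clearing denominators expresses the up-step by transition moments, and the down-step by the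
   exchange identity. *)
have tot : (updown n.+1 (csum phi) l - csum phi l) * ((B + n.+1%:R) * (n.+2%:R * (dimY l)%:R)) =
  (dimY l)%:R * (n.+2%:R * (upmoment F N l j.+2 + A * upmoment F N l j.+1 + B * upmoment F N l j)
    - (B + n%:R) * downmoment F N l j - (jumpw 0 * phi 0 + csum (diff2 (fun c => jumpw c * phi c)) l)).
  transitivity (\sum_(i < N | addable l i) (jumpw (upc l i) * phi (upc l i) * (dimY (addbox l i))%:R -
     jumpw (upc l i) * (\sum_(k < N | removable (addbox l i) k)
      (dimY (rembox (addbox l i) k))%:R * phi (downc (addbox l i) k)))).
    rewrite drift mulr_suml; apply: eq_bigr => i ai; have pa := addbox_partition _ _ pl _ ai.
    have a0 := dimYF_gt0 _ _ pa.
    rewrite (eq_bigr (fun k : 'I_N => (dimY (addbox l i))%:R^-1 *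
      ((dimY (rembox (addbox l i) k))%:R * phi (downc (addbox l i) k)))); last first.
      by move=> k _; rewrite /stepdown; ring.
    rewrite -mulr_sumr /stepup.
    have : n.+2%:R != 0 :> F by rewrite pnatr_eq0.
    set S := \sum_(_ < _ | _) _; move: (n.+2%:R : F) (B + n.+1%:R) Bn => q bn Bn q0.
    by field; rewrite q0 (gt_eqF a0) (gt_eqF d0) (gt_eqF Bn).
  rewrite sumrB (sum_upc_dimY (fun c => jumpw c * phi c) _ _ _ pl nN).
  rewrite (updown_exchange phi n l N pl nN).
  have -> : \sum_(i < N) upw F N (ellF F N l) i * (jumpw (upc l i) * phi (upc l i)) =
     upmoment F N l j.+2 + A * upmoment F N l j.+1 + B * upmoment F N l j.
    rewrite /upmoment !mulr_sumr -!big_split /=; apply: eq_bigr => i _.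
    by rewrite /jumpw /phi !exprS; ring.
  have -> : (B + n%:R) * n.+1%:R * (\sum_(k < N | removable l k) phi (downc l k) * (dimY (rembox l k))%:R) =
     (dimY l)%:R * ((B + n%:R) * downmoment F N l j).
    rewrite -[LHS]mulrA [n.+1%:R * _]mulrC mulr_suml (sum_downc_dimY phi _ _ _ pl (ltnW nN)) /downmoment.
    by rewrite /phi; ring.
  ring.
pose X : F := n.+1%:R ^+ j.
have X0 : 0 <= X by rewrite exprn_ge0.
have b1 := upmoment_downmoment F n.+1 N l pl nN j.
have b2 := upmoment_le F n.+1 N l pl nN j.
have b3 : `|upmoment F N l j| <= X.
  case: (j) @X {X0 phi tot drift HD b1 b2} => [|i] X; first by rewrite (upmoment0 _ n.+1) // normr1.
  rewrite (le_trans (upmoment_le F n.+1 N l pl nN i)) // /X exprS ler_peMl // exprn_ge0 //.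
have b4 := downmoment_le F n.+1 N l pl nN j.
have b5 : `|csum (diff2 (fun c => jumpw c * phi c)) l| <= n.+1%:R * (D * X).
  by apply: csum_norm_le pl _ => c cn; apply: HD.
have b6 : `|jumpw 0 * phi 0| <= `|B| * X.
  rewrite normrM /jumpw expr0n /= mulr0 !add0r ler_wpM2l // /phi /X expr0n.
  by case: (j) => [|i]; rewrite ?expr0 ?normr1 // normr0 exprn_ge0.
rewrite exprS -/X in b4; rewrite -/X in b1 b2.
set u := updown _ _ _ - _ in tot *.
suff : `|u| * n.+1%:R * n.+1%:R <=
  (2 * j%:R + 2 + `|B| + 2 * `|A| + 2 * `|B| + `|B| + D) * X * n.+1%:R by rewrite ler_pM2r.
have : `|u * ((B + n.+1%:R) * n.+2%:R)| <= (2 * j%:R + 2 + `|B| + 2 * `|A| + 2 * `|B| + `|B| + D) * X * n.+1%:R.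
  (* The two terms of order [n ^ (j + 2)] are regrouped into a multiple of the small difference
     [upmoment j.+2 - downmoment j] and a bounded multiple of [downmoment j], both of order
     [n ^ (j + 1)]. *)
  have -> : u * ((B + n.+1%:R) * n.+2%:R) =
     n.+2%:R * (upmoment F N l j.+2 - downmoment F N l j) + (2 - B) * downmoment F N l j +
     n.+2%:R * A * upmoment F N l j.+1 + n.+2%:R * B * upmoment F N l j
     - (jumpw 0 * phi 0) - csum (diff2 (fun c => jumpw c * phi c)) l.
    apply: (mulfI (lt0r_neq0 d0)).
    rewrite [LHS](_ : _ = u * ((B + n.+1%:R) * (n.+2%:R * (dimY l)%:R))); last by ring.
    by rewrite tot -[n.+2%:R]natr1 -[n.+1%:R]natr1; ring.
  set q : F := n.+1%:R in m0 m1 b4 b5 *.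
  have q2 : n.+2%:R <= 2 * q by rewrite -[n.+2%:R]natr1 -/q; lra.
  have q20 : 0 <= n.+2%:R :> F by [].
  move: (n.+2%:R : F) q2 q20 => q' q2 q20.
  rewrite (le_trans (ler_normB _ _)) // (le_trans (lerD (ler_normB _ _) (lexx _))) //.
  rewrite (le_trans (lerD (lerD (ler_normD _ _) (lexx _)) (lexx _))) //.
  rewrite (le_trans (lerD (lerD (lerD (ler_normD _ _) (lexx _)) (lexx _)) (lexx _))) //.
  rewrite (le_trans (lerD (lerD (lerD (lerD (ler_normD _ _) (lexx _)) (lexx _)) (lexx _)) (lexx _))) //.
  rewrite !normrM (ger0_norm q20).
  have t1 : q' * `|upmoment F N l j.+2 - downmoment F N l j| <= 2 * q * (j%:R * X) by rewrite ler_pM.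
  have t2 : `|2 - B| * `|downmoment F N l j| <= (2 + `|B|) * (q * X).
    by rewrite ler_pM // (le_trans (ler_normB _ _)) // ger0_norm.
  have t3 : q' * `|A| * `|upmoment F N l j.+1| <= 2 * q * `|A| * X.
    by rewrite ler_pM ?mulr_ge0 // ler_wpM2r.
  have t4 : q' * `|B| * `|upmoment F N l j| <= 2 * q * `|B| * X.
    by rewrite ler_pM ?mulr_ge0 // ler_wpM2r.
  have t6 : `|B| * X <= `|B| * X * q by rewrite ler_peMr // mulr_ge0.
  by rewrite normrM in b6; move: t1 t2 t3 t4 b5 b6 t6; lra.
move=> h; apply: le_trans h; rewrite normrM -mulrA ler_wpM2l //.
rewrite ger0_norm ?mulr_ge0 ?(ltW Bn) //.
by rewrite ler_pM // ?ler_nat // lerDr.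
Qed.

End Chain.
End UpDownChain.
(** * Frobenius coordinates *)

Section FrobeniusCoordinates.
Local Open Scope nat_scope.

(** Column lengths and the diagonal length are counts of predicates that hold on an initial segment;
    their defining inequalities are read off from this. *)
Lemma count_initial (p : pred nat) n i : (forall j, p j.+1 -> p j) ->
  (i < count p (iota 0 n)) = (i < n) && p i.
Proof.
move=> pS; have p_le j k : j <= k -> p k -> p j.
  by move=> /subnK <-; elim: (k - j) => // m IH; rewrite addSn => /pS; exact: IH.
elim: n i => [|n IH] i //.
have -> : iota 0 n.+1 = iota 0 n ++ [:: n] by rewrite -[in LHS]addn1 iotaD.
rewrite count_cat /= addn0.
case pn : (p n).
  have -> : count p (iota 0 n) = n.
    rewrite -[RHS](size_iota 0); apply/eqP; rewrite -all_count; apply/allP => j.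
    by rewrite mem_iota add0n => /andP[_ jn]; apply: p_le pn; exact: ltnW.
  rewrite addn1; case: ltnP => //= i_n.
  by rewrite (p_le i n) // -ltnS.
rewrite addn0 IH ltnS; case: (ltngtP i n) => //= -> ; by rewrite pn.
Qed.

Lemma conjpP n l k i : is_partition n l -> (i < conjp l k) = (k < rw l i).
Proof.
move=> pl; have -> : conjp l k = count (fun j => k < rw l j) (iota 0 (size l)).
  by rewrite /conjp -{1}(mkseq_nth 0%N l) /mkseq count_map.
rewrite count_initial => [|j]; last by move/leq_trans; apply; exact: (rw_antitone _ _ _ _ pl).
case: ltnP => //= li; by rewrite (nth_default _ li).
Qed.

Lemma frob_dP n l i : is_partition n l -> (i < frob_d l) = (i < rw l i).
Proof.
move=> pl; rewrite /frob_d count_initial => [|j].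
  by case: ltnP => //= li; rewrite (nth_default _ li).
by move=> h; apply: leq_trans (rw_antitone _ _ j j.+1 pl (leqnSn j)); exact: leq_trans h.
Qed.

Lemma frob_d_le n l : is_partition n l -> frob_d l <= n.
Proof.
move=> pl; have := frob_dP n l n pl; rewrite ltnNge [in RHS]ltnNge (rw_partition_le _ _ _ pl) /=.
by move/negbFE.
Qed.

Lemma conjp_antitone n l j k : is_partition n l -> j <= k -> conjp l k <= conjp l j.
Proof.
move=> pl jk; rewrite leqNgt; apply/negP; rewrite (conjpP _ _ _ _ pl) => h.
have : conjp l j < conjp l j by rewrite (conjpP _ _ _ _ pl); exact: leq_ltn_trans h.
by rewrite ltnn.
Qed.

Lemma conjp_le n l k : is_partition n l -> conjp l k <= n.
Proof.
move=> pl; rewrite leqNgt; apply/negP; rewrite (conjpP _ _ _ _ pl) nth_default //.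
exact: size_partition pl.
Qed.

Lemma frob_conjp n l i : is_partition n l -> (i < frob_d l) = (i < conjp l i).
Proof. by move=> pl; rewrite (conjpP _ _ _ _ pl) (frob_dP _ _ _ pl). Qed.

Local Close Scope nat_scope.

Variable F : realFieldType.

Definition frobA (l : seq nat) i : F := (rw l i)%:R - i%:R - 2^-1.
Definition frobB (l : seq nat) i : F := (conjp l i)%:R - i%:R - 2^-1.

Lemma telescope_row (g : F -> F) (i r : nat) (x : F) : (i <= r)%N ->
  \sum_(i <= j < r) (g (j%:R - x + 2^-1) - g (j%:R - x - 2^-1)) = g (r%:R - x - 2^-1) - g (i%:R - x - 2^-1).
Proof.
move=> /subnK <-; elim: (r - i)%N => [|m IH]; first by rewrite add0n big_geq // subrr.
rewrite addSn big_nat_recr ?leq_addl //= IH -[(m + i).+1%:R]natr1.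
have -> : (m + i)%:R + 1 - x - 2^-1 = (m + i)%:R - x + 2^-1 by field.
by ring.
Qed.

Lemma telescope_col (g : F -> F) (i r : nat) (x : F) : (i <= r)%N ->
  \sum_(i <= j < r) (g (x - j%:R + 2^-1) - g (x - j%:R - 2^-1)) = g (x - i%:R + 2^-1) - g (x - r%:R + 2^-1).
Proof.
move=> /subnK <-; elim: (r - i)%N => [|m IH]; first by rewrite add0n big_geq // subrr.
rewrite addSn big_nat_recr ?leq_addl //= IH -[(m + i).+1%:R]natr1.
have -> : x - ((m + i)%:R + 1) + 2^-1 = x - (m + i)%:R - 2^-1 by field.
by ring.
Qed.

Lemma big_nat_prefix (G : nat -> F) N a b : (a <= b)%N -> (b <= N)%N ->
  \sum_(0 <= j < N | (a <= j)%N && (j < b)%N) G j = \sum_(a <= j < b) G j.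
Proof.
move=> ab bN; rewrite (big_cat_nat _ (n := b)) //= [X in _ + X]big_nat_cond [X in _ + X]big_pred0 ?addr0; last first.
  by move=> j; apply/negP => /andP[/andP[h _] /andP[_]]; rewrite ltnNge h.
rewrite (big_cat_nat _ (n := a)) //= big_nat_cond big_pred0 ?add0r; last first.
  by move=> j; apply/negP => /andP[/andP[_ h] /andP[]]; rewrite leqNgt h.
rewrite big_nat_cond [RHS]big_nat_cond; apply: eq_bigl => j.
by case: (leqP a j) => //=; case: (ltnP j b).
Qed.

(* Boxes on or above the diagonal are summed along rows, the other ones along columns;
   both sums telescope. *)
Lemma csum_frobenius (g : F -> F) n l : is_partition n l ->
  csum F (fun c => g (c + 2^-1) - g (c - 2^-1)) l =
  \sum_(i < frob_d l) (g (frobA l i) - g (- frobB l i)).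
Proof.
move=> pl; pose h c := g (c + 2^-1) - g (c - 2^-1).
have -> : csum F h l = \sum_(0 <= i < n) \sum_(0 <= j < n | (j < rw l i)%N) h (j%:R - i%:R).
  rewrite (csumE _ _ _ n (size_partition _ _ pl)) big_mkord; apply: eq_bigr => i _.
  have := big_nat_prefix (fun j => h (j%:R - i%:R)) n 0 (rw l i) (leq0n _) (rw_partition_le _ _ _ pl).
  by rewrite [RHS]big_mkord => <-; apply: eq_bigl => j.
have -> : \sum_(0 <= i < n) \sum_(0 <= j < n | (j < rw l i)%N) h (j%:R - i%:R) =
   \sum_(0 <= i < n) \sum_(0 <= j < n | (i <= j)%N && (j < rw l i)%N) h (j%:R - i%:R) +
   \sum_(0 <= j < n) \sum_(0 <= i < n | (j.+1 <= i)%N && (i < conjp l j)%N) h (j%:R - i%:R).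
  rewrite [X in _ + X](exchange_big_dep_nat xpredT) //= -big_split /=; apply: eq_bigr => i _.
  rewrite (bigID (fun j => (i <= j)%N)) /=; congr (_ + _); first by apply: eq_bigl => j; rewrite andbC.
  by apply: eq_bigl => j; rewrite (conjpP _ _ _ _ pl) -ltnNge andbC.
rewrite -big_split /= big_mkord (big_ord_widen n (fun i => g (frobA l i) - g (- frobB l i))) ?frob_d_le //.
rewrite [RHS]big_mkcond; apply: eq_bigr => i _; case: ifP => di.
  have ri : (i <= rw l i)%N by rewrite ltnW // -(frob_dP _ _ _ pl).
  have ci : (i.+1 <= conjp l i)%N by rewrite -(frob_conjp _ _ _ pl).
  rewrite big_nat_prefix // ?(rw_partition_le _ _ _ pl) // big_nat_prefix ?(conjp_le _ _ _ pl) //.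
  rewrite /h telescope_row // telescope_col // /frobA /frobB.
  have -> : i%:R - i%:R - 2^-1 = i%:R - i.+1%:R + 2^-1 :> F by rewrite -[i.+1%:R]natr1; field.
  have -> : - ((conjp l i)%:R - i%:R - 2^-1) = i%:R - (conjp l i)%:R + 2^-1 :> F by ring.
  by ring.
move/negbT: di => di; rewrite big_pred0 ?add0r => [|j]; last first.
  by rewrite (frob_dP _ _ _ pl) -leqNgt in di; apply/negP => /andP[h1 h2]; have := leq_trans h2 di; rewrite ltnNge h1.
rewrite big_pred0 // => j; apply/negP => /andP[h1 h2].
by rewrite (frob_conjp _ _ _ pl) -leqNgt in di; have := leq_trans h2 di; rewrite ltnNge ltnW.
Qed.

Lemma frobA_ge0 n l i : is_partition n l -> (i < frob_d l)%N -> 0 <= frobA l i.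
Proof.
move=> pl; rewrite (frob_dP _ _ _ pl) -(ler_nat F) -[i.+1%:R]natr1 /frobA => h.
have : 2^-1 <= 1 :> F by rewrite invf_le1 // ler1n.
by lra.
Qed.

Lemma frobB_ge0 n l i : is_partition n l -> (i < frob_d l)%N -> 0 <= frobB l i.
Proof.
move=> pl; rewrite (frob_conjp _ _ _ pl) -(ler_nat F) -[i.+1%:R]natr1 /frobB => h.
have : 2^-1 <= 1 :> F by rewrite invf_le1 // ler1n.
by lra.
Qed.

Lemma csum1 n l : is_partition n l -> csum F (fun=> 1) l = n%:R.
Proof.
move=> pl; rewrite /csum -[RHS](congr1 _ (sumn_partition _ _ pl)) (sumn_rw _ _ (leqnn _)) natr_sum.
by apply: eq_bigr => i _; rewrite sumr_const card_ord.
Qed.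

(** With [g] the identity every box contributes [1]. *)
Lemma frobenius_sum n l : is_partition n l ->
  \sum_(i < frob_d l) (frobA l i + frobB l i) = n%:R.
Proof.
move=> pl; rewrite -(csum1 _ _ pl); have := csum_frobenius id _ _ pl => /=.
rewrite (_ : csum F (fun c => c + 2^-1 - (c - 2^-1)) l = csum F (fun=> 1) l).
  by move=> ->; apply: eq_bigr => i _; rewrite opprK.
by apply: eq_bigr => i _; apply: eq_bigr => j _; field.
Qed.

End FrobeniusCoordinates.

(** * Fourth moments of a chain with small drift and small jumps *)

Section FourthMoment.
Variables (F : realFieldType) (Y : Type) (S : Y -> Prop) (nbr : Y -> Y -> Prop) (U : (Y -> F) -> Y -> F).
Hypothesis nbrS : forall x y, S x -> nbr x y -> S y.
Hypothesis U1 : forall x, S x -> U (fun=> 1) x = 1.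
Hypothesis Ulin : forall (a : F) g h x, U (fun y => a * g y + h y) x = a * U g x + U h x.
Hypothesis Umono : forall g h x, S x -> (forall y, nbr x y -> g y <= h y) -> U g x <= U h x.
Variables (u : Y -> F) (B J e : F).
Hypotheses (B0 : 0 <= B) (J0 : 0 <= J) (e0 : 0 <= e).
Hypothesis u4 : forall x, S x -> `|u x| <= 4.
Hypothesis drift : forall x, S x -> `|U u x - u x| <= B * e.
Hypothesis jump : forall x y, S x -> nbr x y -> (u y - u x) ^+ 2 <= J * e.

Let Uext g h : g =1 h -> U g =1 U h.
Proof. by move=> gh x; congr (U _ x); apply/funext. Qed.

Let Uaff a b g x : S x -> U (fun y => a * g y + b) x = a * U g x + b.
Proof.
move=> Sx; rewrite Ulin; congr (_ + _).
have h : U (fun=> 0) x = 0.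
  have := Ulin 1 (fun=> 0) (fun=> 0) x; rewrite (Uext (fun _ => 1 * 0 + 0) (fun=> 0)); last by move=> y; rewrite mulr0 addr0.
  by move: (U _ x) => y; lra.
rewrite (Uext (fun=> b) (fun y => b * 1 + 0)); last by move=> y; rewrite mulr1 addr0.
by rewrite Ulin U1 // h mulr1 addr0.
Qed.

(** On neighbours the jump bound dominates [u y ^+ 2] by an affine function of [u y], to which the
    drift bound applies; [8] is twice the bound [4] on [u]. *)
Lemma second_moment_step x : S x -> U (fun y => u y ^+ 2) x <= u x ^+ 2 + (8 * B + J) * e.
Proof.
move=> Sx; apply: (@le_trans _ _ (U (fun y => 2 * u x * u y + (J * e - u x ^+ 2)) x)).
  by apply: Umono => // y nxy; have := jump x y Sx nxy; rewrite sqrrB; lra.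
rewrite Uaff //; have h1 := drift x Sx; have h2 := u4 x Sx.
have : u x * (U u x - u x) <= 4 * (B * e).
  apply: (le_trans (ler_norm _)); rewrite normrM ler_pM //.
have -> : 2 * u x * U u x + (J * e - u x ^+ 2) = u x ^+ 2 + 2 * (u x * (U u x - u x)) + J * e by ring.
by lra.
Qed.

(** For a jump [d] from the value [v], the inequality [4 v d^3 <= 2 v^2 d^2 + 2 d^4] bounds the
    quartic by its tangent plus [8 v^2 d^2 + 3 d^4], again affine in [u y] once [d^2] is replaced by
    [J * e]. *)
Lemma fourth_moment_step x : S x ->
  U (fun y => u y ^+ 4) x <= u x ^+ 4 + (16 * B + 8 * J) * e * u x ^+ 2 + 3 * (J * e) ^+ 2.
Proof.
move=> Sx; pose c := - 3 * u x ^+ 4 + 8 * u x ^+ 2 * (J * e) + 3 * (J * e) ^+ 2.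
have Je0 : 0 <= J * e by rewrite mulr_ge0.
apply: (@le_trans _ _ (U (fun y => 4 * u x ^+ 3 * u y + c) x)).
  apply: Umono => // y nxy; set d := u y - u x.
  have hd : d ^+ 2 <= J * e by exact: jump.
  have -> : u y = u x + d by rewrite /d; ring.
  have h1 : 0 <= d ^+ 2 by rewrite exprn_even_ge0.
  have h2 : 0 <= u x ^+ 2 by rewrite exprn_even_ge0.
  have h3 : u x ^+ 2 * d ^+ 2 <= u x ^+ 2 * (J * e) by rewrite ler_wpM2l.
  have h4 : (d ^+ 2) * (d ^+ 2) <= (J * e) * (J * e) by rewrite ler_pM.
  have h5 : 0 <= (u x - d) ^+ 2 * d ^+ 2 by rewrite mulr_ge0 // exprn_even_ge0.
  rewrite /c -subr_ge0.
  have -> : 4 * u x ^+ 3 * (u x + d) + (- 3 * u x ^+ 4 + 8 * u x ^+ 2 * (J * e) + 3 * (J * e) ^+ 2) - (u x + d) ^+ 4 =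
    8 * (u x ^+ 2 * (J * e) - u x ^+ 2 * d ^+ 2) + 3 * (J * e * (J * e) - d ^+ 2 * d ^+ 2) + 2 * ((u x - d) ^+ 2 * d ^+ 2).
    by ring.
  by lra.
rewrite Uaff // /c; have h1 := drift x Sx; have h2 := u4 x Sx.
have h3 : 0 <= u x ^+ 2 by rewrite exprn_even_ge0.
have : u x ^+ 3 * (U u x - u x) <= (4 * u x ^+ 2) * (B * e).
  apply: (le_trans (ler_norm _)); rewrite normrM ler_pM // exprS normrM normrX.
  by rewrite real_normK ?num_real // ler_wpM2r.
have -> : 4 * u x ^+ 3 * U u x + (- 3 * u x ^+ 4 + 8 * u x ^+ 2 * (J * e) + 3 * (J * e) ^+ 2) =
  u x ^+ 4 + 4 * (u x ^+ 3 * (U u x - u x)) + 8 * u x ^+ 2 * (J * e) + 3 * (J * e) ^+ 2 by ring.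
by lra.
Qed.

(** Here [e * K%:R] is the elapsed time. When [u x] and [e] tend to zero at fixed elapsed time, only
    the term quadratic in time remains. *)
Lemma fourth_moment_iter K x : S x ->
  iter K U (fun y => u y ^+ 4) x <= u x ^+ 4 + (16 * B + 8 * J) * (e * K%:R) * u x ^+ 2 +
    ((16 * B + 8 * J) * (8 * B + J) * (e * K%:R) ^+ 2 + 3 * J ^+ 2 * e * (e * K%:R)).
Proof.
pose C2 := 16 * B + 8 * J; pose C1 := 8 * B + J.
have C20 : 0 <= C2 by rewrite addr_ge0 ?mulr_ge0.
have C10 : 0 <= C1 by rewrite addr_ge0 ?mulr_ge0.
elim: K x => [|K IH] x Sx; first by rewrite /= !mulr0 expr0n /= !mulr0 mul0r !addr0.
rewrite iterS; pose b := C2 * (e * K%:R); pose c := C2 * C1 * (e * K%:R) ^+ 2 + 3 * J ^+ 2 * e * (e * K%:R).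
apply: (@le_trans _ _ (U (fun y => b * u y ^+ 2 + (1 * u y ^+ 4 + c)) x)).
  apply: Umono => // y nxy; apply: (le_trans (IH y (nbrS _ _ Sx nxy))).
  by rewrite le_eqVlt; apply/orP; left; apply/eqP; rewrite /b /c /C1 /C2; ring.
rewrite Ulin Uaff // mul1r.
have h1 := second_moment_step x Sx; have h2 := fourth_moment_step x Sx.
have K0 : 0 <= K%:R :> F by [].
have b0 : 0 <= b by rewrite /b !mulr_ge0.
have h3 : b * U (fun y => u y ^+ 2) x <= b * (u x ^+ 2 + C1 * e) by rewrite ler_wpM2l.
rewrite -/C2 -/C1 in h2 *; apply: (le_trans (lerD h3 (lerD h2 (lexx c)))).
rewrite -subr_ge0 -natr1 /b /c.
have -> : u x ^+ 4 + C2 * (e * (K%:R + 1)) * u x ^+ 2 +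
   (C2 * C1 * (e * (K%:R + 1)) ^+ 2 + 3 * J ^+ 2 * e * (e * (K%:R + 1))) -
   (C2 * (e * K%:R) * (u x ^+ 2 + C1 * e) + (u x ^+ 4 + C2 * e * u x ^+ 2 + 3 * (J * e) ^+ 2 +
    (C2 * C1 * (e * K%:R) ^+ 2 + 3 * J ^+ 2 * e * (e * K%:R)))) =
   C2 * C1 * e ^+ 2 * (K%:R + 1) by ring.
by apply: mulr_ge0; [apply: mulr_ge0; [exact: mulr_ge0 | exact: exprn_ge0] | exact: addr_ge0].
Qed.

End FourthMoment.

(** * The Thoma simplex *)

Lemma compact_set_type (X : topologicalType) (A : set X) :
  compact A -> compact [set: set_type A].
Proof.
move=> cA F FF _.
have FA : (fmap set_val F) A.
  have h : setT `<=` (set_val @^-1` A : set (set_type A)).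
    by move=> -[v Av] _; exact: (set_mem Av).
  exact: (filterS h filterT).
have [p [Ap clp]] := cA (fmap set_val F) _ FA.
exists (exist _ p (mem_set Ap)); split=> // B C FB [_ [[V oV <-] Vp sVC]].
have FB' : F (set_val @^-1` (set_val @` B)) by apply: (filterS _ FB) => v Bv; exists v.
have nV : nbhs p V by apply: open_nbhs_nbhs; split.
by have [_ [[b Bb <-] Vb]] := clp _ _ FB' nV; exists b; split => //; apply: sVC.
Qed.

Lemma uniform_approx_continuous (R : realType) (T : topologicalType)
    (g : nat -> T -> R) (f : T -> R) (e : nat -> R) :
  (forall n, continuous (g n)) -> (forall n x, `|g n x - f x| <= e n) ->
  e @ \oo --> 0 -> continuous f.
Proof.
move=> cg ge e0 x; apply/cvgrPdist_lt => d d0.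
have d3 : 0 < d / 3 by rewrite divr_gt0.
have /cvgrPdist_lt/(_ _ d3)[N _ HN] := e0.
have eN := HN N (leqnn N); rewrite sub0r normrN in eN.
have eN' : e N < d / 3 by rewrite (le_lt_trans _ eN) // ler_norm.
have /cvgrPdist_lt/(_ _ d3) := cg N x.
apply: filterS => y xy; have := ge N x; have := ge N y; move: xy.
rewrite !ltr_norml !ler_norml => /andP[? ?] /andP[? ?] /andP[? ?].
by apply/andP; split; lra.
Qed.

Lemma closed_le_fun (R : realType) (T : topologicalType) (g h : T -> R) :
  continuous g -> continuous h -> closed [set w | g w <= h w].
Proof.
move=> cg ch.
have E : [set w | g w <= h w] = (fun w => h w - g w) @^-1` [set x | 0 <= x].
  by apply/funext => w; apply/propext; rewrite /= subr_ge0.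
have : closed ((fun w => h w - g w) @^-1` [set x | 0 <= x]).
  apply: closed_comp; last exact: closed_ge.
  by move=> x _; apply: cvgB; [exact: ch | exact: cg].
by rewrite -E.
Qed.

Lemma continuous_cst_fun (R : realType) (T : topologicalType) (a : R) :
  continuous (fun _ : T => a).
Proof. by move=> w; exact: cvg_cst. Qed.

Lemma continuous_mul_fun (R : realType) (T : topologicalType) (g h : T -> R) :
  continuous g -> continuous h -> continuous (fun w => g w * h w).
Proof. by move=> cg ch w; apply: cvgM; [exact: cg | exact: ch]. Qed.

Lemma continuous_exp_fun (R : realType) (T : topologicalType) (g : T -> R) m :
  continuous g -> continuous (fun w => g w ^+ m).
Proof.
move=> cg; elim: m => [|m IH]; first exact: continuous_cst_fun.
by under eq_fun do rewrite exprS; exact: continuous_mul_fun.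
Qed.

Lemma continuous_add_fun (R : realType) (T : topologicalType) (g h : T -> R) :
  continuous g -> continuous h -> continuous (fun w => g w + h w).
Proof. by move=> cg ch w; apply: cvgD; [exact: cg | exact: ch]. Qed.

Lemma continuous_sum_fun (R : realType) (T : topologicalType) N (g : nat -> T -> R) :
  (forall i, continuous (g i)) -> continuous (fun w => \sum_(i < N) g i w).
Proof.
move=> cg; elim: N => [|N IH] w.
  by under eq_fun do rewrite big_ord0; exact: cvg_cst.
by under eq_fun do rewrite big_ord_recr /=; apply: cvgD; [exact: IH | exact: cg].
Qed.

Section ThomaSimplex.
Variable R : realType.
Local Notation Om := (Omega R).

Let fst_c : continuous (fun w : thomaX R => w.1). Proof. by move=> w; exact: cvg_fst. Qed.
Let snd_c : continuous (fun w : thomaX R => w.2). Proof. by move=> w; exact: cvg_snd. Qed.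
Let ev_c i : continuous (fun f : {ptws nat -> R} => f i).
Proof. exact: (@proj_continuous nat (fun _ => R) i). Qed.
Let c1 i : continuous (fun w : thomaX R => w.1 i).
Proof. by move=> w; apply: (continuous_comp (fst_c w) (ev_c i _)). Qed.
Let c2 i : continuous (fun w : thomaX R => w.2 i).
Proof. by move=> w; apply: (continuous_comp (snd_c w) (ev_c i _)). Qed.
Let val_c : continuous (fun w : Om => (sval w : thomaX R)).
Proof. exact: (@initial_continuous (thoma_set R) (thomaX R) set_val). Qed.

Lemma alpha_continuous i : continuous (fun w : Om => alpha R w i).
Proof. by move=> w; apply: (continuous_comp (val_c w) (c1 i _)). Qed.

Lemma beta_continuous i : continuous (fun w : Om => beta R w i).
Proof. by move=> w; apply: (continuous_comp (val_c w) (c2 i _)). Qed.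

Lemma Omega_cvg (F : set_system Om) (w : Om) : Filter F ->
  (forall i, (fun v : Om => alpha R v i) @ F --> alpha R w i) ->
  (forall i, (fun v : Om => beta R v i) @ F --> beta R w i) -> F --> w.
Proof.
move=> FF ca cb.
have h1 : (fun v : Om => (sval v).1 : {ptws nat -> R}) @ F --> ((sval w).1 : {ptws nat -> R}).
  by apply/pointwise_cvgP => t; exact: ca.
have h2 : (fun v : Om => (sval v).2 : {ptws nat -> R}) @ F --> ((sval w).2 : {ptws nat -> R}).
  by apply/pointwise_cvgP => t; exact: cb.
have h : (fun v : Om => (sval v : thomaX R)) @ F --> (sval w : thomaX R).
  move=> U [[P Q] [/= nP nQ] sPQ]; have fP : F ((fun v : Om => (sval v).1) @^-1` P) := h1 _ nP.
  have fQ : F ((fun v : Om => (sval v).2) @^-1` Q) := h2 _ nQ.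
  suff : F ((fun v : Om => (sval v : thomaX R)) @^-1` U) by [].
  by apply: (filterS _ (filterI fP fQ)) => v [Pv Qv]; exact: (sPQ (sval v) (conj Pv Qv)).
move=> A [_ [[B oB <-] Bw sBA]].
have fB : F (set_val @^-1` B) := h B (open_nbhs_nbhs (conj oB Bw)).
exact: (filterS sBA fB).
Qed.

(** All conditions are closed, and the bound on the partial sums confines every coordinate to the
    unit interval, so Tychonoff's theorem applies. *)
Lemma thoma_set_compact : compact (thoma_set R).
Proof.
have bigC (P : nat -> thomaX R -> Prop) : (forall i, closed [set w | P i w]) ->
    closed [set w | forall i, P i w].
  move=> cP; rewrite (_ : [set w | forall i, P i w] = \bigcap_i [set w | P i w]).
    by apply: closed_bigI => i _; exact: cP.
  by apply/seteqP; split=> w h i; [move=> _; exact: h | exact: (h i I)].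
have c0 (a : R) := @continuous_cst_fun R (thomaX R) a.
have cl : closed (thoma_set R).
  pose A1 : set (thomaX R) := [set w | forall i, 0 <= w.1 i].
  pose A2 : set (thomaX R) := [set w | forall i, 0 <= w.2 i].
  pose A3 : set (thomaX R) := [set w | forall i, w.1 i.+1 <= w.1 i].
  pose A4 : set (thomaX R) := [set w | forall i, w.2 i.+1 <= w.2 i].
  pose A5 : set (thomaX R) := [set w : thomaX R | forall N : nat, \sum_(i < N) (w.1 i + w.2 i) <= 1].
  suff : closed (A1 `&` (A2 `&` (A3 `&` (A4 `&` A5)))) by [].
  apply: closedI; first by apply: bigC => i; apply: closed_le_fun.
  apply: closedI; first by apply: bigC => i; apply: closed_le_fun.
  apply: closedI; first by apply: bigC => i; apply: closed_le_fun.
  apply: closedI; first by apply: bigC => i; apply: closed_le_fun.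
  apply: bigC => N; apply: closed_le_fun => //.
  apply: (@continuous_sum_fun R (thomaX R) N (fun i w => w.1 i + w.2 i)) => i.
  by apply: continuous_add_fun; [exact: c1 | exact: c2].
pose K : set {ptws nat -> R} := [set f | forall i, `[0, 1]%classic (f i)].
have cK : compact K by apply: (@tychonoff nat (fun _ => R) (fun _ => `[0, 1]%classic)) => i; exact: segment_compact.
have cKK : compact (K `*` K) by apply: compact_setX.
apply: (subclosed_compact cl cKK) => w [w1 [w2 [_ [_ w5]]]].
have le1 i : w.1 i + w.2 i <= 1.
  apply: le_trans (w5 i.+1); rewrite big_ord_recr /= lerDr sumr_ge0 // => j _.
  by rewrite addr_ge0.
split=> i /=; rewrite in_itv /=; first by rewrite w1 (le_trans _ (le1 i)) // lerDl.
by rewrite w2 (le_trans _ (le1 i)) // lerDr.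
Qed.

Lemma Omega_compact : compact [set: Om].
Proof. exact: compact_set_type thoma_set_compact. Qed.

Lemma alpha_ge0 (w : Om) i : 0 <= alpha R w i.
Proof. by have [h _] := set_mem (valP w); exact: h. Qed.
Lemma beta_ge0 (w : Om) i : 0 <= beta R w i.
Proof. by have [_ [h _]] := set_mem (valP w); exact: h. Qed.
Lemma alpha_noninc (w : Om) i : alpha R w i.+1 <= alpha R w i.
Proof. by have [_ [_ [h _]]] := set_mem (valP w); exact: h. Qed.
Lemma beta_noninc (w : Om) i : beta R w i.+1 <= beta R w i.
Proof. by have [_ [_ [_ [h _]]]] := set_mem (valP w); exact: h. Qed.
Lemma alpha_beta_sum (w : Om) N : \sum_(i < N) (alpha R w i + beta R w i) <= 1.
Proof. by have [_ [_ [_ [_ h]]]] := set_mem (valP w); exact: h. Qed.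

Lemma Omega_ext (v w : Om) : alpha R v = alpha R w -> beta R v = beta R w -> v = w.
Proof.
move=> ea eb; apply: val_inj; case: v w ea eb => -[a b] h [[a' b'] h'].
by rewrite /alpha /beta /= => -> ->.
Qed.

Definition simplex_seq (x : nat -> R) :=
  [/\ forall i, 0 <= x i, forall i, x i.+1 <= x i & forall N, \sum_(i < N) x i <= 1].

Lemma alpha_simplex w : simplex_seq (alpha R w).
Proof.
split; [exact: alpha_ge0 | exact: alpha_noninc | move=> N].
by apply: le_trans (alpha_beta_sum w N); apply: ler_sum => i _; rewrite lerDl beta_ge0.
Qed.

Lemma beta_simplex w : simplex_seq (beta R w).
Proof.
split; [exact: beta_ge0 | exact: beta_noninc | move=> N].
by apply: le_trans (alpha_beta_sum w N); apply: ler_sum => i _; rewrite lerDr alpha_ge0.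
Qed.

Lemma simplex_noninc x i j : simplex_seq x -> (i <= j)%N -> x j <= x i.
Proof.
move=> [_ x1 _]; elim: j => [|j IH]; first by rewrite leqn0 => /eqP ->.
rewrite leq_eqVlt => /orP[/eqP -> //|]; rewrite ltnS => /IH; exact: le_trans.
Qed.

Lemma simplex_le x i : simplex_seq x -> i.+1%:R * x i <= 1.
Proof.
move=> sx; have [x0 _ x2] := sx; apply: le_trans (x2 i.+1).
rewrite mulr_natl -[X in _ *+ X](card_ord i.+1) -sumr_const; apply: ler_sum => j _.
by apply: simplex_noninc => //; rewrite -ltnS.
Qed.

Lemma simplex_le1 x i : simplex_seq x -> x i <= 1.
Proof.
move=> sx; have [x0 _ _] := sx; apply: le_trans (simplex_le x 0 sx).
by rewrite mul1r; apply: simplex_noninc.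
Qed.

(** By monotonicity each term is at most [x M ^+ m * x i], and the [x i] sum to at most one. *)
Lemma simplex_sum_pow x M N m : simplex_seq x ->
  \sum_(M <= i < N) x i ^+ m.+1 <= x M ^+ m.
Proof.
move=> sx; have [x0 _ x2] := sx.
have [NM|MN] := leqP N M; first by rewrite big_geq // exprn_ge0.
apply: (@le_trans _ _ (\sum_(M <= i < N) x M ^+ m * x i)).
  apply: ler_sum_nat => i /andP[Mi _]; rewrite exprS mulrC ler_wpM2r //.
  by rewrite lerXn2r ?nnegrE // simplex_noninc.
rewrite -mulr_sumr ler_piMr ?exprn_ge0 //; apply: le_trans (x2 N).
rewrite -(big_mkord xpredT) [X in _ <= X](big_cat_nat _ (n := M)) ?(ltnW MN) //= lerDr.
by apply: sumr_ge0.
Qed.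

Definition powersum (x : nat -> R) m := limn (fun N => \sum_(0 <= i < N) x i ^+ m).

Lemma powersum_cvg x m : simplex_seq x ->
  (fun N => \sum_(0 <= i < N) x i ^+ m.+1) @ \oo --> powersum x m.+1.
Proof.
move=> sx; apply: nondecreasing_is_cvgn.
  apply/nondecreasing_seqP => N; rewrite big_nat_recr //= lerDl exprn_ge0 //.
  by case: sx.
exists 1 => _ [N _ <-]; apply: le_trans (simplex_sum_pow x 0 N m sx) _.
by rewrite exprn_ile1 ?(simplex_le1 _ _ sx) //; case: sx.
Qed.

Lemma powersum_dist x m N : simplex_seq x ->
  0 <= powersum x m.+1 - \sum_(0 <= i < N) x i ^+ m.+1 <= x N ^+ m.
Proof.
move=> sx; have c := powersum_cvg x m sx; rewrite subr_ge0 lerBlDl; apply/andP; split.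
  apply: (cvgr_to_ge c); exists N => // M /= NM.
  rewrite [X in _ <= X](big_cat_nat _ (n := N)) //= lerDl sumr_ge0 // => i _.
  by rewrite exprn_ge0 //; case: sx.
apply: (cvgr_to_le c); exists N => // M /= NM.
by rewrite (big_cat_nat _ (n := N)) //= lerD2l simplex_sum_pow.
Qed.

Lemma lt_pow_eventually (a b : R) : 0 <= b -> b < a ->
  exists M, forall m, (M <= m)%N -> b ^+ m < a ^+ m.+1.
Proof.
move=> b0 ba; have a0 : 0 < a by apply: le_lt_trans ba.
have ba1 : `|b / a| < 1 by rewrite ger0_norm ?divr_ge0 ?(ltW a0) // ltr_pdivrMr // mul1r.
have /cvgrPdist_lt/(_ _ a0)[M _ HM] := cvg_expr ba1.
exists M => m Mm; have := HM m Mm; rewrite sub0r normrN ger0_norm; last first.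
  by rewrite exprn_ge0 // divr_ge0 // ltW.
by rewrite expr_div_n ltr_pdivrMr ?exprn_gt0 // exprS.
Qed.

(** At the first disagreement the whole tail of [x] is at most [x i ^+ m], which for large [m] is
    below the single term [y i ^+ m.+1]. *)
Lemma powersum_lt_eventually x y i : simplex_seq x -> simplex_seq y ->
  (forall j, (j < i)%N -> x j = y j) -> x i < y i ->
  exists M, forall m, (M <= m)%N -> powersum x m.+1 < powersum y m.+1.
Proof.
move=> sx sy xy xyi; have [x0 _ _] := sx; have [M HM] := lt_pow_eventually _ _ (x0 i) xyi.
exists M => m Mm; have := HM _ Mm.
have /andP[_] := powersum_dist x m i sx; have /andP[+ _] := powersum_dist y m i.+1 sy.
rewrite big_nat_recr //=.
have -> : \sum_(0 <= j < i) x j ^+ m.+1 = \sum_(0 <= j < i) y j ^+ m.+1.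
  by apply: eq_big_nat => j /andP[_ ji]; rewrite xy.
lra.
Qed.

Lemma powersum_trichotomy x y : simplex_seq x -> simplex_seq y ->
  [\/ x = y, exists M, forall m, (M <= m)%N -> powersum x m.+1 < powersum y m.+1
   | exists M, forall m, (M <= m)%N -> powersum y m.+1 < powersum x m.+1].
Proof.
move=> sx sy; have [xy|/eqP nxy] := pselect (x = y); first by apply: Or31.
have ex : exists i, x i != y i.
  apply/not_existsP => h; case/eqP: nxy; apply/funext => i.
  by apply/eqP/negPn/negP/h.
have [i nxyi mini] := ex_minnP ex.
have xy j : (j < i)%N -> x j = y j.
  by move=> ji; apply/eqP/negPn/negP => /mini; rewrite leqNgt ji.
move: nxyi; rewrite neq_lt => /orP[h|h].
  by apply: Or32; apply: powersum_lt_eventually h.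
by apply: Or33; apply: (powersum_lt_eventually y x i) h => // j /xy.
Qed.

(* The moment coordinate [q_(k.+1)] of the paper. *)
Definition qmom k (w : Om) : R :=
  powersum (alpha R w) k.+2 - (-1) ^+ k.+2 * powersum (beta R w) k.+2.

(** The exponents are at least two, so the tail beyond [N] is at most the [N]-th coordinate, which
    is at most [1 / (N + 1)] uniformly on the simplex; the factor [2] in [e] counts both
    sequences. *)
Lemma qmom_continuous k : continuous (qmom k).
Proof.
pose g N (w : Om) : R := \sum_(i < N) (alpha R w i ^+ k.+2 + - (-1) ^+ k.+2 * beta R w i ^+ k.+2).
pose e N : R := 2 * harmonic N.
apply: (@uniform_approx_continuous _ _ g _ e) => [N w|N w|].
- apply: (@continuous_sum_fun R Om N (fun i w => alpha R w i ^+ k.+2 + - (-1) ^+ k.+2 * beta R w i ^+ k.+2)) => i.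
  apply: continuous_add_fun; first by apply: continuous_exp_fun; exact: alpha_continuous.
  apply: continuous_mul_fun; first exact: continuous_cst_fun.
  by apply: continuous_exp_fun; exact: beta_continuous.
- have h x : simplex_seq x -> `|\sum_(0 <= i < N) x i ^+ k.+2 - powersum x k.+2| <= harmonic N.
    move=> sx; have [x0 _ _] := sx; have /andP[h1 h2] := powersum_dist x k.+1 N sx.
    rewrite distrC ger0_norm // (le_trans h2) //.
    apply: (@le_trans _ _ (x N)).
      by rewrite exprS ler_piMr // exprn_ile1 // simplex_le1.
    by rewrite /harmonic /= -[X in _ <= X]mul1r ler_pdivlMr // mulrC simplex_le.
  have -> : g N w - qmom k w = (\sum_(0 <= i < N) alpha R w i ^+ k.+2 - powersum (alpha R w) k.+2)
     - (-1) ^+ k.+2 * (\sum_(0 <= i < N) beta R w i ^+ k.+2 - powersum (beta R w) k.+2).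
    by rewrite /g /qmom big_split /= -mulr_sumr !big_mkord; ring.
  rewrite (le_trans (ler_normB _ _)) // normrM normrX normrN1 expr1n mul1r.
  have := h _ (alpha_simplex w); have := h _ (beta_simplex w); rewrite /e; lra.
- rewrite -(mulr0 2); apply: cvgMr; exact: cvg_harmonic.
Qed.

Lemma qmom_norm_le k w : `|qmom k w| <= 2.
Proof.
have h x : simplex_seq x -> `|powersum x k.+2| <= 1.
  move=> sx; have [x0 _ _] := sx; have := powersum_dist x k.+1 0 sx.
  rewrite big_geq // subr0 => /andP[p0 p1]; rewrite ger0_norm // (le_trans p1) //.
  by rewrite exprn_ile1 // simplex_le1.
rewrite /qmom (le_trans (ler_normB _ _)) // normrM normrX normrN1 expr1n mul1r.
by rewrite -[2]/(1 + 1) lerD // h //; [exact: alpha_simplex | exact: beta_simplex].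
Qed.

(** Even exponents fix the difference of the two power sums and odd ones their sum. For large
    exponents the former rules out strict inequalities in opposite directions, the latter those in
    the same direction or on one side only. *)
Lemma qmom_separates v w : (forall k, qmom k v = qmom k w) -> v = w.
Proof.
move=> E.
have ev M : exists2 m, (M <= m)%N & powersum (alpha R v) m.+1 - powersum (beta R v) m.+1 =
    powersum (alpha R w) m.+1 - powersum (beta R w) m.+1.
  exists (2 * M).+1; first by lia.
  by have := E (2 * M)%N; rewrite /qmom -addn2 exprD sqrrN expr1n mulr1 exprM sqrrN !expr1n !mul1r !addn2.
have od M : exists2 m, (M <= m)%N & powersum (alpha R v) m.+1 + powersum (beta R v) m.+1 =
    powersum (alpha R w) m.+1 + powersum (beta R w) m.+1.
  exists (2 * M).+2; first by lia.
  have := E (2 * M).+1; rewrite /qmom -addn2 exprD sqrrN expr1n mulr1 exprS exprM sqrrN !expr1n !mulr1 !addn2.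
  by rewrite !mulN1r !opprK.
have [ea|[M1 h1]|[M1 h1]] := powersum_trichotomy _ _ (alpha_simplex v) (alpha_simplex w);
have [eb|[M2 h2]|[M2 h2]] := powersum_trichotomy _ _ (beta_simplex v) (beta_simplex w).
- exact: Omega_ext.
- by exfalso; have [m /h2 + ] := od M2; rewrite ea; lra.
- by exfalso; have [m /h2 + ] := od M2; rewrite ea; lra.
- by exfalso; have [m /h1 + ] := od M1; rewrite eb; lra.
- exfalso; have [m mM] := od (maxn M1 M2).
  by have := h1 m (leq_trans (leq_maxl _ _) mM); have := h2 m (leq_trans (leq_maxr _ _) mM); lra.
- exfalso; have [m mM] := ev (maxn M1 M2).
  by have := h1 m (leq_trans (leq_maxl _ _) mM); have := h2 m (leq_trans (leq_maxr _ _) mM); lra.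
- by exfalso; have [m /h1 + ] := od M1; rewrite eb; lra.
- exfalso; have [m mM] := ev (maxn M1 M2).
  by have := h1 m (leq_trans (leq_maxl _ _) mM); have := h2 m (leq_trans (leq_maxr _ _) mM); lra.
- exfalso; have [m mM] := od (maxn M1 M2).
  by have := h1 m (leq_trans (leq_maxl _ _) mM); have := h2 m (leq_trans (leq_maxr _ _) mM); lra.
Qed.

End ThomaSimplex.

Lemma continuous_opp_fun (R : realType) (T : topologicalType) (g : T -> R) :
  continuous g -> continuous (fun w => - g w).
Proof. by move=> cg w; apply: cvgN; exact: cg. Qed.

Lemma continuous_min_fun (R : realType) (T : topologicalType) (g h : T -> R) :
  continuous g -> continuous h -> continuous (fun w => Num.min (g w) (h w)).
Proof. by move=> cg ch w; apply: continuous_min; [exact: cg | exact: ch]. Qed.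

Lemma continuous_max_fun (R : realType) (T : topologicalType) (g h : T -> R) :
  continuous g -> continuous h -> continuous (fun w => Num.max (g w) (h w)).
Proof. by move=> cg ch w; apply: continuous_max; [exact: cg | exact: ch]. Qed.

Lemma hausdorff_of_separating (R : realType) (T : topologicalType) (J : Type) (q : J -> T -> R) :
  (forall j, continuous (q j)) -> (forall v w, (forall j, q j v = q j w) -> v = w) ->
  hausdorff_space T.
Proof.
move=> cq sep v w clvw; apply: sep => j; apply/eqP/negPn/negP => ne.
pose d := `|q j v - q j w| / 2.
have d0 : 0 < d by rewrite divr_gt0 // normr_gt0 subr_eq0.
have /cvgrPdist_lt/(_ _ d0) nv := cq j v; have /cvgrPdist_lt/(_ _ d0) nw := cq j w.
have [u [/= h1 h2]] := clvw _ _ nv nw.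
have := ler_distD (q j u) (q j v) (q j w); rewrite [`|q j u - _|]distrC.
by move: h1 h2; rewrite /d; lra.
Qed.

Lemma cvg_of_separating (R : realType) (T : topologicalType) (J : Type) (q : J -> T -> R)
    (F : set_system T) (w : T) : ProperFilter F -> compact [set: T] ->
  (forall j, continuous (q j)) -> (forall v w, (forall j, q j v = q j w) -> v = w) ->
  (forall j, q j @ F --> q j w) -> F --> w.
Proof.
move=> FF cT cq sep cF U; rewrite nbhsE => -[V [oV Vw] sVU].
apply/not_notP => nFU.
(* The filter generated by [F] and the complement of [U], proper because [U] is assumed not to be in
   [F]. Its cluster point must be [w], which contradicts the openness of [V]. *)
pose G : set_system T := fun A => F (A `|` U).
have GF : ProperFilter G.
  split; first by rewrite /G set0U.
  split.
  - by rewrite /G setTU; exact: filterT.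
  - by move=> A B GA GB; rewrite /G setUIl; exact: filterI.
  - by move=> A B AB GA; apply: (@filterS _ F _ (A `|` U) (B `|` U)) => // x [/AB|]; [left|right].
have FG : F `<=` G by move=> A; apply: filterS => x; left.
have [p [_ clp]] := cT G GF (@filterT _ G _).
have pw : p = w.
  apply: sep => j; apply/eqP/negPn/negP => ne.
  pose d := `|q j p - q j w| / 2.
  have d0 : 0 < d by rewrite divr_gt0 // normr_gt0 subr_eq0.
  have /cvgrPdist_lt/(_ _ d0) nv := cq j p.
  have /cvgrPdist_lt/(_ _ d0) nw := cF j.
  have [u [/= h1 h2]] := clp _ _ (FG _ nw) nv.
  have := ler_distD (q j u) (q j p) (q j w); rewrite [`|q j u - _|]distrC.
  by move: h1 h2; rewrite /d; lra.
have GU : G (~` U) by rewrite /G setvU; exact: filterT.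
have nV : nbhs p V by rewrite pw; apply: open_nbhs_nbhs; split.
by have [u [nUu Vu]] := clp _ _ GU nV; apply: nUu; apply: sVU.
Qed.

(* A compact space with countably many separating functions is metrizable, so every open
   set is the set where some continuous function does not vanish. *)
Lemma open_cozero (R : realType) (T : topologicalType) (q : nat -> T -> R) (U : set T) :
  compact [set: T] -> (forall j, continuous (q j)) ->
  (forall v w, (forall j, q j v = q j w) -> v = w) -> (forall j w, `|q j w| <= 2) ->
  open U -> exists f : T -> R, [/\ continuous f, forall w, 0 <= f w <= 1 & U = [set w | 0 < f w]].
Proof.
move=> cT cq sep qb oU.
have hT := hausdorff_of_separating _ _ _ _ cq sep.
have cU : compact (~` U) by apply: (subclosed_compact (open_closedC oU) cT).
(* The infimum that defines a distance needs a nonempty complement; for the whole space a constant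
   serves. *)
have [[x0 x0U]|nU] := pselect (exists x0, ~ U x0); last first.
  exists (fun=> 1); split => [|w|]; first exact: continuous_cst_fun.
    by rewrite ler01 lexx.
  apply/seteqP; split => w _ /=; first exact: ltr01.
  by apply/not_notP => nw; apply: nU; exists w.
(* Partial sums of the metric [rho]. Each difference is at most [4], whence the tail bound
   [8 * (1 / 2) ^+ M], uniform in both points. *)
pose S N v w : R := \sum_(0 <= k < N) (1 / 2) ^+ k * `|q k v - q k w|.
have S_inc v w : nondecreasing_seq (S ^~ v ^~ w).
  by apply/nondecreasing_seqP => N; rewrite /S big_nat_recr //= lerDl mulr_ge0 // exprn_ge0.
have qd k v w : `|q k v - q k w| <= 4.
  by rewrite (le_trans (ler_normB _ _)) // (_ : 4 = 2 + 2) ?lerD // -natrD.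
have tail M N v w : (M <= N)%N -> S N v w - S M v w <= 8 * (1 / 2) ^+ M.
  move=> MN; rewrite /S (big_cat_nat _ (n := M)) //= addrAC subrr add0r.
  have : \sum_(M <= k < N) (1 / 2 : R) ^+ k * `|q k v - q k w| <= \sum_(M <= k < N) 4 * (1 / 2) ^+ k.
    by apply: ler_sum_nat => k _; rewrite mulrC ler_wpM2r // exprn_ge0.
  move/le_trans; apply.
  have : \sum_(M <= k < N) 4 * (1 / 2 : R) ^+ k = 8 * (1 / 2) ^+ M - 8 * (1 / 2) ^+ N.
    elim: N MN => [|N IH]; first by rewrite leqn0 => /eqP ->; rewrite big_geq // subrr.
    rewrite leq_eqVlt => /orP[/eqP -> |]; first by rewrite big_geq // subrr.
    by rewrite ltnS => MN; rewrite big_nat_recr //= IH // exprS; field.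
  by move=> ->; rewrite lerBlDr lerDl mulr_ge0 // exprn_ge0.
pose rho v w := limn (S ^~ v ^~ w).
have Sc v w : (S ^~ v ^~ w) @ \oo --> rho v w.
  apply: nondecreasing_is_cvgn => //; exists 8 => _ [N _ <-].
  by have := tail 0%N N v w isT; rewrite /S [X in _ - X]big_geq // subr0 expr0 mulr1.
have Srho N v w : S N v w <= rho v w by apply: nondecreasing_cvgn_le => //; apply/cvg_ex; exists (rho v w).
have rhoS N v w : rho v w - S N v w <= 8 * (1 / 2) ^+ N.
  rewrite lerBlDr; apply: (cvgr_to_le (Sc v w)); exists N => // M /= NM.
  by rewrite -lerBlDr tail.
have rho_c v : continuous (rho v).
  apply: (@uniform_approx_continuous _ _ (fun N => S N v) _ (fun N => 8 * (1 / 2) ^+ N)) => [N|N w|].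
  - rewrite /S; under eq_fun do rewrite big_mkord.
    apply: (@continuous_sum_fun R T N (fun k w => (1 / 2) ^+ k * `|q k v - q k w|)) => k.
    apply: continuous_mul_fun; first exact: continuous_cst_fun.
    by move=> w; apply: cvg_norm; apply: cvgB; [exact: cvg_cst | exact: cq].
  - by rewrite distrC ger0_norm ?subr_ge0 ?Srho // rhoS.
  - by apply: cvg_geometric; rewrite ger0_norm //; lra.
have rho_ge0 v w : 0 <= rho v w by have := Srho 0%N v w; rewrite /S big_geq.
have rho_tri u v w : rho u w <= rho u v + rho v w.
  apply: (ler_cvg_to (Sc u w) (cvgD (Sc u v) (Sc v w))); apply: nearW => N.
  rewrite -[leRHS]/(S N u v + S N v w) /S -big_split /=; apply: ler_sum => k _; rewrite -mulrDr ler_wpM2l ?exprn_ge0 //.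
  exact: ler_distD.
have rho_sym v w : rho v w = rho w v.
  rewrite /rho; congr (limn _); apply/funext => N; apply: eq_bigr => k _.
  by rewrite distrC.
have rho_vv v : rho v v = 0.
  rewrite /rho (_ : (S ^~ v ^~ v) = fun=> 0) ?lim_cst //; apply/funext => N.
  by rewrite /S big1 // => k _; rewrite subrr normr0 mulr0.
have rho_gt0 v w : rho v w = 0 -> v = w.
  move=> r0; apply: sep => k; have := Srho k.+1 v w; rewrite r0 /S big_nat_recr //=.
  have s0 : 0 <= \sum_(0 <= i < k) (1 / 2 : R) ^+ i * `|q i v - q i w|.
    by apply: sumr_ge0 => i _; rewrite mulr_ge0 // exprn_ge0.
  move=> h; have : (1 / 2 : R) ^+ k * `|q k v - q k w| <= 0 by lra.
  rewrite pmulr_rle0 ?exprn_gt0 // normr_le0 subr_eq0 => /eqP //.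
pose D w := [set rho w u | u in ~` U].
have D0 w : D w !=set0 by exists (rho w x0); exists x0.
have Dlb w : lbound (D w) 0 by move=> _ [u _ <-].
have Dinf w u : ~ U u -> inf (D w) <= rho w u.
  by move=> nu; apply: ge_inf; [exists 0 | exists u].
have lip v w : inf (D v) <= inf (D w) + rho v w.
  rewrite -lerBlDr; apply: lb_le_inf => // _ [u nu <-].
  by rewrite lerBlDr (le_trans (Dinf v u nu)) // addrC rho_tri.
pose f w := Num.min 1 (inf (D w)).
have infc : continuous (fun w => inf (D w)).
  move=> w; apply/cvgrPdist_lt => e e0.
  have /cvgrPdist_lt/(_ _ e0) := rho_c w w; apply: filterS => v.
  rewrite rho_vv sub0r normrN ger0_norm // => h.
  have := lip v w; have := lip w v; rewrite (rho_sym v w) ltr_norml => h1 h2.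
  by apply/andP; split; lra.
exists f; split.
- exact: continuous_min_fun (continuous_cst_fun _ _ 1) infc.
- by move=> w; rewrite /f le_min ler01 lb_le_inf //= ge_min lexx.
- apply/seteqP; split => w.
    move=> Uw; rewrite /f /= lt_min ltr01 /=.
    (* The complement is compact, so the distance is attained and hence positive at points of
       [U]. *)
    have [c] : exists2 c, c \in ~` U & forall t, t \in ~` U -> rho w c <= rho w t.
      apply: compact_EVT_min => //; first by exists x0.
      by apply: continuous_subspaceT; exact: rho_c.
    rewrite inE => nc cmin.
    have : 0 < rho w c.
      rewrite lt_neqAle rho_ge0 eq_sym andbT; apply/eqP => /rho_gt0 wc.
      by apply: nc; rewrite -wc.
    move/lt_le_trans; apply; apply: lb_le_inf => // _ [u nu <-]; apply: cmin.
    by rewrite inE.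
  rewrite /f /= lt_min => /andP[_ h]; apply/not_notP => nw.
  by have := Dinf w w nw; rewrite rho_vv leNgt h.
Qed.

(** * Moments of the up-down chain *)

Section UpDownOperator.
Variables (R : realType) (z z' : complex.complex R).

Definition paramA : R := complex.Re (z + z').
Definition paramB : R := complex.Re (z * z').

Lemma complex_int (c : int) : c%:~R = complex.Complex c%:~R 0 :> complex.complex R.
Proof. by rewrite -[RHS]/(complex.real_complex R c%:~R) rmorph_int. Qed.

Lemma Re_shift (c : int) :
  complex.Re ((z + c%:~R) * (z' + c%:~R)) = jumpw R paramA paramB c%:~R.
Proof.
rewrite complex_int /jumpw /paramA /paramB; case: z => a b; case: z' => a' b' /=.
by ring.
Qed.

Lemma Tn_updown n g l : is_partition n l -> Tn R z z' n g l = updown R paramA paramB n g l.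
Proof.
move=> pl; rewrite /Tn /updown.
pose G nu := complex.Re ((z + (box_content nu l)%:~R) * (z' + (box_content nu l)%:~R))
      / (complex.Re (z * z') + n%:R) * (dimY nu)%:R / (n.+1%:R * (dimY l)%:R) *
      \sum_(lt <- Yd n) pdown R nu lt * g lt.
transitivity (\sum_(nu <- Yd n.+1 | covers nu l) G nu).
  rewrite [RHS]big_mkcond; apply: eq_bigr => nu _; rewrite /pup /G.
  by case: ifP => _ //; rewrite mul0r.
rewrite (sum_covers_up _ _ _ n.+2) //; apply: eq_bigr => i ai.
have pa := addbox_partition _ _ pl _ ai.
rewrite /G (box_content_addbox _ _ _ pl) // Re_shift /stepup rmorphB /= -/(upc R l i) mulrA.
congr (_ * _); rewrite -(sum_covers_down _ _ _ n.+2 (fun m => (dimY m)%:R / (dimY (addbox l i))%:R * g m) pa) //.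
by rewrite [RHS]big_mkcond; apply: eq_bigr => m _; rewrite /pdown; case: ifP => _ //; rewrite mul0r.
Qed.

Hypothesis Hzz : principal_or_complementary R z z'.

Lemma jumpw_int_ge0 (c : int) : 0 <= jumpw R paramA paramB c%:~R.
Proof.
rewrite -Re_shift complex_int; move: Hzz; case: z => a b; case: z' => a' b' /=.
case=> [[_ [-> ->]]|[N [/= -> -> /andP[h1 h2] /andP[h3 h4]]]].
  rewrite !addr0 mulrN opprK -!expr2 addr_ge0 // ?exprn_even_ge0 //.
(* In the complementary series both shifted parameters lie in one open interval between consecutive
   integers, so they have the same sign. In the principal series the product was a squared
   modulus. *)
rewrite !addr0 mulr0 subr0; have [cN|cN] := lerP 0 (N + c).
  have : 0 <= (N + c)%:~R :> R by rewrite ler0z.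
  by rewrite rmorphD /= => h; apply: mulr_ge0; lra.
have : (N + c + 1)%:~R <= 0 :> R by rewrite lerz0; lia.
by move: h2 h4; rewrite !rmorphD /= => h2 h4 h; apply: mulr_le0; lra.
Qed.

Lemma paramB_ge0 : 0 <= paramB.
Proof. by have := jumpw_int_ge0 0; rewrite /jumpw expr0n mulr0 /= !add0r. Qed.

(** The diagrams reachable in one step: restricting monotonicity to them is what lets a bound on
    single jumps enter the moment estimate. *)
Definition nbr n (l l' : seq nat) := is_partition n l /\ exists i k : 'I_n.+2,
  [/\ addable l i, removable (addbox l i) k & l' = rembox (addbox l i) k].

Lemma nbr_partition n l l' : nbr n l l' -> is_partition n l'.
Proof.
by move=> [pl [i [k [ai rk ->]]]]; exact: (rembox_partition _ _ (addbox_partition _ _ pl _ ai) _ rk).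
Qed.

Lemma upc_int l i : upc R l i = ((rw l i)%:Z - i%:Z)%:~R.
Proof. by rewrite rmorphB. Qed.

Lemma Tn_mono n g h l : is_partition n.+1 l -> (forall l', nbr n.+1 l l' -> g l' <= h l') ->
  Tn R z z' n.+1 g l <= Tn R z z' n.+1 h l.
Proof.
move=> pl gh; rewrite !Tn_updown // /updown; apply: ler_sum => i ai.
apply: ler_wpM2l.
  rewrite /stepup mulr_ge0 // divr_ge0 ?mulr_ge0 // ?upc_int ?jumpw_int_ge0 //.
  by rewrite addr_ge0 // paramB_ge0.
apply: ler_sum => k rk; rewrite ler_wpM2l ?divr_ge0 //.
by apply: gh; split=> //; exists i, k.
Qed.

Lemma Tn_1 n l : is_partition n.+1 l -> Tn R z z' n.+1 (fun=> 1) l = 1.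
Proof.
move=> pl; rewrite Tn_updown // /updown.
have Bn : 0 < paramB + n.+1%:R by rewrite ltr_wpDl // paramB_ge0.
rewrite -[RHS](sum_stepup R paramA paramB _ _ pl Bn); apply: eq_bigr => i ai.
have pa := addbox_partition _ _ pl _ ai.
rewrite -[RHS]mulr1; congr (_ * _); rewrite -[RHS](sum_stepdown R _ n.+3 _ pa) //.
by apply: eq_bigr => k _; rewrite mulr1.
Qed.

Lemma Tn_lin n (a : R) g h l : Tn R z z' n (fun m => a * g m + h m) l = a * Tn R z z' n g l + Tn R z z' n h l.
Proof.
rewrite /Tn mulr_sumr -big_split; apply: eq_bigr => nu _ /=.
rewrite mulrCA -mulrDr; congr (_ * _); rewrite mulr_sumr -big_split.
by apply: eq_bigr => m _ /=; rewrite mulrDr mulrCA.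
Qed.

End UpDownOperator.

(** * Moment coordinates of a diagram as content sums *)

Section MomentOfDiagram.
Variable R : realType.

Lemma iota_pt_thoma n l : is_partition n.+1 l -> thoma_set R (iota_pt R n.+1 l).
Proof.
move=> pl; pose d := frob_d l; have n0 : 0 < n.+1%:R :> R by rewrite ltr0n.
have n_ge0 : 0 <= n.+1%:R^-1 :> R by rewrite invr_ge0 ltW.
have A0 k : (k < d)%N -> 0 <= frobA R l k := frobA_ge0 R _ _ k pl.
have B0 k : (k < d)%N -> 0 <= frobB R l k := frobB_ge0 R _ _ k pl.
have a_ge0 k : 0 <= (iota_pt R n.+1 l).1 k by rewrite /=; case: ifP => // /A0 h; rewrite mulr_ge0.
have b_ge0 k : 0 <= (iota_pt R n.+1 l).2 k by rewrite /=; case: ifP => // /B0 h; rewrite mulr_ge0.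
split=> //; split=> //; split=> [k|].
  rewrite /=; case: ifP => h1; last exact: a_ge0.
  rewrite (ltnW h1) ler_wpM2r // lerD2r lerB //; first by rewrite ler_nat (rw_antitone _ _ _ _ pl).
  by rewrite ler_nat.
split=> [k|N].
  rewrite /=; case: ifP => h1; last exact: b_ge0.
  rewrite (ltnW h1) ler_wpM2r // lerD2r lerB //; first by rewrite ler_nat (conjp_antitone _ _ _ _ pl).
  by rewrite ler_nat.
have full : \sum_(i < d) ((iota_pt R n.+1 l).1 i + (iota_pt R n.+1 l).2 i) = 1.
  transitivity ((\sum_(i < d) (frobA R l i + frobB R l i)) / n.+1%:R).
    by rewrite mulr_suml; apply: eq_bigr => i _; rewrite /= ltn_ord -/(frobA R l i) -/(frobB R l i) -mulrDl.
  by rewrite (frobenius_sum R _ _ pl) divff ?gt_eqF.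
rewrite -full.
have [Nd|dN] := leqP N d.
  rewrite (big_ord_widen d (fun i => (iota_pt R n.+1 l).1 i + (iota_pt R n.+1 l).2 i)) // big_mkcond /=.
  by apply: ler_sum => i _; case: ifP => // _; exact: addr_ge0 (a_ge0 i) (b_ge0 i).
rewrite [X in _ <= X](big_ord_widen N (fun i => (iota_pt R n.+1 l).1 i + (iota_pt R n.+1 l).2 i) (ltnW dN)).
rewrite [leRHS]big_mkcond; apply: ler_sum => i _; case: ifPn => // di.
by rewrite /= -/d (negbTE di) addr0.
Qed.

Lemma iota_nE n l : is_partition n.+1 l ->
  alpha R (iota_n R n.+1 l) = (iota_pt R n.+1 l).1 /\ beta R (iota_n R n.+1 l) = (iota_pt R n.+1 l).2.
Proof. by move=> pl; rewrite /iota_n; case: pselect => // h; exfalso; apply: h; exact: iota_pt_thoma. Qed.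

Lemma powersum_finite (x : nat -> R) m d : (forall i, (d <= i)%N -> x i = 0) ->
  powersum R x m.+1 = \sum_(i < d) x i ^+ m.+1.
Proof.
move=> x0; apply: cvg_lim => //; apply: (@cvg_trans _ ((fun=> \sum_(i < d) x i ^+ m.+1) @ \oo)); last exact: cvg_cst.
apply: near_eq_cvg; exists d => // N /= dN.
rewrite (big_cat_nat _ (n := d)) //= big_mkord [X in _ + X]big_nat_cond [X in _ + X]big1 ?addr0 // => i.
by case/andP=> /andP[di _] _; rewrite x0 // expr0n.
Qed.

Definition boxpow m (c : R) := (c + 2^-1) ^+ m - (c - 2^-1) ^+ m.

(** The sign in [qmom] is that of a power of [- frobB], so this is [csum_frobenius] for a monomial,
    scaled by the size of the diagram. *)
Lemma qmom_iota k n l : is_partition n.+1 l ->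
  qmom R k (iota_n R n.+1 l) = csum R (boxpow k.+2) l / n.+1%:R ^+ k.+2.
Proof.
move=> pl; have [Ea Eb] := iota_nE n l pl; rewrite /qmom Ea Eb.
rewrite !(powersum_finite _ _ (frob_d l)); try by move=> i di; rewrite /= ltnNge di.
rewrite (csum_frobenius R (fun c => c ^+ k.+2) _ _ pl) mulr_suml mulr_sumr -sumrB; apply: eq_bigr => i _.
rewrite /= ltn_ord -/(frobA R l i) -/(frobB R l i) !expr_div_n [(- frobB R l i) ^+ _]exprNn.
by rewrite mulrA mulrBl.
Qed.

(** The leading powers cancel, so the degree drops by one; a step multiplies by [c] and adds half
    the sum of the two shifted powers, expanded binomially. *)
Lemma boxpow_expand m : exists a : nat -> R, forall c, boxpow m.+1 c = \sum_(j < m.+1) a j * c ^+ j.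
Proof.
elim: m => [|m [a Ha]].
  by exists (fun=> 1) => c; rewrite big_ord1 /boxpow !expr1 expr0; field.
exists (fun j => (if j is j'.+1 then a j' else 0) + (if (j <= m.+1)%N then 2^-1 * ((2^-1) ^+ (m.+1 - j) + (- 2^-1) ^+ (m.+1 - j)) *+ 'C(m.+1, j) else 0)) => c.
have -> : boxpow m.+2 c = c * boxpow m.+1 c + 2^-1 * ((c + 2^-1) ^+ m.+1 + (c - 2^-1) ^+ m.+1).
  by rewrite /boxpow !exprS; ring.
under [RHS]eq_bigr do rewrite mulrDl.
rewrite big_split /=; congr (_ + _).
  rewrite big_ord_recl /= mul0r add0r Ha mulr_sumr; apply: eq_bigr => j _.
  by rewrite /= /bump /= exprS; ring.
rewrite [c + _]addrC [c - _]addrC !exprDn -big_split /= mulr_sumr; apply: eq_bigr => j _.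
by rewrite -ltnS ltn_ord -mulrnDl -mulrDl !mulrnAr !mulrnAl mulrA.
Qed.

Lemma csum_sum m (a : nat -> R) l :
  csum R (fun c => \sum_(j < m) a j * c ^+ j) l = \sum_(j < m) a j * csum R (fun c => c ^+ j) l.
Proof.
rewrite /csum.
transitivity (\sum_(i < size l) \sum_(j < m) \sum_(b < rw l i) a j * (b%:R - i%:R) ^+ j).
  by apply: eq_bigr => i _; rewrite exchange_big.
rewrite exchange_big; apply: eq_bigr => j _ /=; rewrite mulr_sumr; apply: eq_bigr => i _.
by rewrite mulr_sumr.
Qed.

End MomentOfDiagram.

(** * Drift, jumps and fourth moments of the moment coordinates *)

Section ChainMoments.
Variables (R : realType) (z z' : complex.complex R).
Hypothesis Hzz : principal_or_complementary R z z'.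
Variable k : nat.

Definition qdiag n l : R := qmom R k (iota_n R n l).

Let a : nat -> R := projT1 (cid (boxpow_expand R k.+1)).

Let boxpowE c : boxpow R k.+2 c = \sum_(j < k.+2) a j * c ^+ j.
Proof. exact: (projT2 (cid (boxpow_expand R k.+1)) c). Qed.

Let qdiagE n l : is_partition n.+1 l ->
  qdiag n.+1 l = (n.+1%:R ^+ k.+2)^-1 * \sum_(j < k.+2) a j * csum R (fun c => c ^+ j) l.
Proof.
move=> pl; rewrite /qdiag qmom_iota // mulrC -csum_sum; congr (_ * _).
by rewrite /csum; apply: eq_bigr => i _; apply: eq_bigr => j _; rewrite boxpowE.
Qed.

Let Tn_ext n (g h : seq nat -> R) l : is_partition n.+1 l -> (forall l', is_partition n.+1 l' -> g l' = h l') ->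
  Tn R z z' n.+1 g l = Tn R z z' n.+1 h l.
Proof.
move=> pl gh; apply/eqP; rewrite eq_le; apply/andP; split.
  by apply: Tn_mono => // l' /nbr_partition pl'; rewrite gh.
by apply: Tn_mono => // l' /nbr_partition pl'; rewrite gh.
Qed.

Let Tn_sum n m (b : nat -> R) (g : nat -> seq nat -> R) l :
  Tn R z z' n (fun l => \sum_(j < m) b j * g j l) l = \sum_(j < m) b j * Tn R z z' n (g j) l.
Proof.
elim: m => [|m IH].
  have := Tn_lin R z z' n 1 (fun=> 0) (fun=> 0) l.
  rewrite (_ : (fun _ => 1 * 0 + 0) = fun _ : seq nat => 0); last by apply/funext => ?; rewrite mulr0 addr0.
  rewrite (_ : (fun _ => \sum_(j < 0) _) = fun _ : seq nat => 0); last by apply/funext => ?; rewrite big_ord0.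
  by rewrite big_ord0; move: (Tn _ _ _ _ _ _) => y; lra.
rewrite big_ord_recr /= -IH addrC -Tn_lin; congr (Tn _ _ _ _ _ _).
by apply/funext => l'; rewrite big_ord_recr /= addrC.
Qed.

(** The power sums that occur have exponent at most [k.+1] and drift at most of order [n ^ k]; the
    normalisation [n ^ (k + 2)] leaves [n ^ (-2)]. *)
Lemma qdiag_drift : exists2 B : R, 0 <= B & forall n l, is_partition n.+1 l ->
  `|Tn R z z' n.+1 (qdiag n.+1) l - qdiag n.+1 l| <= B * (n.+1%:R ^+ 2)^-1.
Proof.
have /choice[C HC] j : exists C, 0 <= C /\ forall n l, is_partition n.+1 l ->
    `|updown R (paramA R z z') (paramB R z z') n.+1 (csum R (fun c => c ^+ j)) l - csum R (fun c => c ^+ j) l| * n.+1%:R <=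
    C * n.+1%:R ^+ j.
  have [C C0 H] := updown_drift R (paramA R z z') (paramB R z z') (paramB_ge0 R z z' Hzz) j.
  by exists C.
exists (\sum_(j < k.+2) `|a j| * C j); first by apply: sumr_ge0 => j _; rewrite mulr_ge0 ?(HC j).1.
move=> n l pl; pose N : R := n.+1%:R; have N0 : 0 < N by rewrite ltr0n.
have N1 : 1 <= N by rewrite ler1n.
rewrite (Tn_ext _ _ (fun l => \sum_(j < k.+2) ((N ^+ k.+2)^-1 * a j) * csum R (fun c => c ^+ j) l)) //; last first.
  by move=> l' pl'; rewrite qdiagE // mulr_sumr; apply: eq_bigr => j _; rewrite mulrA.
rewrite (Tn_sum _ _ (fun j => (N ^+ k.+2)^-1 * a j) (fun j => csum R (fun c => c ^+ j))) qdiagE // mulr_sumr -sumrB.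
apply: (le_trans (ler_norm_sum _ _ _)); rewrite mulr_suml; apply: ler_sum => j _.
rewrite -/N mulrA -mulrBr normrM normrM normfV (ger0_norm (exprn_ge0 _ (ltW N0))) Tn_updown //.
have := (HC j).2 n l pl; rewrite -/N; set D := `|_ - _| => hD.
have hNj : N ^+ j <= N ^+ k.+1 by rewrite ler_weXn2l // -ltnS ltn_ord.
have hD' : D * N <= C j * N ^+ k.+1 by apply: (le_trans hD); rewrite ler_wpM2l ?(HC j).1.
have Nk : 0 < N ^+ k.+2 by rewrite exprn_gt0.
rewrite -mulrA mulrCA -mulrA ler_wpM2l // mulrC ler_pdivrMr // -mulrA mulrC mulrAC mulrC.
rewrite -(ler_pM2r N0) (le_trans hD') // le_eqVlt; apply/orP; left; apply/eqP.
by rewrite !exprS; field; rewrite gt_eqF.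
Qed.

(** Only the added and the removed box contribute, each of order [n ^ (k + 1)] before normalisation
    by [n ^ (k + 2)]. *)
Lemma qdiag_jump : exists2 J : R, 0 <= J & forall n l l', is_partition n.+1 l -> nbr n.+1 l l' ->
  (qdiag n.+1 l' - qdiag n.+1 l) ^+ 2 <= J * (n.+1%:R ^+ 2)^-1.
Proof.
pose D := \sum_(j < k.+2) `|a j| * 3 ^+ k.+1.
have D0 : 0 <= D by apply: sumr_ge0 => j _; rewrite mulr_ge0 // exprn_ge0.
exists ((2 * D) ^+ 2); first by rewrite exprn_even_ge0.
move=> n l l' pl nb; have pl' := nbr_partition _ _ _ nb.
pose N : R := n.+1%:R; have N0 : 0 < N by rewrite ltr0n.
have N1 : 1 <= N by rewrite ler1n.
(* The generous range [3 * N] covers the contents of both boxes, the removed one belonging to a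
   diagram with one box more. *)
have bnd c : `|c| <= 3 * N -> `|boxpow R k.+2 c| <= D * N ^+ k.+1.
  move=> hc; rewrite boxpowE (le_trans (ler_norm_sum _ _ _)) // mulr_suml; apply: ler_sum => j _.
  rewrite normrM normrX -mulrA ler_wpM2l // -exprMn.
  apply: (@le_trans _ _ ((3 * N) ^+ j)); first by rewrite lerXn2r ?nnegrE // mulr_ge0 // ltW.
  have jk : (j <= k.+1)%N by rewrite -ltnS.
  by rewrite ler_weXn2l //; lra.
have Nk : 0 < N ^+ k.+2 by rewrite exprn_gt0.
rewrite /qdiag !qmom_iota // -mulrBl.
have [_ [i [j [ai rj El]]]] := nb; have pa := addbox_partition _ _ pl _ ai.
rewrite El (csum_rembox R _ _ _ _ pa rj) (csum_addbox R _ _ _ _ pl ai).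
have -> (s x y : R) : s + x - y - s = x - y by ring.
rewrite -/N exprMn exprVn.
have h1 : `|boxpow R k.+2 (upc R l i)| <= D * N ^+ k.+1.
  apply: bnd; rewrite /upc ler_norml.
  have := rw_partition_le _ _ i pl; rewrite -(ler_nat R) -/N => r1.
  have := addable_le _ _ _ pl ai; move/leq_trans/(_ (size_partition _ _ pl)); rewrite -(ler_nat R) -/N => r2.
  have r3 : 0 <= i%:R :> R by []. have r4 : 0 <= (rw l i)%:R :> R by [].
  by apply/andP; split; lra.
have h2 : `|boxpow R k.+2 (downc R (addbox l i) j)| <= D * N ^+ k.+1.
  apply: bnd; rewrite /downc ler_norml.
  have := rw_partition_le _ _ j pa; rewrite -(ler_nat R) -[n.+2%:R]natr1 -/N => r1.
  have := removable_lt _ _ rj; move/leq_trans/(_ (size_partition _ _ pa)); rewrite ltnS -(ler_nat R) -/N => r2.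
  have r3 : 0 <= j%:R :> R by []. have r4 : 0 <= (rw (addbox l i) j)%:R :> R by [].
  by apply/andP; split; lra.
have h3 : (boxpow R k.+2 (upc R l i) - boxpow R k.+2 (downc R (addbox l i) j)) ^+ 2 <= (2 * D * N ^+ k.+1) ^+ 2.
  rewrite -[leLHS]ger0_norm ?exprn_even_ge0 // normrX; rewrite lerXn2r ?nnegrE //.
    by rewrite !mulr_ge0 // exprn_ge0 // ltW.
  by rewrite (le_trans (ler_normB _ _)) // -mulrA; lra.
rewrite ler_pdivrMr ?exprn_gt0 // (le_trans h3) // le_eqVlt; apply/orP; left; apply/eqP.
by rewrite exprMn !exprS; field; rewrite gt_eqF.
Qed.

Lemma chain_moment : exists C2 C3 C4 : R, [/\ 0 <= C2, 0 <= C3, 0 <= C4 & forall n (b : R) l K e, `|b| <= 2 ->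
  is_partition n.+1 l -> e = (n.+1%:R ^+ 2)^-1 ->
  iter K (Tn R z z' n.+1) (fun l => (qdiag n.+1 l - b) ^+ 4) l <=
    (qdiag n.+1 l - b) ^+ 4 + C2 * (e * K%:R) * (qdiag n.+1 l - b) ^+ 2 + (C4 * (e * K%:R) ^+ 2 + C3 * e * (e * K%:R))].
Proof.
have [B B0 HB] := qdiag_drift; have [J J0 HJ] := qdiag_jump.
exists (16 * B + 8 * J), (3 * J ^+ 2), ((16 * B + 8 * J) * (8 * B + J)); split.
- by rewrite addr_ge0 ?mulr_ge0.
- by rewrite mulr_ge0 // exprn_ge0.
- by rewrite mulr_ge0 ?addr_ge0 ?mulr_ge0.
move=> n b l K e b2 pl eE.
have e0 : 0 <= e by rewrite eE invr_ge0 exprn_ge0.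
apply: (@fourth_moment_iter R (seq nat) (is_partition n.+1) (nbr n.+1) (Tn R z z' n.+1) _ _ _ _
  (fun l => qdiag n.+1 l - b) B J e B0 J0 e0) => //.
- by move=> x y _; exact: nbr_partition.
- by move=> x px; exact: Tn_1.
- by move=> c g h x; exact: Tn_lin.
- by move=> g h x px gh; exact: Tn_mono.
- move=> x px; rewrite (le_trans (ler_normB _ _)) // (_ : 4 = 2 + 2) ?lerD // ?qmom_norm_le //.
  by rewrite -natrD.
- move=> x px; rewrite (_ : Tn R z z' n.+1 (fun l => qdiag n.+1 l - b) x = Tn R z z' n.+1 (qdiag n.+1) x - b).
    by rewrite opprB addrA subrK eE; exact: HB.
  rewrite (_ : (fun l => qdiag n.+1 l - b) = fun l => - b * 1 + qdiag n.+1 l).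
    by rewrite Tn_lin Tn_1 // mulr1 addrC.
  by apply/funext => y; rewrite mulr1 addrC.
by move=> x y px nxy; rewrite opprB addrA subrK eE; exact: HJ.
Qed.

End ChainMoments.

(** * Density of Young diagrams *)

Section Density.
Local Open Scope nat_scope.

Lemma sqrt_bracket m : exists d, d * d <= m < d.+1 * d.+1.
Proof.
elim: m => [|m [d /andP[h1 h2]]]; first by exists 0.
have [h|h] := ltnP m.+1 (d.+1 * d.+1); first by exists d; rewrite h (leq_trans h1).
by exists d.+1; rewrite h /=; nia.
Qed.

Section Thick.
(* The diagram with square [d * d], arms [A], legs [B] and [r] extra boxes in the first row. *)
Variables (I d r : nat) (A B : nat -> nat).
Hypotheses (Id : I <= d) (d0 : 0 < d).
Hypothesis (A_anti : forall i, A i.+1 <= A i) (B_anti : forall i, B i.+1 <= B i).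
Hypothesis (A0 : forall i, I <= i -> A i = 0) (B0 : forall i, I <= i -> B i = 0).

(** Below the square the legs [B] are columns, so row [i] there counts the legs that reach beyond
    depth [i - d]. *)
Definition thick_row i :=
  if i < d then d + A i + (if i == 0 then r else 0) else count (fun j => i - d < B j) (iota 0 I).

Let B_le i j : i <= j -> B j <= B i.
Proof. by move=> /subnK <-; elim: (j - i) => // m IH; rewrite addSn (leq_trans (B_anti _)). Qed.

Let legP i k : (k < count (fun j => i < B j) (iota 0 I)) = (i < B k).
Proof.
rewrite count_initial; last by move=> j h; exact: leq_trans h (B_anti j).
by case: ltnP => //= Ik; rewrite (B0 k Ik).
Qed.

Definition thick_size := d + B 0.

Lemma thick_antitone i : thick_row i.+1 <= thick_row i.
Proof.
rewrite /thick_row; case: (ltnP i.+1 d) => h.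
  by rewrite (ltnW h) /= addn0; have := A_anti i; lia.
case: (ltnP i d) => h'.
  have : count (fun j => i.+1 - d < B j) (iota 0 I) <= I.
    by rewrite -[leqRHS](size_iota 0) count_size.
  by lia.
by apply: sub_count => j /=; lia.
Qed.

Lemma thick_row0 : thick_row thick_size = 0.
Proof.
rewrite /thick_row /thick_size ltnNge leq_addr /= addKn; apply/eqP; rewrite -leqn0 leqNgt legP.
by rewrite ltnn.
Qed.

Definition thick := shape_of thick_row thick_size.

Lemma rw_thick i : rw thick i = thick_row i.
Proof. exact: rw_shape_of thick_antitone thick_row0. Qed.

Lemma sum_count (N : nat) : B 0 <= N -> \sum_(k < N) count (fun j => k < B j) (iota 0 I) = \sum_(j < I) B j.
Proof.
move=> BN; transitivity (\sum_(k < N) \sum_(j < I) (k < B j : nat)).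
  have -> : iota 0 I = index_iota 0 I by rewrite /index_iota subn0.
  by apply: eq_bigr => k _; rewrite -sum1_count big_mkcond big_mkord.
rewrite exchange_big; apply: eq_bigr => j _ /=.
have BjN : B j <= N by apply: leq_trans BN; exact: B_le.
rewrite -(big_mkord xpredT (fun k => (k < B j : nat))) (big_cat_nat _ (n := B j)) //=.
rewrite [X in _ + X]big_nat_cond [X in _ + X]big1 ?addn0 => [|k /andP[/andP[h _] _]]; last by rewrite ltnNge h.
rewrite big_nat_cond (eq_bigr (fun=> 1)) => [|k /andP[/andP[_ ->]]] //.
by rewrite -big_nat_cond sum_nat_const_nat subn0 muln1.
Qed.

Lemma thick_partition n : n = d * d + r + \sum_(j < I) (A j + B j) -> is_partition n thick.
Proof.
move=> ->; have := shape_of_partition _ _ thick_antitone thick_row0.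
suff -> : \sum_(i < thick_size) thick_row i = d * d + r + \sum_(j < I) (A j + B j) by [].
rewrite /thick_size big_split_ord /= big_split /=.
have -> : \sum_(i < d) thick_row (lshift (B 0) i) = d * d + \sum_(j < I) A j + r.
  rewrite (eq_bigr (fun i : 'I_d => d + A i + (if (i : nat) == 0 then r else 0))) => [|i _]; last first.
    by rewrite /thick_row /= ltn_ord.
  rewrite !big_split /= sum_nat_const card_ord; congr (_ + _ + _).
    rewrite (big_ord_widen d A Id) [RHS]big_mkcond; apply: eq_bigr => i _.
    by case: ltnP => // /A0.
  by case: d d0 => // d' _; rewrite big_ord_recl big1 ?addn0.
have -> : \sum_(i < B 0) thick_row (rshift d i) = \sum_(j < I) B j.
  rewrite -(sum_count (B 0)) //; apply: eq_bigr => k _.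
  by rewrite /thick_row /= ltnNge leq_addr /= addKn.
by move: (\sum_(j < I) A j) (\sum_(j < I) B j) => x y; lia.
Qed.

Variable n : nat.
Hypothesis nE : n = d * d + r + \sum_(j < I) (A j + B j).
Let pt := thick_partition n nE.

Lemma frob_thick : frob_d thick = d.
Proof.
have H i : (i < frob_d thick) = (i < d).
  rewrite (frob_dP _ _ _ pt) rw_thick /thick_row; case: (ltnP i d) => h; first by lia.
  apply/negP => h1.
  have : count (fun j => i - d < B j) (iota 0 I) <= I by rewrite -[leqRHS](size_iota 0) count_size.
  by lia.
by have := H d; have := H (frob_d thick); rewrite !ltnn; lia.
Qed.

Lemma conjp_thick k : k < d -> conjp thick k = d + B k.
Proof.
move=> kd; have H i : (i < conjp thick k) = (i < d + B k).
  rewrite (conjpP _ _ _ _ pt) rw_thick /thick_row; case: (ltnP i d) => h; first by lia.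
  by rewrite legP; lia.
by have := H (d + B k); have := H (conjp thick k); rewrite !ltnn; lia.
Qed.

End Thick.
End Density.

Section DensityOfDiagrams.
Variable R : realType.

Lemma truncn_dist (x : R) : 0 <= x -> x - 1 <= (Num.truncn x)%:R <= x.
Proof.
by move=> x0; have /andP[h1 h2] := truncn_itv x0; move: h2; rewrite -natr1 => h2; apply/andP; split; lra.
Qed.

(** The left side is the error in a coordinate before division by [n]: the side of the square, up to
    twice that for the boxes left over in the first row, and [D] for rounding and index shifts. *)
Lemma small_square (eps : R) (D : nat) : 0 < eps -> exists n1, forall n d, (n1 <= n)%N -> (d * d <= n)%N ->
  3 * d%:R + D%:R <= eps * n%:R.
Proof.
move=> e0; pose h := eps / 6; have h0 : 0 < h by rewrite divr_gt0.
exists (maxn (Num.truncn (h ^+ 2)^-1).+1 (Num.truncn (D%:R / (eps / 2))).+1) => n d.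
rewrite geq_max => /andP[n1 n2] dn.
have hn : (h ^+ 2)^-1 <= n%:R by rewrite (le_trans (ltW (truncnS_gt _))) // ler_nat.
have Dn : D%:R <= eps / 2 * n%:R.
  by rewrite mulrC -ler_pdivrMr ?divr_gt0 // (le_trans (ltW (truncnS_gt _))) // ler_nat.
have dh : d%:R <= h * n%:R.
  rewrite -(@ler_pXn2r _ 2) ?nnegrE //; last by rewrite mulr_ge0 // ltW.
  rewrite exprMn; apply: (@le_trans _ _ n%:R); first by rewrite expr2 -natrM ler_nat.
  have h1 : 1 <= h ^+ 2 * n%:R by rewrite [h ^+ 2 * _]mulrC -ler_pdivrMr ?exprn_gt0 // div1r.
  by rewrite [n%:R ^+ 2]expr2 mulrA ler_peMl.
by move: dh; rewrite /h; lra.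
Qed.

Lemma large_root (c : R) (D : nat) : 0 < c -> exists n1, forall n d, (n1 <= n)%N -> c * n%:R < d.+1%:R * d.+1%:R -> (D <= d)%N.
Proof.
move=> c0; exists (Num.truncn (D%:R * D%:R / c)).+1 => n d n1 h; rewrite leqNgt; apply/negP => dD.
have : D%:R * D%:R <= c * n%:R.
  by rewrite [c * _]mulrC -ler_pdivrMr // (le_trans (ltW (truncnS_gt _))) // ler_nat.
have : d.+1%:R * d.+1%:R <= D%:R * D%:R :> R by rewrite ler_pM // ler_nat.
by lra.
Qed.

(** The arms and legs are the rounded multiples of the coordinates. The missing mass fills a square
    whose side is of order [sqrt n]: long enough to carry all arms and legs, yet negligible after
    division by [n]. *)
Lemma finite_support_limit (w : Omega R) I (U : set (Omega R)) N :
  (forall i, (I <= i)%N -> alpha R w i = 0 /\ beta R w i = 0) ->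
  \sum_(i < I) (alpha R w i + beta R w i) < 1 -> nbhs w U ->
  exists n l, [/\ (N <= n)%N, is_partition n l & U (iota_n R n l)].
Proof.
move=> w0 sig1 nU; set sig := \sum_(i < I) _ in sig1.
have a0 := alpha_ge0 R w; have b0 := beta_ge0 R w.
pose A n i := Num.truncn (n%:R * alpha R w i); pose B n i := Num.truncn (n%:R * beta R w i).
have AE n i := truncn_dist _ (mulr_ge0 (ler0n R n) (a0 i)).
have BE n i := truncn_dist _ (mulr_ge0 (ler0n R n) (b0 i)).
have A_anti n i : (A n i.+1 <= A n i)%N by rewrite le_truncn // ler_wpM2l // alpha_noninc.
have B_anti n i : (B n i.+1 <= B n i)%N by rewrite le_truncn // ler_wpM2l // beta_noninc.
have A00 n i : (I <= i)%N -> A n i = 0%N by move=> /w0[h _]; rewrite /A h mulr0 truncn0.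
have B00 n i : (I <= i)%N -> B n i = 0%N by move=> /w0[_ h]; rewrite /B h mulr0 truncn0.
pose s n := (\sum_(j < I) (A n j + B n j))%N.
have s_le n : (s n)%:R <= n%:R * sig.
  rewrite natr_sum mulr_sumr; apply: ler_sum => j _; rewrite natrD mulrDr.
  by have /andP[_ h1] := AE n j; have /andP[_ h2] := BE n j; exact: lerD.
have s_n n : (s n <= n)%N.
  by rewrite -(ler_nat R) (le_trans (s_le n)) // ler_piMr // ltW.
have /choice[sq Hsq] := sqrt_bracket.
(* The largest square that fits into the remaining boxes; the rest, at most [2 * d n], goes to the
   first row. A total coordinate mass below one makes [d n] grow. *)
pose d n := sq (n - s n)%N; pose r n := ((n - s n) - d n * d n)%N.
have nE n : n = (d n * d n + r n + \sum_(j < I) (A n j + B n j))%N.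
  by rewrite -/(s n); have := Hsq (n - s n)%N; rewrite -/(d n) /r; have := s_n n; lia.
have dn n : (d n * d n <= n)%N by have := Hsq (n - s n)%N; rewrite -/(d n); lia.
have rd n : (r n <= 2 * d n)%N by have := Hsq (n - s n)%N; rewrite -/(d n) /r; nia.
have d_big n : (1 - sig) * n%:R < (d n).+1%:R * (d n).+1%:R.
  have /andP[_ h] := Hsq (n - s n)%N; move: h; rewrite -/(d n) -(ltr_nat R) natrM natrB //.
  by have := s_le n; lra.
have sig0 : 0 < 1 - sig by rewrite subr_gt0.
have [nI HnI] := large_root (1 - sig) (maxn I 1) sig0.
pose l n := thick I (d n) (r n) (A n) (B n).
have pl n : (nI <= n)%N -> is_partition n (l n).
  move=> h; have := HnI n (d n) h (d_big n); rewrite geq_max => /andP[h1 h2].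
  exact: (thick_partition I (d n) (r n) (A n) (B n) h1 h2 (A_anti n) (B_anti n) (A00 n) (B00 n) n (nE n)).
have coord n i : (nI <= n)%N -> (0 < n)%N -> (i < d n)%N ->
   alpha R (iota_n R n (l n)) i = ((d n)%:R + (A n i)%:R + (if i == 0%N then r n else 0%N)%:R - i%:R - 2^-1) / n%:R /\
   beta R (iota_n R n (l n)) i = ((d n)%:R + (B n i)%:R - i%:R - 2^-1) / n%:R.
  move=> h n0 id; have := HnI n (d n) h (d_big n); rewrite geq_max => /andP[h1 h2].
  have fr : frob_d (l n) = d n by exact: (frob_thick I (d n) (r n) (A n) (B n) h1 h2 (A_anti n) (B_anti n) (A00 n) (B00 n) n (nE n)).
  have cj : conjp (l n) i = (d n + B n i)%N by exact: (conjp_thick I (d n) (r n) (A n) (B n) h1 h2 (A_anti n) (B_anti n) (A00 n) (B00 n) n (nE n) i id).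
  have rE : rw (l n) i = (d n + A n i + (if i == 0%N then r n else 0%N))%N.
    rewrite /l (rw_thick I (d n) (r n) (A n) (B n) h1 h2 (A_anti n) (B_anti n) (B00 n)).
    by rewrite /thick_row id.
  have pn := pl n h; case: n n0 h id h1 h2 fr cj rE pn => // n _ h id h1 h2 fr cj rE pn.
  have [-> ->] := iota_nE R n _ pn; rewrite /= fr id rE cj !natrD.
  by split.
have lim : iota_n R n (l n) @[n --> \oo] --> w.
  have err (i : nat) (eps : R) : 0 < eps -> exists n1, forall n, (n1 <= n)%N ->
      `|alpha R w i - alpha R (iota_n R n (l n)) i| < eps /\ `|beta R w i - beta R (iota_n R n (l n)) i| < eps.
    move=> e0; have e2 : 0 < eps / 2 by rewrite divr_gt0.
    have [n1 H1] := small_square (eps / 2) i.+2 e2.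
    have [n2 H2] := large_root (1 - sig) i.+1 sig0.
    exists (maxn (maxn n1 n2) (maxn nI 1)) => n; rewrite !geq_max => /andP[/andP[nn1 nn2] /andP[nnI n0]].
    have id := H2 n (d n) nn2 (d_big n).
    have [-> ->] := coord n i nnI n0 id.
    have hs := H1 n (d n) nn1 (dn n).
    have n0' : 0 < n%:R :> R by rewrite ltr0n.
    have /andP[a1 a2] := AE n i; have /andP[b1 b2] := BE n i.
    have hr : (r n)%:R <= 2 * (d n)%:R :> R by rewrite -natrM ler_nat.
    have hd : 0 <= (d n)%:R :> R by [].
    have hr0 : 0 <= (r n)%:R :> R by [].
    have hi : 0 <= i%:R :> R by [].
    move: hs; rewrite -[i.+2%:R]natr1 -[i.+1%:R]natr1 => hs.
    have key (x a : R) : `|x - n%:R * a| <= eps / 2 * n%:R -> `|a - x / n%:R| < eps.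
      move=> hx; have -> : a - x / n%:R = - ((x - n%:R * a) / n%:R) by field; rewrite gt_eqF.
      rewrite normrN normrM normfV (gtr0_norm n0') ltr_pdivrMr //.
      by apply: (le_lt_trans hx); rewrite ltr_pM2r //; lra.
    rewrite -/(A n i) in a1 a2; rewrite -/(B n i) in b1 b2.
    by split; apply: key; rewrite ler_norml; [case: (i == 0%N)|]; apply/andP; split; lra.
  apply: Omega_cvg => i; apply/cvgrPdist_lt => eps e0; have [n1 H] := err i eps e0.
    by exists n1 => // n /= /H[].
  by exists n1 => // n /= /H[].
have [n0 _ Hn0] := lim U nU.
exists (maxn N (maxn nI n0)), (l (maxn N (maxn nI n0))); split; first exact: leq_maxl.
  by apply: pl; rewrite leq_max leq_maxl orbT.
by apply: Hn0; rewrite /= !leq_max leqnn !orbT.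
Qed.

(** Besides making the support finite, the contraction factor keeps the total mass strictly below
    one, as needed to fit a growing square. *)
Definition truncation (w : Omega R) I : thomaX R :=
  (fun i => if (i < I)%N then (1 - I.+2%:R^-1) * alpha R w i else 0,
   fun i => if (i < I)%N then (1 - I.+2%:R^-1) * beta R w i else 0).

Lemma truncation_factor I : 0 <= (1 - I.+2%:R^-1 : R) < 1.
Proof.
have h0 : 0 < I.+2%:R^-1 :> R by rewrite invr_gt0.
have h1 : I.+2%:R^-1 <= 1 :> R by rewrite invf_le1 // ler1n.
by rewrite subr_ge0 h1 ltrBlDr ltrDl.
Qed.

Lemma truncation_sum w I N : \sum_(i < N) ((truncation w I).1 i + (truncation w I).2 i) <= 1 - I.+2%:R^-1.
Proof.
have /andP[c0 _] := truncation_factor I.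
apply: (@le_trans _ _ ((1 - I.+2%:R^-1) * \sum_(i < N) (alpha R w i + beta R w i))).
  rewrite mulr_sumr; apply: ler_sum => i _ /=; case: ifP => _; first by rewrite mulrDr.
  by rewrite addr0 mulr_ge0 // addr_ge0 ?alpha_ge0 ?beta_ge0.
by rewrite ler_piMr // alpha_beta_sum.
Qed.

Lemma truncation_thoma w I : thoma_set R (truncation w I).
Proof.
have /andP[c0 c1] := truncation_factor I.
split=> [i|]; first by rewrite /=; case: ifP => // _; rewrite mulr_ge0 // alpha_ge0.
split=> [i|]; first by rewrite /=; case: ifP => // _; rewrite mulr_ge0 // beta_ge0.
split=> [i|].
  rewrite /=; case: ifP => [h|_]; first by rewrite (ltnW h) ler_wpM2l // alpha_noninc.
  by case: ifP => // _; rewrite mulr_ge0 // alpha_ge0.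
split=> [i|N]; last exact: le_trans (truncation_sum w I N) (ltW c1).
rewrite /=; case: ifP => [h|_]; first by rewrite (ltnW h) ler_wpM2l // beta_noninc.
by case: ifP => // _; rewrite mulr_ge0 // beta_ge0.
Qed.

Definition truncate (w : Omega R) I : Omega R := @exist _ _ (truncation w I) (mem_set (truncation_thoma w I)).

Lemma truncate_cvg w : truncate w I @[I --> \oo] --> w.
Proof.
have fac (a : R) i : (if (i < I)%N then (1 - I.+2%:R^-1) * a else 0) @[I --> \oo] --> a.
  have h : (1 - I.+2%:R^-1 : R) * a @[I --> \oo] --> (1 - 0) * a.
    apply: cvgM; last exact: cvg_cst.
    apply: cvgB; first exact: cvg_cst.
    have h := @cvg_harmonic R; rewrite -cvg_shiftS in h; exact: h.
  rewrite subr0 mul1r in h; apply: cvg_trans h; apply: near_eq_cvg.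
  by exists i.+1 => // I /= ->.
by apply: Omega_cvg => i; exact: fac.
Qed.

Lemma iota_dense (w : Omega R) (U : set (Omega R)) (N : nat) : nbhs w U ->
  exists n l, [/\ (N <= n)%N, is_partition n l & U (iota_n R n l)].
Proof.
rewrite nbhsE => -[V [oV Vw] VU].
have [I0 _ HI] := truncate_cvg w V (open_nbhs_nbhs (conj oV Vw)).
have Vt := HI I0 (leqnn I0).
have [|||n [l [h1 h2 h3]]] := finite_support_limit (truncate w I0) I0 V N.
- by move=> i Ii; rewrite /alpha /beta /= ltnNge Ii.
- by apply: (le_lt_trans (truncation_sum w I0 I0)); have /andP[] := truncation_factor I0.
- by apply: open_nbhs_nbhs; split.
by exists n, l; split=> //; exact: VU.
Qed.

End DensityOfDiagrams.

(** At a diagram near [w] the chain estimate starts from a small value of [q_k - q_k(w)], so in the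
    limit only its term quadratic in time is left. *)
Lemma semigroup_moment_bound (R : realType) (z z' : complex.complex R)
  (Hzz : principal_or_complementary R z z') (T : R -> (Omega R -> R) -> (Omega R -> R))
  (HTcont : forall (t : R) (f : Omega R -> R), 0 <= t -> continuous f -> continuous (T t f))
  (HTlim : forall (t : R) (f : Omega R -> R), 0 <= t -> continuous f ->
     (fun n : nat => \big[Num.max/0]_(l <- Yd n)
        `| iter (Num.truncn ((n%:R) ^+ 2 * t)) (Tn R z z' n) (pi_n R n f) l
           - pi_n R n (T t f) l |) @ \oo --> 0) k :
  exists C : R, forall (w : Omega R) (t : R), 0 <= t <= 1 ->
    T t (fun v => (qmom R k v - qmom R k w) ^+ 4) w <= C * t ^+ 2.
Proof.
have [C2 [C3 [C4 [C20 C30 C40 HC]]]] := chain_moment R z z' Hzz k.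
exists C4 => w t /andP[t0 t1].
pose b := qmom R k w; pose f (v : Omega R) := (qmom R k v - b) ^+ 4.
have cq := qmom_continuous R k.
have cf : continuous f.
  apply: continuous_exp_fun; apply: continuous_add_fun => //; exact: continuous_cst_fun.
have cT := HTcont t f t0 cf.
(* The error budget: [C2] and [C3] for the mixed terms of the chain estimate, and one unit each for
   the initial fourth power, the chain approximation, and the continuity of [T t f] at [w]. *)
pose D := C2 + C3 + 3.
have D0 : 0 < D by rewrite ltr_wpDl // addr_ge0.
apply/ler_addgt0Pr => eps eps0.
pose d := Num.min 1 (eps / D).
have d0 : 0 < d by rewrite lt_min ltr01 divr_gt0.
have d1 : d <= 1 by rewrite ge_min lexx.
have dD : D * d <= eps.
  by rewrite mulrC -ler_pdivlMr // ge_min lexx orbT.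
have /cvgrPdist_lt/(_ _ d0)[n0 _ Hn0] := HTlim t f t0 cf.
have /cvgrPdist_lt/(_ _ d0) nq := cq w.
have /cvgrPdist_lt/(_ _ d0) nT := cT w.
have [n [l [nN pl]]] := iota_dense R w _ (maxn n0 (Num.truncn d^-1).+1) (filterI nq nT).
move: nN; rewrite geq_max => /andP[nn0 nd].
case: n nn0 nd pl => [|n] nn0 nd pl; first by [].
move=> [hq hT]; move: hq hT; rewrite -/(qdiag R k n.+1 l) => hq hT.
(* Rounding the number of steps down gives [e * K%:R <= t]. *)
pose N : R := n.+1%:R; pose e := (N ^+ 2)^-1; pose K := Num.truncn (N ^+ 2 * t).
have N0 : 0 < N by rewrite ltr0n.
have N20 : 0 < N ^+ 2 by rewrite exprn_gt0.
have e0 : 0 <= e by rewrite invr_ge0 ltW.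
have ed : e <= d.
  have h1 : d^-1 <= N by rewrite (le_trans (ltW (truncnS_gt _))) // ler_nat.
  have h2 : N <= N ^+ 2 by rewrite expr2 ler_peMl ?(ltW N0) // ler1n.
  by rewrite /e -[leRHS]invrK lef_pV2 ?posrE ?invr_gt0 // (le_trans h1).
have eK : e * K%:R <= t.
  rewrite /e mulrC ler_pdivrMr // mulrC truncn_le.
  by rewrite mulr_ge0 // ltW.
have eK0 : 0 <= e * K%:R by rewrite mulr_ge0.
have b2 : `|b| <= 2 by exact: qmom_norm_le.
have := HC n b l K e b2 pl erefl.
set u := qdiag R k n.+1 l - b; set I := iter _ _ _ _ => hI.
have hlim : `|I - T t f (iota_n R n.+1 l)| < d.
  have lY : l \in Yd n.+1 by rewrite mem_Yd.
  have := Hn0 n.+1 nn0; rewrite /= sub0r normrN; set M := \big[_/_]_(_ <- _) _ => hM.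
  have IM : `|I - T t f (iota_n R n.+1 l)| <= M.
    exact: (@le_bigmax_seq _ R _ (Yd n.+1) 0 l xpredT (fun l => `|iter K (Tn R z z' n.+1) (pi_n R n.+1 f) l - pi_n R n.+1 (T t f) l|) lY isT).
  by apply: (le_lt_trans IM); apply: le_lt_trans hM; exact: ler_norm.
have hu : `|u| <= d by rewrite /u distrC ltW.
have hu2 : u ^+ 2 <= d.
  rewrite -[leLHS]ger0_norm ?exprn_even_ge0 // normrX expr2 -[leRHS]mulr1.
  by apply: ler_pM => //; exact: le_trans hu d1.
have hu0 : 0 <= u ^+ 2 by rewrite exprn_even_ge0.
have hu4 : u ^+ 4 <= d.
  have -> : u ^+ 4 = u ^+ 2 * u ^+ 2 by rewrite -exprD.
  by rewrite -[leRHS]mulr1; apply: ler_pM => //; exact: le_trans hu2 d1.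
have h2 : C2 * (e * K%:R) * u ^+ 2 <= C2 * d.
  rewrite -mulrA ler_wpM2l //; apply: (@le_trans _ _ (1 * u ^+ 2)); last by rewrite mul1r.
  by rewrite ler_wpM2r // (le_trans eK).
have h3 : C3 * e * (e * K%:R) <= C3 * d.
  rewrite -mulrA ler_wpM2l //; apply: (@le_trans _ _ (d * 1)); last by rewrite mulr1.
  by rewrite ler_pM // (le_trans eK).
have h4 : C4 * (e * K%:R) ^+ 2 <= C4 * t ^+ 2.
  by rewrite ler_wpM2l // lerXn2r // nnegrE.
move: hlim hT; rewrite !ltr_norml => /andP[l1 l2] /andP[l3 l4].
rewrite -/b -/f; move: dD; rewrite /D !mulrDl => dD.
by lra.
Qed.

(** * The Daniell extension *)

Lemma nneseries_pairing : exists e : nat -> nat * nat, forall (R : realType) (a : nat -> nat -> \bar R),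
  (forall i j, (0 <= a i j)%E) ->
  (\sum_(k <oo) a (e k).1 (e k).2 = \sum_(i <oo) \sum_(j <oo) a i j)%E.
Proof.
have /card_esym/ppcard_eqP[f] := card_nat2.
exists f => R a a0.
have -> : (\sum_(k <oo) a (f k).1 (f k).2 = \esum_(i in [set: nat * nat]) uncurry a i)%E.
  rewrite nneseries_esumT; last by move=> k; exact: a0.
  rewrite (reindex_esum [set: nat] [set: nat * nat] f) //.
  by apply: eq_esum => k _; case: (f k).
rewrite nneseries_esumT; last by move=> i; apply: nneseries_ge0.
rewrite (_ : [set: nat * nat] = [set: nat] `*`` (fun=> [set: nat])).
  rewrite (eq_esum (b := fun k => a k.1 k.2)); last by case.
  rewrite -(esum_esum (a := fun i j => a i j)) //.
  by apply: eq_esum => i _; rewrite nneseries_esumT.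
by apply/seteqP; split.
Qed.

Section Daniell.
Variables (R : realType) (T : pointedType) (E : set (T -> R)) (L : (T -> R) -> R).
Hypothesis Ecst : forall c, E (fun=> c).
Hypothesis Eadd : forall f g, E f -> E g -> E (fun x => f x + g x).
Hypothesis Emul : forall f g, E f -> E g -> E (fun x => f x * g x).
Hypothesis Emin : forall f g, E f -> E g -> E (fun x => Num.min (f x) (g x)).
Hypothesis Emax : forall f g, E f -> E g -> E (fun x => Num.max (f x) (g x)).
Hypothesis Ebnd : forall f, E f -> exists M : R, forall x, `|f x| <= M.
Hypothesis L1 : L (fun=> 1) = 1.
Hypothesis Ladd : forall f g, E f -> E g -> L (fun x => f x + g x) = L f + L g.
Hypothesis Lscale : forall c f, E f -> L (fun x => c * f x) = c * L f.
Hypothesis Lpos : forall f, E f -> (forall x, 0 <= f x) -> 0 <= L f.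
(* Daniell's continuity axiom, in the countably subadditive form given by compactness. *)
Hypothesis Lcover : forall (f : nat -> T -> R) g, (forall i, E (f i)) -> E g ->
  (forall i x, 0 <= f i x) ->
  (forall x, ((g x)%:E <= \sum_(i <oo) (f i x)%:E)%E) -> ((L g)%:E <= \sum_(i <oo) (L (f i))%:E)%E.

Let Eopp f : E f -> E (fun x => - f x).
Proof. by move=> Ef; under eq_fun do rewrite -mulN1r; apply: Emul. Qed.

Let Esub f g : E f -> E g -> E (fun x => f x - g x).
Proof. by move=> Ef Eg; apply: Eadd => //; exact: Eopp. Qed.

Let Escale c f : E f -> E (fun x => c * f x).
Proof. by move=> Ef; apply: Emul. Qed.

Let Lopp f : E f -> L (fun x => - f x) = - L f.
Proof. by move=> Ef; under eq_fun do rewrite -mulN1r; rewrite Lscale // mulN1r. Qed.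

Let Lsub f g : E f -> E g -> L (fun x => f x - g x) = L f - L g.
Proof. by move=> Ef Eg; rewrite Ladd ?Lopp //; exact: Eopp. Qed.

Let Lmono f g : E f -> E g -> (forall x, f x <= g x) -> L f <= L g.
Proof.
move=> Ef Eg fg; rewrite -subr_ge0 -Lsub //; apply: Lpos; first exact: Esub.
by move=> x; rewrite subr_ge0.
Qed.

Let L0 : L (fun=> 0) = 0.
Proof.
by have := Lscale 0 _ (Ecst 1); rewrite !mul0r.
Qed.

Definition covering (A : set T) (f : nat -> T -> R) :=
  [/\ forall i, E (f i), forall i x, 0 <= f i x &
      forall x, A x -> (1 <= \sum_(i <oo) (f i x)%:E)%E].

(** Sets are covered by countable sums of nonnegative test functions rather than by sets, since only
    the functional [L] is given. *)
Definition daniell_outer (A : set T) : \bar R :=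
  ereal_inf [set (\sum_(i <oo) (L (f i))%:E)%E | f in covering A].

Local Open Scope ereal_scope.

Let cover_ge0 A f : covering A f -> 0 <= \sum_(i <oo) (L (f i))%:E.
Proof.
by move=> [Ef f0 _]; apply: nneseries_ge0 => i _ _; rewrite lee_fin Lpos.
Qed.

Lemma daniell_outer0 : daniell_outer set0 = 0.
Proof.
apply/eqP; rewrite eq_le; apply/andP; split.
  apply: ereal_inf_lbound; exists (fun _ _ => 0%R); first by split.
  by rewrite eseries0 // => i _ _; rewrite L0.
by apply: le_ereal_inf_tmp => _ [f cf <-]; exact: cover_ge0 cf.
Qed.

Lemma daniell_outer_ge0 A : 0 <= daniell_outer A.
Proof. by apply: le_ereal_inf_tmp => _ [f cf <-]; exact: cover_ge0 cf. Qed.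

Lemma le_daniell_outer : {homo daniell_outer : A B / A `<=` B >-> A <= B}.
Proof.
move=> A B AB; apply: ereal_inf_le_tmp => _ [f [Ef f0 cf] <-]; exists f => //.
by split => // x /AB; exact: cf.
Qed.

Lemma daniell_outer_le A f : covering A f -> daniell_outer A <= \sum_(i <oo) (L (f i))%:E.
Proof. by move=> cf; apply: ereal_inf_lbound; exists f. Qed.

Lemma daniell_outer_le2 A (g : nat -> nat -> T -> R) :
  (forall i j, E (g i j)) -> (forall i j x, (0 <= g i j x)%R) ->
  (forall x, A x -> 1 <= \sum_(i <oo) \sum_(j <oo) (g i j x)%:E) ->
  daniell_outer A <= \sum_(i <oo) \sum_(j <oo) (L (g i j))%:E.
Proof.
move=> Eg g0 cg; have [e eP] := nneseries_pairing.
rewrite -(eP R (fun i j => (L (g i j))%:E)); last by move=> i j; rewrite lee_fin Lpos.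
apply: (daniell_outer_le _ (fun k => g (e k).1 (e k).2)); split => // x Ax.
rewrite (eP R (fun i j => (g i j x)%:E)); first exact: cg.
by move=> i j; rewrite lee_fin.
Qed.

Lemma nneseries_single (c : R) : (0 <= c)%R -> \sum_(i <oo) (if i == 0%N then c else 0%R)%:E = c%:E.
Proof.
move=> c0; rewrite (@nneseriesD1 R _ 0%N xpredT) //.
  by rewrite eseries0 ?adde0 // => -[|k].
by move=> k _; rewrite lee_fin; case: ifP.
Qed.

Lemma daniell_outer_le1 A f : E f -> (forall x, (0 <= f x)%R) -> (forall x, A x -> (1 <= f x)%R) ->
  daniell_outer A <= (L f)%:E.
Proof.
move=> Ef f0 Af.
have /daniell_outer_le : covering A (fun i => if i == 0%N then f else fun=> 0%R).
  split => [[|i] //|[|i] //|x /Af fx]; first exact: Ecst.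
  rewrite (eq_eseriesr (g := fun i => (if i == 0%N then f x else 0%R)%:E)); last by case.
  by rewrite nneseries_single.
move/le_trans; apply.
rewrite (eq_eseriesr (g := fun i => (if i == 0%N then L f else 0%R)%:E)).
  by rewrite nneseries_single ?Lpos.
by case=> [|i] //= _; rewrite L0.
Qed.

Lemma daniell_outer_fin A : daniell_outer A \is a fin_num.
Proof.
rewrite ge0_fin_numE ?daniell_outer_ge0 //.
by apply: le_lt_trans (daniell_outer_le1 A (fun=> 1%R) _ _ _) _; rewrite // L1 ltry.
Qed.

Lemma daniell_outer_setT : daniell_outer setT = 1.
Proof.
apply/eqP; rewrite eq_le; apply/andP; split.
  by rewrite -L1; apply: daniell_outer_le1.
apply: le_ereal_inf_tmp => _ [f [Ef f0 cf] <-]; rewrite -L1.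
by apply: Lcover => // x; exact: cf.
Qed.

Lemma daniell_outer_adherent A (e : R) : (0 < e)%R ->
  exists2 f, covering A f & \sum_(i <oo) (L (f i))%:E <= daniell_outer A + e%:E.
Proof.
move=> e0; have [_ [f cf <-] /ltW h] := lb_ereal_inf_adherent e0 (daniell_outer_fin A).
by exists f.
Qed.

Lemma daniell_outer_sigma_subadditive : sigma_subadditive daniell_outer.
Proof.
move=> A; apply/lee_addgt0Pr => e e0.
have e2 n : (0 < e / (2 ^ n.+1)%:R)%R by rewrite divr_gt0 // ltr0n expn_gt0.
have /choice[G GP] n : exists f, covering (A n) f /\
    \sum_(i <oo) (L (f i))%:E <= daniell_outer (A n) + (e / (2 ^ n.+1)%:R)%:E.
  by have [f] := daniell_outer_adherent (A n) _ (e2 n); exists f.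
apply: le_trans (epsilon_trick _ _ _); last first.
- exact: ltW.
- by move=> n; exact: daniell_outer_ge0.
apply: (@le_trans _ _ (\sum_(i <oo) \sum_(j <oo) (L (G i j))%:E)).
  apply: daniell_outer_le2 => [i j|i j x|x [n _ Anx]].
  - by have [[]] := GP i.
  - by have [[]] := GP i.
  - have [[_ G0 cG] _] := GP n; apply: (le_trans (cG _ Anx)).
    have G0' i : 0 <= \sum_(j <oo) (G i j x)%:E.
      by apply: nneseries_ge0 => j _ _; rewrite lee_fin; have [[]] := GP i.
    rewrite (@nneseriesD1 R _ n xpredT (fun k _ => G0' k) isT).
    by rewrite leeDl // nneseries_ge0.
apply: lee_nneseries => n _; last by have [] := GP n.
by move=> _; apply: nneseries_ge0 => j _ _; rewrite lee_fin Lpos; have [[]] := GP n.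
Qed.

Lemma nneseries_fin_approx (a : nat -> R) C (e : R) : (forall i, 0 <= a i)%R ->
  (forall N, \sum_(0 <= i < N) a i <= C)%R -> (0 < e)%R ->
  exists N, \sum_(i <oo) (a i)%:E <= (\sum_(0 <= i < N) a i + e)%:E.
Proof.
move=> a0 aC e0; apply/not_notP => nN.
have cv : cvgn (fun N => \sum_(0 <= i < N) (a i)%:E) by apply: is_cvg_nneseries => i _ _; rewrite lee_fin.
have lim_le D : (forall N, \sum_(0 <= i < N) a i <= D)%R -> \sum_(i <oo) (a i)%:E <= D%:E.
  by move=> aD; apply: (lime_le cv); apply: nearW => N; rewrite sumEFin lee_fin.
have fin : \sum_(i <oo) (a i)%:E \is a fin_num.
  rewrite ge0_fin_numE; last by apply: nneseries_ge0 => i _ _; rewrite lee_fin.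
  by apply: le_lt_trans (lim_le _ aC) _; rewrite ltry.
have := lim_le (fine (\sum_(i <oo) (a i)%:E) - e)%R.
rewrite EFinB fineK // leNgt => /(_ _)/negP; apply; last first.
  by rewrite lteBlDr // lteDl // lte_fin.
move=> N; rewrite lerBrDr -lee_fin fineK // leNgt; apply/negP => /ltW h.
by apply: nN; exists N.
Qed.

(** Increases with [k] to the indicator of the set where [f] is positive, reaching it at each point
    after finitely many steps. *)
Let plateau (f : T -> R) k x : R := Num.min 1%R (k%:R * Num.max 0 (f x))%R.

Let Eplateau f k : E f -> E (plateau f k).
Proof. by move=> Ef; apply: Emin => //; apply: Escale; exact: Emax. Qed.

Let plateau_mono f k l x : (k <= l)%N -> (plateau f k x <= plateau f l x)%R.
Proof.
move=> kl; rewrite /plateau le_min ge_min lexx /= ge_min ler_wpM2r ?orbT ?ler_nat //.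
by rewrite le_max lexx.
Qed.

Let plateau_ge0 f k x : (0 <= plateau f k x)%R.
Proof. by rewrite /plateau le_min ler01 mulr_ge0 // le_max lexx. Qed.

Let plateau_le1 f k x : (plateau f k x <= 1)%R.
Proof. by rewrite /plateau ge_min lexx. Qed.

(** A nearly optimal cover of [X] is multiplied by the plateaus and by their complements; this
    yields covers of the two parts of [X] whose total cost exceeds that of the original by at most
    [e]. *)
Lemma cozero_caratheodory f (mu : {outer_measure set T -> \bar R}) : E f ->
  (mu : set T -> \bar R) = daniell_outer -> caratheodory_measurable mu [set x | (0 < f x)%R].
Proof.
move=> Ef muE; apply: le_caratheodory_measurable => X; rewrite muE.
apply/lee_addgt0Pr => e e0; have h0 : (0 < e / 2)%R by rewrite divr_gt0.
have [phi [Ep p0 cp] phiX] := daniell_outer_adherent X _ h0.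
(* The increments are nonnegative and sum over [k] to [phi i] restricted to the positivity set, so
   together they cover the inner part. *)
pose step i k x := (phi i x * (plateau f k.+1 x - plateau f k x))%R.
have Estep i k : E (step i k) by apply: Emul => //; apply: Esub; exact: Eplateau.
have step0 i k x : (0 <= step i k x)%R by rewrite mulr_ge0 // subr_ge0 plateau_mono.
have plateau0 x : plateau f 0 x = 0%R by rewrite /plateau mul0r /Num.min ltr10.
have sum_step i N x : (\sum_(0 <= k < N) step i k x = phi i x * plateau f N x)%R.
  elim: N => [|N IH]; first by rewrite big_geq // plateau0 mulr0.
  by rewrite big_nat_recr //= IH -mulrDr addrC subrK.
have sum_Lstep i N : (\sum_(0 <= k < N) L (step i k) = L (fun x => phi i x * plateau f N x))%R.
  elim: N => [|N IH].
    rewrite big_geq // (_ : (fun _ => _) = fun=> 0%R) ?L0 //.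
    by apply/funext => x; rewrite plateau0 mulr0.
  rewrite big_nat_recr //= IH -Ladd //; last by apply: Emul => //; exact: Eplateau.
  by congr L; apply/funext => x; rewrite /step mulrBr addrC subrK.
(* A level is fixed for each [i] at which the truncated cost is within a summable error of the full
   one; the outer cover uses the same level, so that the two costs add up to [L (phi i)] plus this
   error. *)
have /choice[m mP] i : exists N, \sum_(k <oo) (L (step i k))%:E <=
    (L (fun x => phi i x * plateau f N x) + e / 2 / (2 ^ i.+1)%:R)%R%:E.
  have [|||N] := nneseries_fin_approx (fun k => L (step i k)) (L (phi i)) (e / 2 / (2 ^ i.+1)%:R).
  - by move=> k; apply: Lpos.
  - move=> N; rewrite sum_Lstep; apply: Lmono => //; first by apply: Emul => //; exact: Eplateau.
    by move=> x; rewrite ler_piMr.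
  - by rewrite divr_gt0 // ltr0n expn_gt0.
  by rewrite sum_Lstep; exists N.
have inA : daniell_outer (X `&` [set x | (0 < f x)%R]) <=
    \sum_(i <oo) \sum_(k <oo) (L (step i k))%:E.
  apply: daniell_outer_le2 => // x [Xx /= fx].
  apply: (le_trans (cp _ Xx)); apply: lee_nneseries => [i _ _|i _]; first by rewrite lee_fin.
  have [k kf] : exists k : nat, (1 <= k%:R * f x)%R.
    exists (Num.truncn (f x)^-1).+1; rewrite -ler_pdivrMr // div1r ltW //.
    by rewrite truncnS_gt.
  apply: le_trans (nneseries_lim_ge k _); last by move=> j _ _; rewrite lee_fin.
  have plateau1 : plateau f k x = 1%R by rewrite /plateau (max_r (ltW fx)) (min_l kf).
  by rewrite sumEFin lee_fin sum_step plateau1 mulr1.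
(* Every plateau vanishes off the positivity set, so its complement leaves [phi i] unchanged
   there. *)
have outA : daniell_outer (X `&` ~` [set x | (0 < f x)%R]) <=
    \sum_(i <oo) (L (fun x => phi i x * (1 - plateau f (m i) x)))%:E.
  apply: daniell_outer_le; split=> [i|i x|x [Xx /negP]].
  - by apply: Emul => //; apply: Esub => //; exact: Eplateau.
  - by rewrite mulr_ge0 // subr_ge0.
  rewrite -leNgt => fx; apply: (le_trans (cp _ Xx)); apply: lee_nneseries => [i _ _|i _].
    by rewrite lee_fin.
  by rewrite lee_fin /plateau max_l // mulr0 min_r ?ler01 // subr0 mulr1.
apply: (le_trans (leeD inA outA)); rewrite -nneseriesD; last 2 first.
- by move=> i _ _; apply: nneseries_ge0 => j _ _; rewrite lee_fin Lpos.
- move=> i _ _; rewrite lee_fin Lpos //; last by move=> x; rewrite mulr_ge0 // subr_ge0.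
  by apply: Emul => //; apply: Esub => //; exact: Eplateau.
rewrite [in leRHS](splitr e) EFinD addeA; apply: (le_trans _ (leeD2r _ phiX)).
apply: le_trans (epsilon_trick _ _ (ltW h0)); last by move=> i; rewrite lee_fin Lpos.
apply: lee_nneseries => [i _ _|i _].
  rewrite adde_ge0 //; first by apply: nneseries_ge0 => j _ _; rewrite lee_fin Lpos.
  rewrite lee_fin Lpos //; last by move=> x; rewrite mulr_ge0 // subr_ge0.
  by apply: Emul => //; apply: Esub => //; exact: Eplateau.
apply: (le_trans (leeD2r _ (mP i))); rewrite -!EFinD lee_fin addrAC lerD2r -Ladd; last 2 first.
- by apply: Emul => //; exact: Eplateau.
- by apply: Emul => //; apply: Esub => //; exact: Eplateau.
apply/Lmono => // [|x]; last by rewrite -mulrDr addrC subrK mulr1.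
by apply: Eadd; apply: Emul => //; [|apply: Esub => //]; exact: Eplateau.
Qed.

Definition cozero_sets : set (set T) := [set [set x | (0 < f x)%R] | f in E].

Let clamp (x : R) : R := Num.max 0%R (Num.min 1%R x).

Lemma measurable_cozero_type (f : g_sigma_algebraType cozero_sets -> R) : E f -> measurable_fun setT f.
Proof.
move=> Ef; apply: (measurability _ (RGenOInfty.measurableE R)) => //.
move=> _ [_ [c ->] <-]; rewrite setTI; apply: sub_sigma_algebra.
exists (fun x => f x - c)%R; first by apply: Esub.
by apply/seteqP; split => x /=; rewrite in_itv /= andbT subr_gt0.
Qed.

Lemma min_sum_indic (x : R) N : (0 <= x)%R ->
  (Num.min x N.+1%:R <= 1 + \sum_(0 <= j < N) (\1_[set y | (j.+1%:R < y)] x : R))%R.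
Proof.
move=> x0; elim: N => [|N IH]; first by rewrite big_geq // addr0 ge_min lexx orbT.
rewrite big_nat_recr //= indicE; case: (ltP N.+1%:R x) => h.
  rewrite mem_set //= addrA; apply: (@le_trans _ _ (N.+1%:R + 1)%R).
    by rewrite ge_min natr1 lexx orbT.
  by rewrite lerD2r; move: IH; rewrite (min_r (ltW h)).
rewrite memNset /=; last by apply/negP; rewrite -leNgt.
by rewrite addr0; move: IH; rewrite !min_l // (le_trans h) // ler_nat.
Qed.

Lemma min_sum_clamp (x : R) N : (0 <= x)%R ->
  (\sum_(0 <= j < N) clamp (x - j%:R) = Num.min x N%:R)%R.
Proof.
move=> x0; elim: N => [|N IH]; first by rewrite big_geq // min_r.
rewrite big_nat_recr //= IH /clamp -natr1 /Num.min /Num.max.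
by repeat case: ifP; lra.
Qed.

(** An upper bound for integrals of nonnegative test functions suffices: applied to [M + f] and
    [M - f], it gives both inequalities. *)
Theorem daniell_probability :
  exists P : probability (g_sigma_algebraType cozero_sets) R,
    forall f, E f -> \int[P]_x (f x)%:E = (L f)%:E.
Proof.
pose Th := g_sigma_algebraType cozero_sets.
pose mu : {outer_measure set Th -> \bar R} := HB.pack daniell_outer
  (isOuterMeasure.Build R T daniell_outer daniell_outer0 daniell_outer_ge0
    le_daniell_outer daniell_outer_sigma_subadditive).
have sub A : measurable (A : set Th) -> @measurable _ (caratheodory_type mu) A.
  apply: smallest_sub; first exact: sigma_algebra_measurable.
  by move=> _ [f Ef <-]; exact: cozero_caratheodory.
have sadd : semi_sigma_additive (daniell_outer : set Th -> _).
  move=> F mF tF mUF; apply: (@caratheodory_measure_sigma_additive _ _ mu) => //.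
  - by move=> i; apply: sub; exact: mF.
  - exact: sub.
pose m : {measure set Th -> \bar R} := HB.pack (daniell_outer : set Th -> \bar R)
  (isMeasure.Build _ Th R daniell_outer daniell_outer0 daniell_outer_ge0 sadd).
pose P : probability Th R := HB.pack (Measure.sort m)
  (Measure_isProbability.Build _ Th R m daniell_outer_setT).

exists P.
have upper f : E f -> (forall x, 0 <= f x)%R -> \int[P]_x (f x)%:E <= (L f)%:E.
  move=> Ef f0; apply/lee_addgt0Pr => e e0.
  (* [f] is cut into layers of height [1 / k <= e], and [N] layers exhaust it. *)
  have [M fM] := Ebnd _ Ef; pose k := (Num.truncn e^-1).+1; pose N := (Num.truncn (k%:R * M)).+1.
  have k0 : (0 < k%:R :> R)%R by rewrite ltr0n.
  have ke : (k%:R^-1 <= e)%R.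
    by rewrite -[leRHS]invrK lef_pV2 ?posrE ?invr_gt0 //; rewrite ltW // truncnS_gt.
  have kfN x : (k%:R * f x <= N%:R)%R.
    apply: le_trans (ltW (truncnS_gt _)); rewrite ler_wpM2l //.
    exact: le_trans (ler_norm _) (fM x).
  pose A j := [set x : Th | (j.+1%:R < k%:R * f x)%R].
  have mA j : measurable (A j).
    apply: sub_sigma_algebra; exists (fun x => k%:R * f x - j.+1%:R)%R.
      by apply: Esub => //; exact: Escale.
    by apply/seteqP; split=> x /=; rewrite subr_gt0.
  pose c j x := clamp (k%:R * f x - j%:R).
  have Ec j : E (c j) by apply: Emax => //; apply: Emin => //; apply: Esub => //; exact: Escale.
  have c0 j x : (0 <= c j x)%R by rewrite /c /clamp le_max lexx.
  (* The clamp of layer [j] equals one as soon as [k * f] exceeds [j + 1], so it covers [A j]; the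
     clamps sum to [k * f] exactly. Shifting by one layer accounts for the extra [1] in the bound
     for [k * f]. *)
  have PA j : P (A j) <= (L (c j))%:E.
    apply: daniell_outer_le1 => // x; rewrite /A /= /c /clamp -natr1 => h.
    by rewrite le_max le_min lexx /=; apply/orP; right; lra.
  have Lc : (\sum_(0 <= j < N) L (c j) = k%:R * L f)%R.
    have Esum n : E (fun x => \sum_(0 <= j < n) c j x)%R /\
        (L (fun x => \sum_(0 <= j < n) c j x) = \sum_(0 <= j < n) L (c j))%R.
      elim: n => [|n [IH1 IH2]].
        rewrite big_geq // (_ : (fun _ => _) = fun=> 0%R) //.
        by apply/funext => x; rewrite big_geq.
      rewrite big_nat_recr //= -IH2 -Ladd // (_ : (fun _ => _) = (fun x => \sum_(0 <= j < n) c j x + c n x)%R).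
        by split=> //; exact: Eadd.
      by apply/funext => x; rewrite big_nat_recr.
    rewrite -(Esum N).2 -Lscale //; congr L; apply/funext => x.
    by rewrite /c min_sum_clamp ?min_l // mulr_ge0.
  have fle x : (f x)%:E <= (k%:R^-1)%:E * (1 + \sum_(j <- iota 0 N) (\1_(A j) x)%:E).
    rewrite sumEFin -EFinD -EFinM lee_fin mulrC ler_pdivlMr // mulrC.
    have := min_sum_indic (k%:R * f x) N; rewrite mulr_ge0 // => /(_ isT).
    rewrite min_l; last by rewrite (le_trans (kfN x)) // ler_nat.
    by rewrite /index_iota subn0; move/le_trans; apply; rewrite lerD2l; apply: ler_sum => j _; rewrite !indicE; exact: lexx.
  have mind j : measurable_fun setT (fun x : Th => (\1_(A j) x)%:E : \bar R).
    by apply/measurable_EFinP; exact: measurable_indic.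
  have msum : measurable_fun setT (fun x : Th => \sum_(j <- iota 0 N) (\1_(A j) x)%:E : \bar R).
    exact: emeasurable_sum.
  have sum_ge0 x : 0 <= \sum_(j <- iota 0 N) (\1_(A j) x)%:E :> \bar R.
    by apply: sume_ge0 => j _; rewrite lee_fin.
  apply: (@le_trans _ _ (\int[P]_x ((k%:R^-1)%:E * (1 + \sum_(j <- iota 0 N) (\1_(A j) x)%:E)))).
    apply: ge0_le_integral => //.
    - by move=> x _; rewrite lee_fin.
    - by apply/measurable_EFinP; exact: measurable_cozero_type.
    - by apply: emeasurable_funM => //; exact: emeasurable_funD.
  have kinv0 : (0 <= k%:R^-1 :> R)%R by rewrite invr_ge0.
  have one_sum0 (x : Th) : [set: Th] x -> 0 <= 1 + \sum_(j <- iota 0 N) (\1_(A j) x : R)%:E.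
    by move=> _; apply: adde_ge0 (sum_ge0 x); exact: lee01.
  have mone_sum : measurable_fun setT (fun x : Th => 1 + \sum_(j <- iota 0 N) (\1_(A j) x : R)%:E).
    exact: emeasurable_funD.
  rewrite ge0_integralZl_EFin //.
  have I1 : \int[P]_(x in setT) 1 = 1 by rewrite integral_cst // mul1e; exact: daniell_outer_setT.
  rewrite ge0_integralD // I1 ge0_integral_sum //.
  rewrite (eq_bigr (fun j => P (A j))); last by move=> j _; rewrite integral_indic // setIT.
  apply: (@le_trans _ _ ((k%:R^-1)%:E * (1 + \sum_(j <- iota 0 N) (L (c j))%:E))).
    rewrite lee_wpmul2l ?lee_fin ?invr_ge0 // leeD2l //.
    exact: lee_sum.
  rewrite sumEFin -EFinD -EFinM -EFinD lee_fin.
  move: Lc; rewrite /index_iota subn0 => ->.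
  by rewrite mulrDr mulr1 mulKf ?gt_eqF // addrC lerD2l.
move=> f Ef; have [M fM] := Ebnd _ Ef.
have mf : measurable_fun setT (fun x : Th => (f x)%:E).
  by apply/measurable_EFinP; exact: measurable_cozero_type.
have intf : P.-integrable setT (fun x : Th => (f x)%:E).
  apply: (@le_integrable _ _ _ P _ _ _ (fun=> M%:E)) => //.
  - by move=> x _; rewrite /= lee_fin (le_trans (fM x)) // ler_norm.
  - exact: finite_measure_integrable_cst.
have M0 x : (0 <= M + f x /\ 0 <= M - f x)%R.
  by have := fM x; rewrite ler_norml => /andP[]; split; lra.
have intM : P.-integrable setT (fun x : Th => M%:E) by exact: finite_measure_integrable_cst.
have IM : \int[P]_(x in setT) M%:E = M%:E.
  by rewrite integral_cst // -[RHS]mule1; congr (_ * _); exact: daniell_outer_setT.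
have LM : L (fun=> M) = M.
  by rewrite -[RHS]mulr1 -[in RHS]L1 -Lscale //; congr L; apply/funext => x; rewrite mulr1.
have If : \int[P]_x (f x)%:E \is a fin_num by exact: integrable_fin_num.
have : \int[P]_x (M%:E + (f x)%:E) <= (L (fun x => M + f x)%R)%:E.
  exact: upper (Eadd _ _ (Ecst M) Ef) (fun x => (M0 x).1).
rewrite integralD // IM Ladd // LM EFinD leeD2lE // => u1.
have : \int[P]_x (M%:E - (f x)%:E) <= (L (fun x => M - f x)%R)%:E.
  exact: upper (Esub _ _ (Ecst M) Ef) (fun x => (M0 x).2).
rewrite integralB // IM Lsub // LM EFinB leeD2lE // leeN2 => u2.
by apply/eqP; rewrite eq_le u1 u2.
Qed.

End Daniell.

(** * Feller semigroups and laws on path space *)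

(** A one-sided form of Dini's theorem. *)
Lemma compact_eventually_lt (R : realType) (X : topologicalType) (a : nat -> X -> R) (g : X -> R) (e : R) :
  compact [set: X] -> (forall n, continuous (a n)) -> continuous g -> 0 < e ->
  (forall n x, a n x <= a n.+1 x) -> (forall x, exists n, g x < a n x + e) ->
  exists n, forall x, g x < a n x + e.
Proof.
move=> /compact_near_coveringP cX ca cg e0 inc H.
have mono x m n : (m <= n)%N -> a m x <= a n x.
  by move/subnK <-; elim: (n - m)%N => [|k IH] //; rewrite addSn (le_trans IH).
have : \forall n \near \oo, [set: X] `<=` (fun x => g x < a n x + e).
  apply: cX => x _; have [m gm] := H x.
  have op : continuous (fun x => a m x + e - g x).
    apply: continuous_add_fun; last exact: continuous_opp_fun.
    by apply: continuous_add_fun => //; exact: continuous_cst_fun.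
  have d0 : 0 < a m x + e - g x by lra.
  have /cvgrPdist_lt/(_ _ d0) near_x := op x.
  exists ([set y | `|a m x + e - g x - (a m y + e - g y)| < a m x + e - g x], [set n | (m <= n)%N]).
    by split => //; exists m.
  move=> [y n] /= []; rewrite ltr_norml => /andP[_ h] mn.
  by have := mono y _ _ mn; lra.
by move=> [n _ /(_ n (leqnn n)) h]; exists n => x; exact: h.
Qed.

Lemma sup_near_compact (R : realType) (X Y : topologicalType) (h : X * Y -> R) x0 (e : R) :
  compact [set: Y] -> continuous h -> 0 < e ->
  \forall x \near x0, forall y, `|h (x0, y) - h (x, y)| < e.
Proof.
move=> /compact_near_coveringP cY ch e0.
have : \forall x \near x0, [set: Y] `<=` (fun y => `|h (x0, y) - h (x, y)| < e).
  apply: cY => y _.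
  have e2 : 0 < e / 2 by rewrite divr_gt0.
  have /cvgrPdist_lt/(_ _ e2) [[A B] /= [nA nB] sAB] := ch (x0, y).
  exists (B, A); first by split.
  move=> [y' x] /= [By' Ax].
  have Ax0 : A x0 by exact: nbhs_singleton.
  have h1 := sAB (x, y') (conj Ax By').
  have h2 := sAB (x0, y') (conj Ax0 By').
  have := ler_distD (h (x0, y)) (h (x0, y')) (h (x, y')).
  by move: h1 h2 => /= h1 h2; rewrite [`|h (x0, y') - h (x0, y)|]distrC; lra.
by apply: filterS => x hx y; exact: hx.
Qed.

Section FellerProcess.
Variables (R : realType) (W : ptopologicalType).
Hypothesis cW : compact [set: W].
Variable T : R -> (W -> R) -> W -> R.
Hypothesis HTcont : forall (t : R) (f : W -> R), 0 <= t -> continuous f -> continuous (T t f).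
Hypothesis HTlin : forall (t a : R) (f g : W -> R), 0 <= t -> continuous f -> continuous g ->
  T t (fun w => a * f w + g w) = (fun w => a * T t f w + T t g w).
Hypothesis HTpos : forall (t : R) (f : W -> R), 0 <= t -> continuous f -> (forall w, 0 <= f w) ->
  forall w, 0 <= T t f w.
Hypothesis HT1 : forall t : R, 0 <= t -> T t (fun _ => 1) = (fun _ => 1).
Hypothesis HT0 : forall f : W -> R, continuous f -> T 0 f = f.
Hypothesis HTsg : forall (s t : R) (f : W -> R), 0 <= s -> 0 <= t -> continuous f ->
  T (s + t) f = T s (T t f).

Lemma semigroup_add (t : R) (f g : W -> R) : 0 <= t -> continuous f -> continuous g ->
  T t (fun w => f w + g w) = fun w => T t f w + T t g w.
Proof.
move=> t0 cf cg; have := HTlin t 1 f g t0 cf cg.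
rewrite (_ : (fun w => 1 * f w + g w) = fun w => f w + g w); last by apply/funext => w; rewrite mul1r.
by move=> ->; apply/funext => w; rewrite mul1r.
Qed.

Lemma semigroup_scale (t a : R) (f : W -> R) : 0 <= t -> continuous f -> T t (fun w => a * f w) = fun w => a * T t f w.
Proof.
move=> t0 cf; have c0 := continuous_cst_fun R W 0.
have T0 : T t (fun=> 0) = fun=> 0.
  have := semigroup_add t (fun=> 0) (fun=> 0) t0 c0 c0.
  rewrite (_ : (fun w : W => 0 + 0) = fun=> 0); last by apply/funext => w; rewrite addr0.
  move=> h; apply/funext => w; have := congr1 (@^~ w) h => /=.
  by move: (T t _ w) => x; lra.
have := HTlin t a f (fun=> 0) t0 cf c0.
rewrite (_ : (fun w => a * f w + 0) = fun w => a * f w); last by apply/funext => w; rewrite addr0.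
by move=> ->; apply/funext => w; rewrite T0 addr0.
Qed.

Lemma semigroup_cst (t c : R) : 0 <= t -> T t (fun=> c) = fun=> c.
Proof.
move=> t0; have := semigroup_scale t c (fun=> 1) t0 (continuous_cst_fun R W 1).
rewrite HT1 // (_ : (fun w : W => c * 1) = fun=> c) //.
by apply/funext => w; rewrite mulr1.
Qed.

Lemma semigroup_sub (t : R) (f g : W -> R) : 0 <= t -> continuous f -> continuous g ->
  T t (fun w => f w - g w) = fun w => T t f w - T t g w.
Proof.
move=> t0 cf cg; have cN := continuous_opp_fun _ _ g cg.
rewrite (semigroup_add t f (fun w => - g w)) //; apply/funext => w; congr (_ + _).
rewrite (_ : (fun w => - g w) = fun w => -1 * g w); last by apply/funext => v; rewrite mulN1r.
by rewrite semigroup_scale // mulN1r.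
Qed.

Lemma semigroup_mono (t : R) (f g : W -> R) : 0 <= t -> continuous f -> continuous g -> (forall w, f w <= g w) ->
  forall w, T t f w <= T t g w.
Proof.
move=> t0 cf cg fg w; rewrite -subr_ge0.
have := HTpos t (fun w => g w - f w) t0; rewrite semigroup_sub //; apply.
  by apply: continuous_add_fun => //; exact: continuous_opp_fun.
by move=> v; rewrite subr_ge0.
Qed.

Lemma semigroup_dist (t : R) (f g : W -> R) (e : R) : 0 <= t -> continuous f -> continuous g ->
  (forall w, `|f w - g w| <= e) -> forall w, `|T t f w - T t g w| <= e.
Proof.
move=> t0 cf cg fg w; have cc := continuous_cst_fun R W e.
have h1 : forall w, f w <= g w + e by move=> v; have := fg v; rewrite ler_norml => /andP[]; lra.
have h2 : forall w, g w <= f w + e by move=> v; have := fg v; rewrite ler_norml => /andP[]; lra.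
have cge := continuous_add_fun _ _ _ _ cg cc; have cfe := continuous_add_fun _ _ _ _ cf cc.
have := semigroup_mono t _ _ t0 cf cge h1 w; have := semigroup_mono t _ _ t0 cg cfe h2 w.
rewrite !semigroup_add // semigroup_cst // ler_norml => u1 u2.
by apply/andP; split; lra.
Qed.

Definition paths := {ptws R -> W}.

Definition upd (th : paths) (t : R) (w : W) : paths := fun s => if s == t then w else th s.

Lemma eval_continuous t : continuous (fun th : paths => th t).
Proof. exact: (@proj_continuous R (fun=> W) t). Qed.

Lemma paths_cvg (I : Type) (G : set_system I) (h : I -> paths) (l : paths) : Filter G ->
  (forall t, (fun i => h i t) @ G --> l t) -> h @ G --> l.
Proof.
move=> FG ch; apply/cvg_sup => t U [V] [[B oB <-]] Bx sU.
have GB : G ((fun i => h i t) @^-1` B) by apply: ch; apply: open_nbhs_nbhs.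
exact: (@filterS _ G _ _ (h @^-1` U) (fun i => sU (h i)) GB).
Qed.

Lemma paths_continuous (X : topologicalType) (h : X -> paths) :
  (forall t, continuous (fun x => h x t)) -> continuous h.
Proof. by move=> ch x; apply: paths_cvg => t; exact: ch. Qed.

Lemma upd_continuous t : continuous (fun x : paths * W => upd x.1 t x.2).
Proof.
apply: paths_continuous => s; rewrite /upd; case: eqP => _.
  by move=> [th w]; exact: cvg_snd.
by move=> [th w]; apply: (continuous_comp _ (eval_continuous s th)); exact: cvg_fst.
Qed.

Lemma paths_compact : compact [set: paths].
Proof.
have := @tychonoff R (fun=> W) (fun=> setT) (fun=> cW).
by congr (compact _); apply/seteqP; split.
Qed.

Lemma const_continuous : continuous (fun w : W => (fun=> w) : paths).
Proof.
by apply: paths_continuous => t w; exact: cvg_id.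
Qed.

(* Resamples the coordinate at [t] by the transition law started from the coordinate at [a]. *)
Definition step (a t : R) (F : paths -> R) (th : paths) : R :=
  T (t - a) (fun w => F (upd th t w)) (th a).

Lemma upd_r_continuous th t : continuous (upd th t).
Proof.
by apply: paths_continuous => s; rewrite /upd; case: eqP => _ w; [exact: cvg_id | exact: cvg_cst].
Qed.

Lemma comp_upd_continuous (F : paths -> R) th t : continuous F -> continuous (fun w => F (upd th t w)).
Proof. by move=> cF w; apply: (continuous_comp (upd_r_continuous th t w)); exact: cF. Qed.

(** Compactness of [W] makes the dependence on the unsampled coordinates uniform in the sampled one,
    and contractivity passes this through [T]; the Feller property handles the starting
    coordinate. *)
Lemma step_continuous a t (F : paths -> R) : a <= t -> continuous F -> continuous (step a t F).
Proof.
move=> at0 cF th0; apply/cvgrPdist_lt => e e0; have e2 : 0 < e / 2 by rewrite divr_gt0.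
have ta : 0 <= t - a by rewrite subr_ge0.
have c1 : continuous (fun x : paths * W => F (upd x.1 t x.2)).
  by move=> x; apply: (continuous_comp (upd_continuous t x)); exact: cF.
have n1 := sup_near_compact _ _ _ _ th0 _ cW c1 e2.
have c2 : continuous (fun th : paths => T (t - a) (fun w => F (upd th0 t w)) (th a)).
  move=> th; apply: (continuous_comp (eval_continuous a th)).
  by apply: HTcont => //; exact: comp_upd_continuous.
have /cvgrPdist_lt/(_ _ e2) n2 := c2 th0.
apply: filterS2 n1 n2 => th h1 h2.
have := semigroup_dist (t - a) (fun w => F (upd th0 t w)) (fun w => F (upd th t w)) (e / 2) ta.
move=> /(_ (comp_upd_continuous _ _ _ cF) (comp_upd_continuous _ _ _ cF) (fun w => ltW (h1 w)) (th a)).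
have := ler_distD (T (t - a) (fun w => F (upd th0 t w)) (th a)) (step a t F th0) (step a t F th).
by move: h2; rewrite /step /=; lra.
Qed.

Definition indep (t : R) (F : paths -> R) := forall th w, F (upd th t w) = F th.

Lemma step_indep a t F : a <= t -> indep t F -> step a t F = F.
Proof.
move=> at0 iF; apply/funext => th; rewrite /step.
rewrite (_ : (fun w => _) = fun=> F th) ?semigroup_cst ?subr_ge0 //.
by apply/funext => w; exact: iF.
Qed.

Lemma updC th t u v w : t != u -> upd (upd th t v) u w = upd (upd th u w) t v.
Proof.
move=> tu; apply/funext => s; rewrite /upd; case: eqP => // ->.
by rewrite eq_sym (negbTE tu).
Qed.

Lemma indep_step a t u F : u != a -> u != t -> indep u F -> indep u (step a t F).
Proof.
move=> ua ut iF th w; rewrite /step (_ : upd th u w a = th a); last by rewrite /upd eq_sym (negbTE ua).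
congr (T _ _ _).
by apply/funext => v; rewrite updC // iF.
Qed.

(** The Chapman-Kolmogorov relation: an intermediate time that [F] does not read may be skipped. *)
Lemma step_step a t u (F : paths -> R) : a <= t -> t < u -> continuous F -> indep t F ->
  step a t (step t u F) = step a u F.
Proof.
move=> at0 tu cF iF; apply/funext => th; rewrite /step.
have -> : u - a = (t - a) + (u - t) by ring.
rewrite (HTsg (t - a) (u - t)) ?subr_ge0 // ?(ltW tu) //; last exact: comp_upd_continuous.
rewrite (_ : (fun w => T (u - t) _ _) = T (u - t) (fun w => F (upd th u w))) //.
apply/funext => w; rewrite (_ : (fun w0 => _) = fun w0 => F (upd th u w0)).
  by rewrite /upd eqxx.
by apply/funext => v; rewrite updC ?iF // lt_eqF.
Qed.

Fixpoint steps (a : R) (ts : seq R) (F : paths -> R) : paths -> R :=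
  if ts is t :: ts' then step a t (steps t ts' F) else F.

Lemma steps_continuous a ts (F : paths -> R) : path <=%R a ts -> continuous F -> continuous (steps a ts F).
Proof.
elim: ts a => [|t ts IH] a //= /andP[at0 p] cF.
by apply: step_continuous => //; exact: IH.
Qed.

Lemma indep_steps a ts u F : u != a -> u \notin ts -> indep u F -> indep u (steps a ts F).
Proof.
elim: ts a => [|t ts IH] a //= ua; rewrite inE negb_or => /andP[ut uts] iF.
by apply: indep_step => //; exact: IH.
Qed.

Lemma path_ltW (a : R) ts : path <%R a ts -> path <=%R a ts.
Proof. by apply: sub_path => x y; exact: ltW. Qed.

(** Consistency of the finite-dimensional laws. A trailing unread time disappears because constants
    are preserved, an inner one by Chapman-Kolmogorov. *)
Lemma steps_filter a ts (p : pred R) (F : paths -> R) : path <%R a ts -> continuous F ->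
  (forall t, t \in ts -> ~~ p t -> indep t F) -> steps a ts F = steps a [seq t <- ts | p t] F.
Proof.
elim: ts a => [|u us IH] a //= /andP[au pu] cF H.
have {}IH := IH u pu cF (fun t tus => H t (mem_behead (s := u :: us) tus)).
case: ifP => pu' /=; first by rewrite IH.
have iu : indep u F by apply: H; rewrite ?inE ?eqxx ?pu'.
rewrite IH; case E : [seq t <- us | p t] => [|v vs] /=; first by rewrite step_indep // ltW.
have pv : path <%R u (v :: vs).
  by rewrite -E; apply: path_filter => //; exact: lt_trans.
move: pv => /= /andP[uv pvs].
rewrite step_step ?(ltW au) //; first by apply: steps_continuous => //; exact: path_ltW.
apply: indep_steps => //; first by rewrite lt_eqF.
apply/negP => uvs; have := order_path_min lt_trans pvs => /allP/(_ _ uvs) vu.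
by have := lt_trans uv vu; rewrite ltxx.
Qed.

Lemma steps_rcons a ts u F : steps a (rcons ts u) F = steps a ts (step (last a ts) u F).
Proof. by elim: ts a => [|t ts IH] a //=; rewrite IH. Qed.

Lemma step_add a t (F G : paths -> R) : a <= t -> continuous F -> continuous G ->
  step a t (fun th => F th + G th) = fun th => step a t F th + step a t G th.
Proof.
move=> at0 cF cG; apply/funext => th; rewrite /step semigroup_add ?subr_ge0 //; exact: comp_upd_continuous.
Qed.

Lemma step_scale a t c (F : paths -> R) : a <= t -> continuous F ->
  step a t (fun th => c * F th) = fun th => c * step a t F th.
Proof.
move=> at0 cF; apply/funext => th; rewrite /step semigroup_scale ?subr_ge0 //; exact: comp_upd_continuous.
Qed.

Lemma step_ge0 a t (F : paths -> R) : a <= t -> continuous F -> (forall th, 0 <= F th) ->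
  forall th, 0 <= step a t F th.
Proof. by move=> at0 cF F0 th; apply: HTpos; rewrite ?subr_ge0 //; exact: comp_upd_continuous. Qed.

Lemma steps_add a ts (F G : paths -> R) : path <=%R a ts -> continuous F -> continuous G ->
  steps a ts (fun th => F th + G th) = fun th => steps a ts F th + steps a ts G th.
Proof.
elim: ts a => [|t ts IH] a //= /andP[at0 p] cF cG; rewrite IH // step_add //; exact: steps_continuous.
Qed.

Lemma steps_scale a ts c (F : paths -> R) : path <=%R a ts -> continuous F ->
  steps a ts (fun th => c * F th) = fun th => c * steps a ts F th.
Proof.
elim: ts a => [|t ts IH] a //= /andP[at0 p] cF; rewrite IH // step_scale //; exact: steps_continuous.
Qed.

Lemma steps_ge0 a ts (F : paths -> R) : path <=%R a ts -> continuous F -> (forall th, 0 <= F th) ->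
  forall th, 0 <= steps a ts F th.
Proof.
elim: ts a => [|t ts IH] a //= /andP[at0 p] cF F0 th.
by apply: step_ge0 => //; [exact: steps_continuous | exact: IH].
Qed.

Lemma steps_cst a ts c : path <=%R a ts -> steps a ts (fun=> c) = fun=> c.
Proof.
elim: ts a => [|t ts IH] a //= /andP[at0 p]; rewrite IH //.
by apply/funext => th; rewrite /step semigroup_cst ?subr_ge0.
Qed.

Definition supported (ts : seq R) (F : paths -> R) :=
  forall th th' : paths, {in ts, th =1 th'} -> F th = F th'.

Definition is_support ts F := all (fun t : R => 0 <= t) ts /\ supported ts F.

Definition cylinder : set ((R -> W) -> R) :=
  [set F | continuous (F : paths -> R) /\ exists ts, is_support ts F].

(** Time zero is left out because its coordinate is the starting point and is not resampled. *)
Definition grid (ts : seq R) := sort <=%R (undup [seq t <- ts | 0 < t]).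

Lemma mem_grid ts t : (t \in grid ts) = (0 < t) && (t \in ts).
Proof. by rewrite mem_sort mem_undup mem_filter. Qed.

Lemma path_grid ts : path <%R 0 (grid ts).
Proof.
rewrite (path_sortedE lt_trans); apply/andP; split.
  by apply/allP => t; rewrite mem_grid => /andP[].
by rewrite lt_sorted_uniq_le sort_uniq undup_uniq /= sort_le_sorted.
Qed.

Lemma steps_support s ts (F : paths -> R) : continuous F -> supported ts F -> path <%R 0 s ->
  (forall t, t \in ts -> 0 < t -> t \in s) -> steps 0 s F = steps 0 (grid ts) F.
Proof.
move=> cF sF ps sub; rewrite (steps_filter 0 s (mem ts)) //.
  congr (steps 0 _ F); apply: (irr_sorted_eq lt_trans ltxx).
  - by apply: (sorted_filter lt_trans); exact: path_sorted ps.
  - exact: path_sorted (path_grid ts).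
  move=> t; rewrite mem_filter mem_grid; apply/idP/idP => /andP[h1 h2]; apply/andP; split=> //.
    by move: ps; rewrite (path_sortedE lt_trans) => /andP[/allP ps _]; exact: ps.
  exact: sub.
move=> t ts_s nt th w; apply: sF => u uts; rewrite /upd; case: eqP => // ut.
by move: nt; rewrite /= -ut uts.
Qed.

(** An arbitrary choice, harmless by [meanE]; it lets [mean] be a functional of [F] alone, as the
    Daniell construction requires. *)
Definition support (F : paths -> R) : seq R := xget [::] [set ts | is_support ts F].

Lemma cylinder_cst c : cylinder (fun=> c).
Proof. by split; [exact: continuous_cst_fun | exists [::]; split]. Qed.

Lemma cylinder_op (F G : paths -> R) op : cylinder F -> cylinder G ->
  continuous (fun th => op (F th) (G th)) -> cylinder (fun th => op (F th) (G th)).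
Proof.
move=> [_ [ts [ge0 sF]]] [_ [ts' [ge0' sG]]] cop; split=> //; exists (ts ++ ts'); split.
  by rewrite all_cat ge0.
by move=> th th' h; rewrite (sF th th') ?(sG th th') // => t t1; apply: h; rewrite mem_cat t1 ?orbT.
Qed.

(** * Expectations of cylinder functions *)

Section Mean.
Variable mu : probability (g_sigma_algebraType (@open W)) R.

Lemma continuous_measurable (f : W -> R) : continuous f ->
  measurable_fun setT (f : g_sigma_algebraType (@open W) -> R).
Proof.
move=> /continuousP cf; apply: (measurability _ (RGenOInfty.measurableE R)) => //.
move=> _ [_ [c ->] <-]; rewrite setTI; apply: sub_sigma_algebra; apply: cf.
exact: interval_open.
Qed.

Lemma continuous_bounded (X : topologicalType) (f : X -> R) : compact [set: X] -> continuous f ->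
  exists M : R, forall x, `|f x| <= M.
Proof.
move=> cX cf; have [x0|nx] := pselect (exists x : X, True); last first.
  by exists 0 => x; exfalso; apply: nx; exists x.
have ne : [set: X] !=set0 by case: x0 => x _; exists x.
have [c _ cmax] : exists2 c, c \in [set: X] & forall t, t \in [set: X] -> `|f t| <= `|f c|.
  apply: compact_EVT_max => //; apply: continuous_subspaceT => x; apply: cvg_norm; exact: cf.
by exists `|f c| => x; apply: cmax; rewrite inE.
Qed.

Lemma continuous_integrable (f : W -> R) : continuous f ->
  mu.-integrable setT (fun w : g_sigma_algebraType (@open W) => (f w)%:E).
Proof.
move=> cf; have [M fM] := continuous_bounded _ f cW cf.
apply: (@le_integrable _ _ _ mu _ _ _ (fun=> M%:E)) => //.
- by apply/measurable_EFinP; exact: continuous_measurable.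
- by move=> w _; rewrite /= lee_fin (le_trans (fM w)) // ler_norm.
- exact: finite_measure_integrable_cst.
Qed.

(** The constant path only carries the starting point: coordinate zero keeps it, and the coordinates
    in [s] are resampled before [F] is evaluated. *)
Definition mean_along s (F : paths -> R) : R :=
  fine (\int[mu]_w (steps 0 s F (fun=> w))%:E).

Definition mean (F : (R -> W) -> R) : R := mean_along (grid (support F)) F.

Lemma meanE s ts (F : paths -> R) : continuous F -> is_support ts F -> path <%R 0 s ->
  (forall t, t \in ts -> 0 < t -> t \in s) -> mean F = mean_along s F.
Proof.
move=> cF sF ps sub; rewrite /mean /mean_along.
have [_ sF'] : is_support (support F) F by apply: (@xgetPex _ [::] [set ts | is_support ts F]); exists ts.
(* Both supports are compared through a common refinement. *)
pose u := grid (ts ++ support F).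
have pu : path <%R 0 u := path_grid _.
have sub1 t : t \in ts -> 0 < t -> t \in u by move=> t1 t0; rewrite mem_grid t0 mem_cat t1.
have sub2 t : t \in support F -> 0 < t -> t \in u by move=> t1 t0; rewrite mem_grid t0 mem_cat t1 orbT.
rewrite (steps_support s ts F cF sF.2 ps sub) -(steps_support u ts F cF sF.2 pu sub1).
by rewrite -(steps_support u (support F) F cF sF' pu sub2).
Qed.

Lemma steps_const_continuous s F : path <=%R 0 s -> continuous (F : paths -> R) ->
  continuous (fun w => steps 0 s F (fun=> w)).
Proof.
move=> ps cF w; apply: (continuous_comp (const_continuous w)); exact: steps_continuous.
Qed.

Lemma mean_along_add s F G : path <%R 0 s -> continuous (F : paths -> R) -> continuous (G : paths -> R) ->
  mean_along s (fun th => F th + G th) = mean_along s F + mean_along s G.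
Proof.
move=> /path_ltW ps cF cG; rewrite /mean_along steps_add // -fineD; last 2 first.
- by apply: integrable_fin_num => //; apply: continuous_integrable; exact: steps_const_continuous.
- by apply: integrable_fin_num => //; apply: continuous_integrable; exact: steps_const_continuous.
rewrite -integralD //; apply: continuous_integrable; exact: steps_const_continuous.
Qed.

Lemma mean_along_scale s c F : path <%R 0 s -> continuous (F : paths -> R) ->
  mean_along s (fun th => c * F th) = c * mean_along s F.
Proof.
move=> /path_ltW ps cF; rewrite /mean_along steps_scale //.
have iF : mu.-integrable setT (fun w : g_sigma_algebraType (@open W) => (steps 0 s F (fun=> w))%:E).
  by apply: continuous_integrable; exact: steps_const_continuous.
transitivity (fine (c%:E * \int[mu]_w (steps 0 s F (fun=> w))%:E)); first by rewrite -integralZl.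
by rewrite fineM // integrable_fin_num.
Qed.

Lemma mean_along_ge0 s F : path <%R 0 s -> continuous (F : paths -> R) -> (forall th, 0 <= F th) ->
  0 <= mean_along s F.
Proof.
move=> /path_ltW ps cF F0; apply: fine_ge0; apply: integral_ge0 => w _.
by rewrite lee_fin; exact: steps_ge0.
Qed.

Lemma mean_along_cst s c : path <%R 0 s -> mean_along s (fun=> c) = c.
Proof.
move=> /path_ltW ps; rewrite /mean_along steps_cst // integral_cst // -[RHS]/(fine c%:E).
by congr fine; rewrite -[RHS]mule1; congr (_ * _)%E; exact: probability_setT.
Qed.

Lemma common_grid (F G : paths -> R) : cylinder F -> cylinder G ->
  exists s, [/\ path <%R 0 s, mean F = mean_along s F, mean G = mean_along s G &
    forall op : R -> R -> R, continuous (fun th => op (F th) (G th)) ->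
      mean (fun th => op (F th) (G th)) = mean_along s (fun th => op (F th) (G th))].
Proof.
move=> [cF [ts sF]] [cG [ts' sG]]; pose s := grid (ts ++ ts').
have ps : path <%R 0 s := path_grid _.
exists s; split => // [||op cop].
- by apply: (meanE _ ts) => // t t1 t0; rewrite mem_grid t0 mem_cat t1.
- by apply: (meanE _ ts') => // t t1 t0; rewrite mem_grid t0 mem_cat t1 orbT.
have sop : is_support (ts ++ ts') (fun th => op (F th) (G th)).
  split; first by rewrite all_cat sF.1 sG.1.
  move=> th th' h; rewrite (sF.2 th th') ?(sG.2 th th') // => t t1; apply: h; rewrite mem_cat t1 ?orbT //.
by apply: (meanE _ (ts ++ ts')) => // t t1 t0; rewrite mem_grid t0 t1.
Qed.

Lemma cylinder_add F G : cylinder F -> cylinder G -> cylinder (fun th => F th + G th).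
Proof. by move=> EF EG; apply: cylinder_op EF EG (continuous_add_fun _ _ _ _ EF.1 EG.1). Qed.

Lemma cylinder_mul F G : cylinder F -> cylinder G -> cylinder (fun th => F th * G th).
Proof. by move=> EF EG; apply: cylinder_op EF EG (continuous_mul_fun _ _ _ _ EF.1 EG.1). Qed.

Lemma cylinder_min F G : cylinder F -> cylinder G -> cylinder (fun th => Num.min (F th) (G th)).
Proof. by move=> EF EG; apply: cylinder_op EF EG (continuous_min_fun _ _ _ _ EF.1 EG.1). Qed.

Lemma cylinder_max F G : cylinder F -> cylinder G -> cylinder (fun th => Num.max (F th) (G th)).
Proof. by move=> EF EG; apply: cylinder_op EF EG (continuous_max_fun _ _ _ _ EF.1 EG.1). Qed.

Lemma mean_add F G : cylinder F -> cylinder G -> mean (fun th => F th + G th) = mean F + mean G.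
Proof.
move=> EF EG; have [s [ps -> -> /(_ +%R) ->]] := common_grid F G EF EG; last exact: continuous_add_fun EF.1 EG.1.
exact: mean_along_add EF.1 EG.1.
Qed.

Lemma mean_scale c F : cylinder F -> mean (fun th => c * F th) = c * mean F.
Proof.
move=> EF; have [s [ps _ -> /(_ *%R) ->]] := common_grid (fun=> c) F (cylinder_cst c) EF.
  exact: mean_along_scale EF.1.
exact: continuous_mul_fun (continuous_cst_fun _ _ c) EF.1.
Qed.

Lemma mean_cst c : mean (fun=> c) = c.
Proof. by have [s [ps -> _ _]] := common_grid _ _ (cylinder_cst c) (cylinder_cst c); rewrite mean_along_cst. Qed.

Lemma mean_ge0 F : cylinder F -> (forall th, 0 <= F th) -> 0 <= mean F.
Proof. by move=> EF F0; have [s [ps -> _ _]] := common_grid _ _ EF EF; exact: mean_along_ge0 EF.1 F0. Qed.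

Lemma mean_sub F G : cylinder F -> cylinder G -> mean (fun th => F th - G th) = mean F - mean G.
Proof.
move=> EF EG; have EN : cylinder (fun th => -1 * G th) by exact: cylinder_mul (cylinder_cst _) EG.
rewrite (_ : (fun th => F th - G th) = fun th => F th + -1 * G th).
  by rewrite mean_add // mean_scale // mulN1r.
by apply/funext => th; rewrite mulN1r.
Qed.

Lemma mean_mono F G : cylinder F -> cylinder G -> (forall th, F th <= G th) -> mean F <= mean G.
Proof.
move=> EF EG FG; rewrite -subr_ge0 -mean_sub //; apply: mean_ge0 => [|th]; last by rewrite subr_ge0.
by apply: (cylinder_op _ _ (fun x y => x - y) EG EF); exact: continuous_add_fun EG.1 (continuous_opp_fun _ _ _ EF.1).
Qed.

Lemma cylinder_sum (F : nat -> (R -> W) -> R) n : (forall i, cylinder (F i)) ->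
  cylinder (fun th => \sum_(0 <= i < n) F i th) /\
  mean (fun th => \sum_(0 <= i < n) F i th) = \sum_(0 <= i < n) mean (F i).
Proof.
move=> EF; elim: n => [|n [IH1 IH2]].
  rewrite big_geq // (_ : (fun _ => _) = fun=> 0); last by apply/funext => th; rewrite big_geq.
  by split; [exact: cylinder_cst | rewrite mean_cst].
rewrite big_nat_recr //= -IH2 -mean_add //.
rewrite (_ : (fun _ => _) = fun th => \sum_(0 <= i < n) F i th + F n th).
  by split => //; exact: cylinder_add.
by apply/funext => th; rewrite big_nat_recr.
Qed.

Lemma cylinder_bounded F : cylinder F -> exists M : R, forall th, `|F th| <= M.
Proof. by move=> [cF _]; exact: continuous_bounded paths_compact cF. Qed.

(** By compactness of the path space a finite partial sum already dominates [G - e] everywhere, and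
    for finite sums positivity is enough. *)
Lemma mean_cover (F : nat -> (R -> W) -> R) G : (forall i, cylinder (F i)) -> cylinder G ->
  (forall i th, 0 <= F i th) -> (forall th, ((G th)%:E <= \sum_(i <oo) (F i th)%:E)%E) ->
  ((mean G)%:E <= \sum_(i <oo) (mean (F i))%:E)%E.
Proof.
move=> EF EG F0 cov; apply/lee_addgt0Pr => e e0.
have [n nP] : exists n, forall th, G th < \sum_(0 <= i < n) F i th + e.
  apply: (@compact_eventually_lt R paths (fun n th => \sum_(0 <= i < n) F i th)) => //.
  - exact: paths_compact.
  - by move=> n; exact: (cylinder_sum F n EF).1.1.
  - exact: EG.1.
  - by move=> n th; rewrite big_nat_recr //= lerDl.
  move=> th; apply/not_notP => nex.
  have := cov th; rewrite leNgt => /negP; apply.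
  have : (\sum_(i <oo) (F i th)%:E <= (G th - e)%:E)%E.
    apply: lime_le; first by apply: is_cvg_nneseries => i _ _; rewrite lee_fin.
    apply: nearW => n; rewrite sumEFin lee_fin lerBrDr leNgt; apply/negP => h.
    by apply: nex; exists n.
  by move/le_lt_trans; apply; rewrite lte_fin ltrBlDr ltrDl.
have := mean_mono G (fun th => \sum_(0 <= i < n) F i th + e) EG.
move=> /(_ (cylinder_add _ _ (cylinder_sum F n EF).1 (cylinder_cst e)) (fun th => ltW (nP th))).
rewrite mean_add ?mean_cst //; [|exact: (cylinder_sum F n EF).1|exact: cylinder_cst].
rewrite (cylinder_sum F n EF).2 => h.
apply: (@le_trans _ _ (\sum_(0 <= i < n) mean (F i) + e)%:E); first by rewrite lee_fin.
rewrite EFinD leeD2r // -sumEFin; apply: nneseries_lim_ge => i _ _.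
by rewrite lee_fin mean_ge0.
Qed.

Lemma last_grid s ts : 0 <= s -> all (fun t => t <= s) ts -> last 0 (grid (s :: ts)) = s.
Proof.
move=> s0 /allP le_s; have := path_grid (s :: ts); rewrite (path_sortedE lt_trans) => /andP[_ srt].
have mem_last' : last 0 (grid (s :: ts)) \in 0 :: grid (s :: ts) by exact: mem_last.
apply/eqP; rewrite eq_le; apply/andP; split.
  move: mem_last'; rewrite inE => /orP[/eqP -> //|]; rewrite mem_grid inE => /andP[_ /orP[/eqP -> //|]].
  exact: le_s.
have [s1|s1] : s = 0 \/ 0 < s by move: s0; rewrite le_eqVlt eq_sym => /orP[/eqP|]; [left|right].
  by rewrite {1}s1; have := mem_last'; rewrite inE => /orP[/eqP -> //|]; rewrite mem_grid => /andP[/ltW].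
have : s \in grid (s :: ts) by rewrite mem_grid s1 inE eqxx.
move: srt; move: (grid (s :: ts)) => g; rewrite (sorted_pairwise lt_trans).
case/lastP: g => // g x; rewrite pairwise_rcons last_rcons mem_rcons inE => /andP[/allP gx _].
by move=> /orP[/eqP -> //|sg]; exact: ltW (gx _ sg).
Qed.

(** The Markov property of the finite-dimensional laws: [F] reads times up to [s] and the later time
    [t], which is integrated out by one transition. *)
Lemma mean_step F ts s t : continuous (F : paths -> R) -> 0 <= s -> s < t ->
  all (fun u => 0 <= u <= s) ts -> supported (rcons ts t) F ->
  cylinder (step s t F) /\ mean F = mean (step s t F).
Proof.
move=> cF s0 st /allP ts_s sF; have cS := step_continuous s t F (ltW st) cF.
have le_s : all (fun u => u <= s) ts by apply/allP => u /ts_s /andP[].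
have ge0 : all (fun u => 0 <= u) ts by apply/allP => u /ts_s /andP[].
have t0 := le_lt_trans s0 st.
have sS : is_support (s :: ts) (step s t F).
  split; first by rewrite /= s0.
  move=> th th' h; rewrite /step (h s) ?inE ?eqxx //; congr (T _ _ _).
  apply/funext => w; apply: sF => u; rewrite mem_rcons inE /upd.
  by case: eqP => //= _ uts; apply: h; rewrite inE uts orbT.
have EF : is_support (rcons ts t) F by split=> //; rewrite all_rcons ge0 (ltW t0).
split; first by split=> //; exists (s :: ts).
pose g := grid (s :: ts).
have lg : last 0 g = s by exact: last_grid.
have pgt : path <%R 0 (rcons g t) by rewrite rcons_path path_grid /= lg.
rewrite (meanE (rcons g t) (rcons ts t)) //; last first.
  move=> u; rewrite !mem_rcons !inE => /orP[-> //|uts] u0.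
  by rewrite mem_grid u0 inE uts !orbT.
rewrite (meanE g (s :: ts)) //; first by rewrite /mean_along steps_rcons lg.
  exact: path_grid.
by move=> u uts u0; rewrite mem_grid u0.
Qed.

Lemma mean_initial (f : W -> R) : continuous f ->
  cylinder (fun th => f (th 0)) /\ mean (fun th => f (th 0)) = fine (\int[mu]_w (f w)%:E).
Proof.
move=> cf; have cF : continuous (fun th : paths => f (th 0)).
  by move=> th; apply: (continuous_comp (eval_continuous 0 th)); exact: cf.
have sF : is_support [:: 0] (fun th => f (th 0)).
  by split; [rewrite /= lexx | move=> th th' h; rewrite h // inE].
split; first by split=> //; exists [:: 0].
by rewrite (meanE [::] [:: 0]) // => u; rewrite inE => /eqP ->; rewrite ltxx.
Qed.

End Mean.

Definition pathsB := g_sigma_algebraType (cozero_sets R (R -> W) cylinder).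

Lemma path_law (mu : probability (g_sigma_algebraType (@open W)) R) :
  exists P : probability pathsB R, forall F, cylinder F -> (\int[P]_th (F th)%:E = (mean mu F)%:E)%E.
Proof.
apply: daniell_probability.
- exact: cylinder_cst.
- exact: cylinder_add.
- exact: cylinder_mul.
- exact: cylinder_min.
- exact: cylinder_max.
- exact: cylinder_bounded.
- exact: mean_cst.
- exact: mean_add.
- exact: mean_scale.
- exact: mean_ge0.
- exact: mean_cover.
Qed.

Section Dyadic.
Variable K : archiRealFieldType.

Definition dyadic (m : nat) (t : K) : K := (Num.truncn (2 ^+ m * t))%:R / 2 ^+ m.

Lemma truncn_neg (x : K) : x < 0 -> Num.truncn x = 0%N.
Proof. by move=> x0; apply/eqP; rewrite -leqn0 truncn_le_nat; lra. Qed.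

Lemma truncn_double (x : K) : Num.truncn (2 * x) = (Num.truncn x).*2 \/ Num.truncn (2 * x) = (Num.truncn x).*2.+1.
Proof.
have [x0|x0] := ltP x 0; first by left; rewrite !truncn_neg //; lra.
have /andP[h1 h2] := truncn_itv x0.
have x20 : 0 <= 2 * x by rewrite mulr_ge0.
have /andP[h3 h4] := truncn_itv x20.
have h5 : ((Num.truncn x).*2 <= Num.truncn (2 * x))%N.
  by rewrite -ltnS -(ltr_nat K) -muln2 natrM; lra.
have h6 : (Num.truncn (2 * x) < (Num.truncn x).*2.+2)%N.
  by rewrite -(ltr_nat K) -doubleS -muln2 natrM; lra.
by move: h5 h6; lia.
Qed.

Lemma truncn_near (x y : K) : x <= y -> y < x + 1 ->
  Num.truncn y = Num.truncn x \/ Num.truncn y = (Num.truncn x).+1.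
Proof.
move=> xy yx; have le1 := le_truncn xy.
have [y0|y0] := ltP y 0; first by left; move: le1; rewrite (truncn_neg _ y0) leqn0 => /eqP.
have /andP[h1 h2] := truncn_itv y0.
have h3 : x < (Num.truncn x).+1%:R by rewrite truncnS_gt.
have : (Num.truncn y < (Num.truncn x).+2)%N.
  by rewrite -(ltr_nat K) -natr1; lra.
by lia.
Qed.

Lemma truncn_ltn (x : K) N : (0 < N)%N -> x < N%:R -> (Num.truncn x < N)%N.
Proof. by case: N => // N _; rewrite ltnS truncn_le_nat. Qed.

Lemma dyadic_le m t : 0 <= t -> dyadic m t <= t.
Proof.
move=> t0; rewrite /dyadic ler_pdivrMr ?exprn_gt0 // [t * _]mulrC truncn_le.
by rewrite mulr_ge0 // exprn_ge0.
Qed.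

Lemma dyadic_gt m t : 0 <= t -> t - (2 ^+ m)^-1 < dyadic m t.
Proof.
move=> t0; rewrite /dyadic ltrBlDr -[X in _ + X]div1r -mulrDl ltr_pdivlMr ?exprn_gt0 //.
by rewrite mulrC natr1 truncnS_gt.
Qed.

Lemma dyadic_ge0 m t : 0 <= dyadic m t.
Proof. by rewrite divr_ge0 // exprn_ge0. Qed.

Lemma dyadic_mono m s t : s <= t -> dyadic m s <= dyadic m t.
Proof.
by move=> st; rewrite ler_pM2r ?invr_gt0 ?exprn_gt0 // ler_nat le_truncn // ler_pM2l ?exprn_gt0.
Qed.

Lemma dyadic0 m : dyadic m 0 = 0.
Proof. by rewrite /dyadic mulr0 truncn0 mul0r. Qed.

End Dyadic.

(** * Continuity of paths *)

Variable q : nat -> W -> R.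
Hypothesis q_cont : forall k, continuous (q k).
Hypothesis q_sep : forall v w, (forall k, q k v = q k w) -> v = w.
Hypothesis q_moment : forall k, exists C : R, forall w t, 0 <= t <= 1 ->
  T t (fun v => (q k v - q k w) ^+ 4) w <= C * t ^+ 2.

(** Compactness provides a cluster point, and the limits of the separating functions identify it. *)
Lemma seq_cvg (u : nat -> W) : (forall k, cvgn (fun n => q k (u n))) -> cvg (u n @[n --> \oo]).
Proof.
move=> cu; have [w [_ clw]] := cW (u n @[n --> \oo]) _ filterT.
apply/cvg_ex; exists w; apply: (@cvg_of_separating R W nat q) => // k.
have /cvg_ex[l ql] := cu k.
suff -> : q k w = l by exact: ql.
apply/eqP/negPn/negP => ne; pose d := `|q k w - l| / 2.
have d0 : 0 < d by rewrite divr_gt0 // normr_gt0 subr_eq0.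
have /cvgrPdist_lt/(_ _ d0) nw := q_cont k w.
have /cvgrPdist_lt/(_ _ d0) nl := ql.
have [v [/= h1 h2]] := clw [set v | `|l - q k v| < d] _ nl nw.
have := ler_distD (q k v) (q k w) l; rewrite [`|q k v - l|]distrC.
by move: h1 h2; rewrite /d; lra.
Qed.

(* Any rate in ]2^(-1/4), 1[ makes both [rate ^+ m] and the Markov bound
   [2^m * (2^-m)^2 / rate^(4 m)] for the jumps between dyadics of level [m] summable. *)
Notation rate := (9 / 10 : R).

Definition smooth_from (k N m0 : nat) (th : R -> W) := forall m, (m0 <= m)%N ->
  forall j, (j < N * 2 ^ m)%N ->
  `|q k (th (j.+1%:R / 2 ^+ m)) - q k (th (j%:R / 2 ^+ m))| <= rate ^+ m.

Definition Good : set (R -> W) := [set th | forall k N, exists m0, smooth_from k N m0 th].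

Section GoodPath.
Variables (k N m0 : nat) (th : R -> W).
Hypothesis sm : smooth_from k N m0 th.
Hypothesis N0 : (0 < N)%N.

Lemma rate_pow_ge0 m : 0 <= rate ^+ m. Proof. by rewrite exprn_ge0. Qed.

Lemma truncn_scale_lt m (t : R) : t < N%:R -> (Num.truncn (2 ^+ m * t)%R < N * 2 ^ m)%N.
Proof.
move=> tN; apply: truncn_ltn; first by rewrite muln_gt0 N0 expn_gt0.
by rewrite natrM natrX mulrC ltr_pM2r ?exprn_gt0.
Qed.

(** Refining the level either keeps the rounded time or moves it to the next dyadic of the finer
    level. *)
Lemma smooth_refine m t : (m0 <= m)%N -> t < N%:R ->
  `|q k (th (dyadic R m.+1 t)) - q k (th (dyadic R m t))| <= rate ^+ m.+1.
Proof.
move=> m0m tN; rewrite /dyadic.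
have two0 : (2 : R) ^+ m != 0 by rewrite expf_neq0.
have E : (Num.truncn (2 ^+ m * t))%:R / 2 ^+ m = (Num.truncn (2 ^+ m * t)).*2%:R / 2 ^+ m.+1 :> R.
  by rewrite -muln2 natrM exprS; field; rewrite two0.
rewrite E exprS -mulrA; have [->|h] := truncn_double R (2 ^+ m * t).
  by rewrite exprS subrr normr0 mulr_ge0 // rate_pow_ge0.
have := sm m.+1 (leqW m0m) (Num.truncn (2 ^+ m * t)).*2; rewrite h !exprS; apply.
by rewrite expnS mulnCA -muln2 mulnC ltn_pmul2l // truncn_scale_lt.
Qed.

(** The constant [9] is [rate / (1 - rate)], the sum of the geometric series of refinements. *)
Lemma smooth_cauchy m n t : (m0 <= m)%N -> (m <= n)%N -> t < N%:R ->
  `|q k (th (dyadic R n t)) - q k (th (dyadic R m t))| <= 9 * rate ^+ m.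
Proof.
move=> m0m mn tN; have : `|q k (th (dyadic R n t)) - q k (th (dyadic R m t))| <= 9 * rate ^+ m - 9 * rate ^+ n.
  elim: n mn => [|n IH]; first by rewrite leqn0 => /eqP ->; rewrite !subrr normr0.
  rewrite leq_eqVlt => /orP[/eqP <-|]; first by rewrite !subrr normr0.
  rewrite ltnS => mn; have := smooth_refine n t (leq_trans m0m mn) tN.
  have := ler_distD (q k (th (dyadic R n t))) (q k (th (dyadic R n.+1 t))) (q k (th (dyadic R m t))).
  by have := IH mn; rewrite exprS; lra.
by move/le_trans; apply; rewrite lerBlDr lerDl mulr_ge0 // rate_pow_ge0.
Qed.

Lemma smooth_adjacent m s t : (m0 <= m)%N -> s <= t -> t < N%:R -> t < s + (2 ^+ m)^-1 ->
  `|q k (th (dyadic R m t)) - q k (th (dyadic R m s))| <= rate ^+ m.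
Proof.
move=> m0m st tN ts; have p0 : 0 < (2 : R) ^+ m by rewrite exprn_gt0.
have h1 : 2 ^+ m * s <= 2 ^+ m * t by rewrite ler_pM2l.
have h2 : 2 ^+ m * t < 2 ^+ m * s + 1.
  by move: ts; rewrite -(ltr_pM2l p0) mulrDr mulfV ?gt_eqF.
rewrite /dyadic; have [->|E] := truncn_near R _ _ h1 h2; first by rewrite subrr normr0 rate_pow_ge0.
by rewrite E; apply: sm => //; apply: truncn_scale_lt; exact: le_lt_trans tN.
Qed.

End GoodPath.

(** [19 = 9 + 1 + 9]: two passages from a time to its rounding and one step between adjacent
    dyadics. *)
Lemma rate_pow_small (e : R) : 0 < e -> exists m1, forall m, (m1 <= m)%N -> 19 * rate ^+ m < e.
Proof.
move=> e0; have r1 : `|rate| < 1 by rewrite ger0_norm //; lra.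
have /cvgrPdist_lt/(_ _ e0)[m1 _ H] := @cvg_geometric R 19 rate r1; exists m1 => m /H /=.
by rewrite sub0r normrN ger0_norm // mulr_ge0 // rate_pow_ge0.
Qed.

Lemma Good_cvg th t : Good th -> cvg (th (dyadic R m t) @[m --> \oo]).
Proof.
move=> gth; apply: seq_cvg => k.
have [m0 sm] := gth k (Num.truncn t).+1.
have tN : t < (Num.truncn t).+1%:R by rewrite truncnS_gt.
apply/cauchy_cvgP/cauchy_exP => e e0; have [m1 H] := rate_pow_small e e0.
exists (q k (th (dyadic R (maxn m0 m1) t))); exists (maxn m0 m1) => // n /= mn.
rewrite /ball /= distrC.
apply: le_lt_trans (smooth_cauchy _ _ _ _ sm (ltn0Sn _) _ _ _ (leq_maxl _ _) mn tN) _.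
have := H (maxn m0 m1) (leq_maxr _ _); apply: le_lt_trans.
by rewrite ler_wpM2r ?rate_pow_ge0 // ler_nat.
Qed.

(** Off [Good] a constant value is used, so that every path of [X] is continuous. *)
Definition X (t : R) (th : R -> W) : W :=
  if pselect (Good th) then lim (th (dyadic R m t) @[m --> \oo]) else point.

Lemma X_cvg t th : Good th -> th (dyadic R m t) @[m --> \oo] --> X t th.
Proof.
by move=> gth; rewrite /X; case: pselect => // g; exact: Good_cvg.
Qed.

Lemma X_dist k N m0 m t th : Good th -> smooth_from k N m0 th -> (0 < N)%N -> (m0 <= m)%N -> t < N%:R ->
  `|q k (X t th) - q k (th (dyadic R m t))| <= 9 * rate ^+ m.
Proof.
move=> gth sm N0 m0m tN.
have cq : q k (th (dyadic R n t)) @[n --> \oo] --> q k (X t th).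
  by apply: continuous_cvg; [exact: q_cont | exact: X_cvg].
have cq2 : `|q k (th (dyadic R n t)) - q k (th (dyadic R m t))| @[n --> \oo] -->
    `|q k (X t th) - q k (th (dyadic R m t))|.
  by apply: cvg_norm; apply: cvgB cq _; exact: cvg_cst.
apply: (cvgr_to_le cq2); exists m => // n /= mn.
exact: smooth_cauchy sm N0 _ _ _ m0m mn tN.
Qed.

Lemma X_continuous th : continuous (fun t => X t th).
Proof.
have [gth|nth] := pselect (Good th); last first.
  move=> t; rewrite (_ : (fun t => X t th) = fun=> point); first exact: cvg_cst.
  by apply/funext => u; rewrite /X; case: pselect.
move=> t; have FF : ProperFilter (X^~ th @ t).
  exact: (@fmap_proper_filter _ _ (X^~ th) _ (nbhs_pfilter t)).
apply: (@cvg_of_separating R W nat q (X^~ th @ t) (X t th) FF cW q_cont q_sep) => k.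
apply/cvgrPdist_lt => e e0; have [m1 H] := rate_pow_small e e0.
pose N := (Num.truncn (t + 1)).+1.
have tN : t + 1 < N%:R by rewrite truncnS_gt.
have [m0 sm] := gth k N; pose m := maxn m0 m1.
have p0 : 0 < ((2 : R) ^+ m)^-1 by rewrite invr_gt0 exprn_gt0.
have p1 : ((2 : R) ^+ m)^-1 <= 1 by rewrite invf_le1 ?exprn_gt0 // exprn_ege1 // ler1n.
exists ((2 ^+ m)^-1) => // s.
rewrite /ball_ /=.
rewrite ltr_distl => /andP[s1 s2].
have m0m : (m0 <= m)%N := leq_maxl _ _.
have tN' : t < N%:R by lra.
have d1 := X_dist k N m0 m t th gth sm isT m0m tN'.
have sN : s < N%:R by lra.
have d2 := X_dist k N m0 m s th gth sm isT m0m sN.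
have d3 : `|q k (th (dyadic R m t)) - q k (th (dyadic R m s))| <= rate ^+ m.
  have [st|ts] := leP s t; first by apply: (smooth_adjacent _ _ _ _ sm) => //; lra.
  by rewrite distrC; apply: (smooth_adjacent _ _ _ _ sm) => //; lra.
have := H m (leq_maxr _ _).
have := ler_distD (q k (th (dyadic R m t))) (q k (X t th)) (q k (X s th)).
have := ler_distD (q k (th (dyadic R m s))) (q k (th (dyadic R m t))) (q k (X s th)).
by rewrite [`|q k (th (dyadic R m s)) - _|]distrC; lra.
Qed.

Lemma cylinder_eval (f : W -> R) t : continuous f -> 0 <= t -> cylinder (fun th => f (th t)).
Proof.
move=> cf t0; split.
  by move=> th; apply: (continuous_comp (eval_continuous t th)); exact: cf.
exists [:: t]; split; first by rewrite /= t0.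
by move=> th th' h; rewrite h // inE.
Qed.

Lemma cylinder_measurable F : cylinder F -> measurable_fun setT (F : pathsB -> R).
Proof. by move=> EF; apply: measurable_cozero_type => //; [exact: cylinder_cst | exact: cylinder_add | exact: cylinder_mul]. Qed.

Definition jump k (s t : R) (th : R -> W) : R := q k (th t) - q k (th s).

Lemma cylinder_jump k s t : 0 <= s -> 0 <= t -> cylinder (jump k s t).
Proof.
move=> s0 t0; have E1 := cylinder_eval _ t (q_cont k) t0; have E2 := cylinder_eval _ s (q_cont k) s0.
apply: (cylinder_op _ _ (fun x y => x - y) E1 E2).
exact: continuous_add_fun E1.1 (continuous_opp_fun _ _ _ E2.1).
Qed.

Lemma cylinder_exp F n : cylinder F -> cylinder (fun th => F th ^+ n).
Proof.
move=> EF; apply: (cylinder_op _ _ (fun x y => x ^+ n) EF EF).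
exact: continuous_exp_fun EF.1.
Qed.

(** Integrating out time [t] leaves the semigroup bound at the position at time [s]; it is uniform
    in that position, hence in the initial law. *)
Lemma jump_moment k : exists2 C : R, 0 <= C & forall mu s t, 0 <= s -> s < t -> t <= s + 1 ->
  mean mu (fun th => jump k s t th ^+ 4) <= C * (t - s) ^+ 2.
Proof.
have [C HC] := q_moment k; exists `|C| => // mu s t s0 st ts.
have t0 : 0 <= t := le_trans s0 (ltW st).
have EF := cylinder_exp _ 4 (cylinder_jump k s t s0 t0).
have sF : supported (rcons [:: s] t) (fun th => jump k s t th ^+ 4).
  by move=> th th' h; rewrite /jump !h // !inE eqxx ?orbT.
have le_s : all (fun u => 0 <= u <= s) [:: s] by rewrite /= s0 lexx.
have [ES ->] := mean_step mu _ [:: s] s t EF.1 s0 st le_s sF.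
rewrite -[leRHS](mean_cst mu); apply: mean_mono => //; first exact: cylinder_cst.
move=> th; rewrite /step; apply: (@le_trans _ _ (C * (t - s) ^+ 2)); last first.
  by rewrite ler_wpM2r ?exprn_even_ge0 // ler_norm.
rewrite (_ : (fun w => _) = fun v => (q k v - q k (th s)) ^+ 4).
  by apply: HC; apply/andP; split; lra.
by apply/funext => w; rewrite /jump /upd eqxx lt_eqF.
Qed.

Definition big_jump k s t c : set pathsB := [set th | c < `|jump k s t th|].

Lemma measurable_big_jump k s t c : 0 <= s -> 0 <= t -> measurable (big_jump k s t c).
Proof.
move=> s0 t0; have EJ := cylinder_jump k s t s0 t0.
have EF : cylinder (fun th => `|jump k s t th| - c).
  apply: (cylinder_op _ _ (fun x y => `|x| - c) EJ EJ).
  apply: continuous_add_fun; last exact: continuous_cst_fun.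
  by move=> th; apply: cvg_norm; exact: EJ.1.
apply: sub_sigma_algebra; exists (fun th => `|jump k s t th| - c) => //.
by apply/seteqP; split=> th /=; rewrite subr_gt0.
Qed.

(** * Borel-Cantelli for dyadic increments *)

Section Law.
Variables (mu : probability (g_sigma_algebraType (@open W)) R) (P : probability pathsB R).
Hypothesis HP : forall F, cylinder F -> (\int[P]_th (F th)%:E = (mean mu F)%:E)%E.

Lemma big_jump_prob k : exists2 C : R, 0 <= C & forall s t c, 0 <= s -> s < t -> t <= s + 1 -> 0 < c ->
  (P (big_jump k s t c) <= (C * (t - s) ^+ 2 / c ^+ 4)%:E)%E.
Proof.
have [C C0 HC] := jump_moment k; exists C => // s t c s0 st ts c0.
have t0 : 0 <= t := le_trans s0 (ltW st).
have mA := measurable_big_jump k s t c s0 t0.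
have EF := cylinder_exp _ 4 (cylinder_jump k s t s0 t0).
have c4 : 0 < c ^+ 4 by rewrite exprn_gt0.
rewrite EFinM lee_pdivlMr // muleC -(integral_cst P mA).
apply: (@le_trans _ _ (\int[P]_th (jump k s t th ^+ 4)%:E)%E); last by rewrite (HP _ EF) lee_fin HC.
have mF : measurable_fun setT (fun th : pathsB => (jump k s t th ^+ 4)%:E).
  by apply/measurable_EFinP; exact: cylinder_measurable.
have F0 (th : pathsB) : (0 <= (jump k s t th ^+ 4)%:E)%E by rewrite lee_fin exprn_even_ge0.
apply: (@le_trans _ _ (\int[P]_(th in big_jump k s t c) (jump k s t th ^+ 4)%:E)%E).
  apply: ge0_le_integral => //.
  - by move=> th _; rewrite lee_fin ltW.
  - exact: measurable_funTS.
  move=> th /= h; rewrite lee_fin -[leRHS]ger0_norm ?exprn_even_ge0 // normrX.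
  by rewrite lerXn2r ?nnegrE ?(ltW c0) // ltW.
by apply: ge0_subset_integral.
Qed.

Definition bad k N m : set pathsB :=
  \big[setU/set0]_(j < (N * 2 ^ m)%N) big_jump k (j%:R / 2 ^+ m) (j.+1%:R / 2 ^+ m) (rate ^+ m).

Lemma measurable_bad k N m : measurable (bad k N m).
Proof.
apply: bigsetU_measurable => j _; apply: measurable_big_jump; by rewrite divr_ge0 // exprn_ge0.
Qed.

Lemma bad_prob k N : exists2 C : R, 0 <= C & forall m, (P (bad k N m) <= (C * (8 / 10) ^+ m)%:E)%E.
Proof.
have [C C0 HC] := big_jump_prob k; exists (N%:R * C); first by rewrite mulr_ge0.
move=> m; pose A j := big_jump k (j%:R / 2 ^+ m) (j.+1%:R / 2 ^+ m) (rate ^+ m).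
have mA j : measurable (A j) by apply: measurable_big_jump; rewrite divr_ge0 // exprn_ge0.
have Boole : (P (bad k N m) <= \sum_(j < (N * 2 ^ m)%N) P (A j))%E.
  by apply: (@Boole_inequality _ _ _ P A) => j _; exact: mA.
apply: (le_trans Boole).

apply: (@le_trans _ _ (\sum_(j < (N * 2 ^ m)%N) (C * ((2 ^+ m)^-1) ^+ 2 / (rate ^+ m) ^+ 4)%:E)%E).
  apply: lee_sum => j _.
  have two0 : 0 < (2 : R) ^+ m by rewrite exprn_gt0.
  have E : j.+1%:R / 2 ^+ m - j%:R / 2 ^+ m = (2 ^+ m)^-1 :> R.
    by rewrite -mulrBl -natr1 addrAC subrr add0r mul1r.
  have p1 : ((2 : R) ^+ m)^-1 <= 1 by rewrite invf_le1 // exprn_ege1 // ler1n.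
  have p0 : 0 < ((2 : R) ^+ m)^-1 by rewrite invr_gt0.
  rewrite -E; apply: HC.
  - by rewrite divr_ge0 // ltW.
  - by rewrite -subr_gt0 E.
  - by rewrite -lerBlDl E.
  - by rewrite exprn_gt0.
rewrite sumEFin lee_fin sumr_const card_ord -[_ *+ (N * _)]mulr_natl natrM natrX.
have -> : (rate ^+ m) ^+ 4 = (rate ^+ 4) ^+ m by rewrite -!exprM mulnC.
have -> : N%:R * 2 ^+ m * (C * (2 ^+ m)^-1 ^+ 2 / (rate ^+ 4) ^+ m) =
    N%:R * C * ((2^-1) ^+ m * (rate ^- 4) ^+ m) :> R.
  by rewrite !exprVn; field; rewrite !expf_neq0.
have rate4 : 5 / 8 <= rate ^+ 4.
  have r2 : 4 / 5 <= rate ^+ 2 by rewrite expr2; lra.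
  have : (4 / 5) * (4 / 5) <= rate ^+ 2 * rate ^+ 2 by rewrite ler_pM.
  by rewrite -exprD; apply: le_trans; lra.
have irate4 : rate ^- 4 <= 8 / 5.
  by rewrite invf_ple ?posrE ?exprn_gt0 // invf_div.
have i0 : 0 <= rate ^- 4 by rewrite invr_ge0 exprn_ge0.
rewrite -exprMn ler_wpM2l ?mulr_ge0 //; apply: lerXn2r; rewrite ?nnegrE //; lra.
Qed.

Lemma Good_bad : (Good : set pathsB) = ~` \bigcup_k \bigcup_N lim_sup_set (bad k N).
Proof.
have badP k N m th : bad k N m th <-> exists2 j, (j < N * 2 ^ m)%N &
    rate ^+ m < `|jump k (j%:R / 2 ^+ m) (j.+1%:R / 2 ^+ m) th|.
  rewrite /bad -(bigcup_mkord _ (fun j => big_jump k (j%:R / 2 ^+ m) (j.+1%:R / 2 ^+ m) (rate ^+ m))).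
  by split => [[j /= jN h]|[j jN h]]; exists j.
apply/seteqP; split => th.
  move=> gth [k _ [N _ h]]; have [m0 sm] := gth k N.
  have [m /= m0m /badP[j jN]] := h m0 I.
  by rewrite ltNge sm.
move=> nb k N; apply/not_notP => nex; apply: nb; exists k => //; exists N => // m0 _.
apply/not_notP => nm; apply: nex; exists m0 => m m0m j jN; rewrite leNgt; apply/negP => h.
by apply: nm; exists m => //; apply/badP; exists j.
Qed.

Lemma measurable_Good : measurable (Good : set pathsB).
Proof.
rewrite Good_bad; apply: measurableC; apply: bigcupT_measurable => k; apply: bigcupT_measurable => N.
apply: bigcapT_measurable => n; apply: bigcup_measurable => m _; exact: measurable_bad.
Qed.

Lemma Good_ae : P.-negligible (~` (Good : set pathsB)).
Proof.
rewrite Good_bad setCK; apply: negligible_bigcup => k; apply: negligible_bigcup => N.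
have mls : measurable (lim_sup_set (bad k N)).
  apply: bigcapT_measurable => n; apply: bigcup_measurable => m _; exact: measurable_bad.
apply/negligibleP => //; apply: lim_sup_set_cvg0; first exact: measurable_bad.
have [C C0 HC] := bad_prob k N.
apply: (@le_lt_trans _ _ (\sum_(m <oo) (C * (8 / 10) ^+ m)%:E)%E).
  by apply: lee_nneseries => m // _; exact: HC.
apply: (@le_lt_trans _ _ (C * 5)%:E); last by rewrite ltry.
apply: lime_le; first by apply: is_cvg_nneseries => m _ _; rewrite lee_fin mulr_ge0 // exprn_ge0.
apply: nearW => n; rewrite sumEFin lee_fin -mulr_sumr ler_wpM2l //.
have -> : \sum_(0 <= i < n) (8 / 10 : R) ^+ i = 5 - 5 * (8 / 10) ^+ n.
  elim: n => [|n IH]; first by rewrite big_geq // expr0 mulr1 subrr.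
  by rewrite big_nat_recr //= IH exprS; field.
by rewrite lerBlDr lerDl mulr_ge0 // exprn_ge0.
Qed.

Lemma bounded_cvg_integral (f : nat -> pathsB -> R) (g : pathsB -> R) (D : set pathsB) (M : R) :
  measurable D -> (forall n, measurable_fun setT (f n)) -> measurable_fun setT g ->
  (forall n th, `|f n th| <= M) -> (forall th, Good th -> f n th @[n --> \oo] --> g th) ->
  (\int[P]_(th in D) (f n th)%:E)%E @[n --> \oo] --> (\int[P]_(th in D) (g th)%:E)%E.
Proof.
move=> mD mf mg fM fg.
have := @dominated_convergence _ _ _ P D mD (fun n th => (f n th)%:E) (fun th => (g th)%:E) (fun=> M%:E).
case.
- by move=> n; apply/measurable_EFinP; exact: measurable_funTS.
- by apply/measurable_EFinP; exact: measurable_funTS.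
- apply: (negligibleS _ Good_ae) => th /= nQ gth; apply: nQ => _.
  by apply: cvg_EFin; [exact: nearW | exact: fg].
- by apply: finite_measure_integrable_cst.
- by apply: aeW => th n _; rewrite lee_fin.
by [].
Qed.

End Law.

Hypothesis q_bound : forall k w, `|q k w| <= 2.
Hypothesis HTsc : forall f : W -> R, continuous f -> forall e : R, 0 < e ->
  \forall s \near 0^'+, forall w, `|T s f w - f w| < e.

(** Contractivity carries strong continuity at zero to every time, on both sides of [s]. *)
Lemma semigroup_time_continuous (s : R) (f : W -> R) (e : R) : 0 <= s -> continuous f -> 0 < e ->
  exists2 d : R, 0 < d & forall u, 0 <= u -> `|u - s| < d -> forall w, `|T u f w - T s f w| <= e.
Proof.
move=> s0 cf e0; have [d /= d0 H] := HTsc f cf e e0.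
have {}H h : 0 <= h -> h < d -> forall w, `|T h f w - f w| <= e.
  rewrite le_eqVlt => /orP[/eqP <- _ w|h0 hd w]; first by rewrite HT0 // subrr normr0 ltW.
  by apply/ltW/H => //=; rewrite sub0r normrN gtr0_norm.
exists d => // u u0; rewrite ltr_norml => /andP[h1 h2] w.
have [su|us] := leP s u.
  have -> : u = s + (u - s) by ring.
  rewrite HTsg ?subr_ge0 //; apply: semigroup_dist => //; first by apply: HTcont; rewrite ?subr_ge0.
  by apply: H; rewrite ?subr_ge0 //; lra.
have {1}-> : s = u + (s - u) by ring.
rewrite HTsg ?subr_ge0 ?(ltW us) // distrC; apply: semigroup_dist => //.
  by apply: HTcont; rewrite ?subr_ge0 ?(ltW us).
by apply: H; rewrite ?subr_ge0 ?(ltW us) //; lra.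
Qed.

Lemma preimage_borel (Y : Type) (S : set (set Y)) (g : Y -> W) : sigma_algebra setT S ->
  (forall U, open U -> S (g @^-1` U)) -> forall B, <<s @open W >> B -> S (g @^-1` B).
Proof.
move=> [S0 SC SU] SO; apply: smallest_sub => //; split => /=.
- by rewrite preimage_set0.
- by move=> A SA; exact: (SC _ SA).
- by move=> A SA; rewrite preimage_bigcup; exact: SU.
Qed.

(** Reduces measurability of maps into [W] to real-valued continuous functions, for which pointwise
    limits are available. *)
Lemma preimage_cozero (Y : Type) (S : set (set Y)) (g : Y -> W) :
  (forall f : W -> R, continuous f -> S [set y | 0 < f (g y)]) ->
  forall U, open U -> S (g @^-1` U).
Proof.
move=> H U oU; have [f [cf _ ->]] := open_cozero R W q U cW q_cont q_sep q_bound oU.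
exact: H.
Qed.

Lemma dyadic_cvg (t : R) : 0 <= t -> dyadic R m t @[m --> \oo] --> t.
Proof.
move=> t0; apply/cvgrPdist_lt => e e0.
have half : `|2^-1 : R| < 1 by rewrite ger0_norm //; lra.
have /cvgrPdist_lt/(_ _ e0)[N _ H] := @cvg_geometric R 1 2^-1 half.
exists N => // m /H /=; rewrite sub0r normrN mul1r exprVn ger0_norm ?invr_ge0 ?exprn_ge0 // => h.
rewrite ger0_norm ?subr_ge0 ?dyadic_le //.
by have := dyadic_gt R m t t0; lra.
Qed.

Definition sample m (th : paths) : paths := fun t => th (dyadic R m t).

(** Sampling keeps supports finite, so expectations of the continuous version become limits of
    values of [mean]. *)
Lemma cylinder_sample m F ts : continuous (F : paths -> R) -> supported ts F ->
  continuous (fun th => F (sample m th)) /\ supported [seq dyadic R m t | t <- ts] (fun th => F (sample m th)).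
Proof.
move=> cF sF; split.
  have cs : continuous (sample m) by apply: paths_continuous => t; exact: eval_continuous.
  by move=> th; apply: (continuous_comp (cs th)); exact: cF.
by move=> th th' h; apply: sF => t tts; apply: h; exact: map_f.
Qed.

Definition Xpath (th : R -> W) : R -> W := fun t => X t th.

Lemma sample_cvg F th : continuous (F : paths -> R) -> Good th -> F (sample m th) @[m --> \oo] --> F (Xpath th).
Proof.
move=> cF gth; have h : sample m th @[m --> \oo] --> (Xpath th : paths).
  by apply: paths_cvg => t; exact: X_cvg.
exact: (cvg_comp _ _ h (cF _)).
Qed.

Lemma measurable_Xpath (F : paths -> R) ts : continuous F -> supported ts F ->
  measurable_fun setT (fun th : pathsB => F (Xpath th)).
Proof.
move=> cF sF; rewrite -(setUv (Good : set pathsB)).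
have mG := measurable_Good.
apply/measurable_funU => //; first exact: measurableC.
split.
  apply: (@measurable_fun_cvg _ pathsB R Good (fun m th => F (sample m th)) (fun th => F (Xpath th))) => [m|th gth]; last exact: sample_cvg.
  apply: measurable_funTS; apply: cylinder_measurable; have [c s] := cylinder_sample m F ts cF sF.
  split=> //; exists [seq dyadic R m t | t <- ts]; split => //.
  by apply/allP => _ /mapP[t _ ->]; exact: dyadic_ge0.
apply: (eq_measurable_fun (fun=> F (fun=> point))); last exact: measurable_cst.
move=> th; rewrite inE /= => nth; congr F; apply/funext => t.
by rewrite /Xpath /X; case: pselect.
Qed.

Lemma measurable_fX t (f : W -> R) : continuous f -> measurable_fun setT (fun th : pathsB => f (X t th)).
Proof.
move=> cf; apply: (measurable_Xpath (fun th => f (th t)) [:: t]).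
  by move=> th; apply: (continuous_comp (eval_continuous t th)); exact: cf.
by move=> th th' h; rewrite h // inE.
Qed.

(** * Markov property of the continuous version at fixed times *)

Section LawX.
Variables (mu : probability (g_sigma_algebraType (@open W)) R) (P : probability pathsB R).
Hypothesis HP : forall F, cylinder F -> (\int[P]_th (F th)%:E = (mean mu F)%:E)%E.

Lemma mean_sample_cvg F ts : continuous (F : paths -> R) -> supported ts F ->
  (mean mu (fun th => F (sample m th)))%:E @[m --> \oo] --> (\int[P]_th (F (Xpath th))%:E)%E.
Proof.
move=> cF sF; have [M FM] := continuous_bounded _ F paths_compact cF.
have ES m : cylinder (fun th => F (sample m th)).
  have [c s] := cylinder_sample m F ts cF sF.
  split=> //; exists [seq dyadic R m t | t <- ts]; split => //.
  by apply/allP => _ /mapP[t _ ->]; exact: dyadic_ge0.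
have := bounded_cvg_integral mu P HP (fun m th => F (sample m th)) (fun th => F (Xpath th)) setT M.
rewrite (_ : (fun n => _) = (fun m => (mean mu (fun th => F (sample m th)))%:E)); last first.
  by apply/funext => m; exact: HP.
apply => //.
- by move=> m; exact: cylinder_measurable.
- exact: measurable_Xpath cF sF.
- by move=> th; exact: sample_cvg.
Qed.

Lemma markov_cylinder (F : paths -> R) ts (t s : R) (f : W -> R) : continuous F -> supported ts F ->
  all (fun u => 0 <= u <= t) ts -> 0 <= t -> 0 <= s -> continuous f ->
  (\int[P]_th (F (Xpath th) * f (X (t + s) th))%:E = \int[P]_th (F (Xpath th) * T s f (X t th))%:E)%E.
Proof.
move=> cF sF /allP ts_t t0 s0 cf.
have cTf : continuous (T s f) by exact: HTcont.
have cev (g : W -> R) u : continuous g -> continuous (fun th : paths => g (th u)).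
  by move=> cg th; apply: (continuous_comp (eval_continuous u th)); exact: cg.
pose G (th : paths) := F th * f (th (t + s)); pose H (th : paths) := F th * T s f (th t).
have cG : continuous G by apply: continuous_mul_fun => //; exact: cev.
have cH : continuous H by apply: continuous_mul_fun => //; exact: cev.
have sG : supported ((t + s) :: t :: ts) G.
  move=> th th' h; rewrite /G (sF th th') ?h ?inE ?eqxx // => u uts.
  by apply: h; rewrite !inE uts !orbT.
have sH : supported ((t + s) :: t :: ts) H.
  move=> th th' h; rewrite /H (sF th th') ?h ?inE ?eqxx ?orbT // => u uts.
  by apply: h; rewrite !inE uts !orbT.
have [M FM] := continuous_bounded _ F paths_compact cF.
have GX := mean_sample_cvg G _ cG sG; have HX := mean_sample_cvg H _ cH sH.
(* The time actually elapsed between the rounded times differs from [s]; it is replaced by [s] only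
   in the limit. *)
pose sg m := dyadic R m (t + s) - dyadic R m t.
have sg0 m : 0 <= sg m by rewrite subr_ge0 dyadic_mono // lerDl.
have ts0 : 0 <= t + s by rewrite addr_ge0.
have sg_cvg : sg m @[m --> \oo] --> s.
  have -> : s = t + s - t by ring.
  by apply: cvgB; exact: dyadic_cvg.
pose Hm m (th : paths) := F (sample m th) * T (sg m) f (th (dyadic R m t)).
have cyl m : cylinder (fun th => F (sample m th)) /\ supported [seq dyadic R m t | t <- ts] (fun th => F (sample m th)).
  have [c s1] := cylinder_sample m F ts cF sF; split=> //.
  split=> //; exists [seq dyadic R m t | t <- ts]; split => //.
  by apply/allP => _ /mapP[u _ ->]; exact: dyadic_ge0.
have EHm m : cylinder (Hm m).
  apply: cylinder_mul; first exact: (cyl m).1.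
  by apply: cylinder_eval; [exact: HTcont | exact: dyadic_ge0].
have EHs m : cylinder (fun th => H (sample m th)).
  apply: cylinder_mul; first exact: (cyl m).1.
  by apply: (cylinder_eval (T s f)) => //; exact: dyadic_ge0.
have GHm m : mean mu (fun th => G (sample m th)) = mean mu (Hm m).
  have := dyadic_mono R m _ _ (_ : t <= t + s); rewrite lerDl => /(_ s0).
  (* At a coarse level, or for [s = 0], both times may round to the same dyadic; then [T 0] acts as
     the identity. *)
  rewrite le_eqVlt => /orP[/eqP eq_d|lt_d].
    congr (mean mu _); apply/funext => th; rewrite /G /Hm /sample /sg -eq_d subrr HT0 //.
  have cGm : continuous (fun th => G (sample m th)).
    exact: (cylinder_sample m G _ cG sG).1.
  have le_ts : all (fun u => 0 <= u <= dyadic R m t) [seq dyadic R m u | u <- ts].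
    apply/allP => _ /mapP[u /ts_t /andP[u0 ut] ->].
    by rewrite dyadic_ge0 dyadic_mono.
  have sGm : supported (rcons [seq dyadic R m u | u <- ts] (dyadic R m (t + s))) (fun th => G (sample m th)).
    move=> th th' h; rewrite /G /= ((cyl m).2 th th') /sample ?h ?mem_rcons ?inE ?eqxx // => u uts.
    by apply: h; rewrite mem_rcons inE uts orbT.
  have [_ ->] := mean_step mu _ _ _ _ cGm (dyadic_ge0 R m t) lt_d le_ts sGm.
  congr (mean mu _); apply/funext => th; rewrite /step /Hm.
  rewrite (_ : (fun w => _) = fun w => F (sample m th) * f w); first by rewrite -/(sg m) semigroup_scale ?sg0.
  apply/funext => w; rewrite /G /sample {2}/upd eqxx; congr (_ * _).
  apply: (cyl m).2 => u /mapP[v /ts_t /andP[_ vt] ->]; rewrite /upd lt_eqF //.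
  by apply: le_lt_trans lt_d; exact: dyadic_mono.
have M0 : 0 <= M by have := FM (fun=> point); apply: le_trans.
have HHm : (fun m => mean mu (Hm m) - mean mu (fun th => H (sample m th))) @ \oo --> 0.
  (* Strong continuity makes the replacement of [sg m] by [s] uniform in the position; [M + 1] keeps
     the denominator positive. *)
  apply/cvgrPdist_le => e e0; pose e' := e / (M + 1).
  have e'0 : 0 < e' by rewrite divr_gt0 // ltr_wpDl.
  have [d d0 Hd] := semigroup_time_continuous s f e' s0 cf e'0.
  have /cvgrPdist_lt/(_ _ d0) [N _ HN] := sg_cvg.
  exists N => // m /HN /= hm; rewrite sub0r normrN -mean_sub //.
  have bnd th : `|Hm m th - H (sample m th)| <= e.
    rewrite /Hm /H -mulrBr normrM; apply: (@le_trans _ _ (M * e')).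
      by apply: ler_pM => //; apply: Hd => //; rewrite distrC.
    by rewrite /e' mulrA ler_pdivrMr ?ltr_wpDl // [e * _]mulrC ler_wpM2r ?(ltW e0) // lerDl.
  have ED : cylinder (fun th => Hm m th - H (sample m th)).
    apply: (cylinder_op _ _ (fun x y => x - y) (EHm m) (EHs m)).
    exact: continuous_add_fun (EHm m).1 (continuous_opp_fun _ _ _ (EHs m).1).
  rewrite ler_norml; apply/andP; split.
    rewrite -[leLHS](mean_cst mu); apply: mean_mono => //; first exact: cylinder_cst.
    by move=> th; have := bnd th; rewrite ler_norml => /andP[].
  rewrite -[leRHS](mean_cst mu); apply: mean_mono => //; first exact: cylinder_cst.
  by move=> th; have := bnd th; rewrite ler_norml => /andP[].
have fin (K : paths -> R) us : continuous K -> supported us K -> (\int[P]_th (K (Xpath th))%:E \is a fin_num)%E.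
  move=> cK sK; apply: integrable_fin_num => //; have [M' KM] := continuous_bounded _ K paths_compact cK.
  apply: (@le_integrable _ _ _ P _ _ _ (fun=> M'%:E)) => //.
  - by apply/measurable_EFinP; exact: measurable_Xpath cK sK.
  - by move=> th _; rewrite /= lee_fin (le_trans (KM _)) // ler_norm.
  - exact: finite_measure_integrable_cst.
have fG := fin G _ cG sG; have fH := fin H _ cH sH.
rewrite -[LHS]/(\int[P]_th (G (Xpath th))%:E)%E -[RHS]/(\int[P]_th (H (Xpath th))%:E)%E.
rewrite -(fineK fG) -(fineK fH); congr EFin.
move: GX HX; rewrite -(fineK fG) -(fineK fH) => /fine_cvg GX /fine_cvg HX.
apply/eqP; rewrite -subr_eq0; apply/eqP.
have DX : (fun m => mean mu (fun th => G (sample m th)) - mean mu (fun th => H (sample m th))) @ \oo -->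
    fine (\int[P]_th (G (Xpath th))%:E)%E - fine (\int[P]_th (H (Xpath th))%:E)%E.
  by apply: cvgB.
apply: (@cvg_unique R _ _ _ _ _ DX); first exact: Rhausdorff.
by apply: cvg_trans HHm; apply: near_eq_cvg; apply: nearW => m /=; rewrite GHm.
Qed.

Lemma law_initial (f : W -> R) : continuous f -> (\int[P]_th (f (X 0 th))%:E = \int[mu]_w (f w)%:E)%E.
Proof.
move=> cf; have [E0 M0] := mean_initial mu f cf.
have cF : continuous (fun th : paths => f (th 0)) := E0.1.
have sF : supported [:: 0] (fun th => f (th 0)) by move=> th th' h; rewrite h // inE.
have := mean_sample_cvg _ _ cF sF; rewrite /sample.
rewrite (_ : (fun m => _) = fun=> (mean mu (fun th => f (th 0)))%:E); last first.
  by apply/funext => m; rewrite dyadic0.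
rewrite M0 fineK; last by apply: integrable_fin_num => //; exact: continuous_integrable.
move=> h; apply: (@cvg_unique (\bar R) _ _ _ _ _ h); first exact: ereal_hausdorff.
exact: cvg_cst.
Qed.

End LawX.

(** * The strong Markov property *)

Definition natural_gen (t : R) : set (set pathsB) :=
  [set A | exists s, 0 <= s <= t /\ exists2 U, open U & A = X s @^-1` U].

Definition Ft (t : R) : set (set pathsB) := <<s natural_gen t >>.

Lemma Ft_sigma t : sigma_algebra setT (Ft t).
Proof. exact: smallest_sigma_algebra. Qed.

Lemma measurable_X t B : <<s @open W >> B -> measurable (X t @^-1` B : set pathsB).
Proof.
move=> mB; apply: preimage_borel mB; first exact: sigma_algebra_measurable.
apply: preimage_cozero => f cf.
have := measurable_fX t f cf measurableT `]0, +oo[%classic (measurable_itv _).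
by rewrite setTI; congr measurable; apply/seteqP; split=> th /=; rewrite in_itv /= andbT.
Qed.

Lemma Ft_measurable t : Ft t `<=` measurable.
Proof.
apply: smallest_sub; first exact: sigma_algebra_measurable.
by move=> _ [s [_ [U oU ->]]]; apply: measurable_X; exact: sub_sigma_algebra.
Qed.

Lemma Ft_mono s t : s <= t -> Ft s `<=` Ft t.
Proof.
move=> st; apply: smallest_sub; first exact: smallest_sigma_algebra.
move=> _ [u [/andP[u0 us] [U oU ->]]]; apply: sub_sigma_algebra.
by exists u; split; [rewrite u0 (le_trans us) | exists U].
Qed.

Lemma Ft_filtration : filtration pathsB R Ft.
Proof.
split; first exact: Ft_sigma.
by split; [exact: Ft_measurable | move=> s t _; exact: Ft_mono].
Qed.

Lemma Ft_adapted s t B : 0 <= s -> s <= t -> <<s @open W >> B -> Ft t (X s @^-1` B).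
Proof.
move=> s0 st; apply: preimage_borel; first exact: Ft_sigma.
by move=> U oU; apply: sub_sigma_algebra; exists s; rewrite s0 st; split=> //; exists U.
Qed.

Definition FtT t := g_sigma_algebraType (natural_gen t).

Lemma FtE t (A : set pathsB) : Ft t A = measurable (A : set (FtT t)).
Proof. by []. Qed.

Section StoppingTime.
Variable tau : pathsB -> \bar R.
Hypothesis st_tau : stopping_time pathsB R Ft tau.

Lemma tau_le t v : 0 <= t -> Ft t [set th | (tau th <= t%:E)%E /\ (tau th <= v%:E)%E].
Proof.
move=> t0; have [v0|v0] := ltP v 0.
  rewrite (_ : [set _ | _] = set0); first by have [] := Ft_sigma t.
  apply/seteqP; split => // th [_ h]; have := le_trans (st_tau.1 th) h.
  by rewrite lee_fin leNgt v0.
have [vt|tv] := leP v t.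
  rewrite (_ : [set _ | _] = [set th | (tau th <= v%:E)%E]).
    by apply: (Ft_mono _ _ vt); exact: st_tau.2.
  by apply/seteqP; split => [th []//|th h]; split=> //; apply: (le_trans h); rewrite lee_fin.
rewrite (_ : [set _ | _] = [set th | (tau th <= t%:E)%E]); first exact: st_tau.2.
by apply/seteqP; split => [th []//|th h]; split=> //; apply: (le_trans h); rewrite lee_fin ltW.
Qed.

Lemma tau_lt t v : 0 <= t -> Ft t [set th | (tau th <= t%:E)%E /\ (tau th < v%:E)%E].
Proof.
move=> t0; rewrite (_ : [set _ | _] =
  \bigcup_n [set th | (tau th <= t%:E)%E /\ (tau th <= (v - n.+1%:R^-1)%:E)%E]).
  by rewrite FtE; apply: bigcupT_measurable => n; exact: tau_le.
apply/seteqP; split => th.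
  move=> [h1 h2]; move: (st_tau.1 th) h1 h2; case E : (tau th) => [r| |] //= r0.
  rewrite !lee_fin lte_fin => rt rv.
  have d0 : 0 < v - r by rewrite subr_gt0.
  exists (Num.truncn (v - r)^-1) => //=; rewrite E !lee_fin; split => //.
  rewrite lerBrDl -lerBrDr -[leRHS]invrK lef_pV2 ?posrE ?invr_gt0 //.
  by rewrite ltW // truncnS_gt.
move=> [n _ /= [h1 h2]]; split=> //; apply: (le_lt_trans h2).
by rewrite lte_fin ltrBlDr ltrDl invr_gt0.
Qed.

Lemma tau_ge t v : 0 <= t -> Ft t [set th | (tau th <= t%:E)%E /\ (v%:E <= tau th)%E].
Proof.
move=> t0; rewrite (_ : [set _ | _] =
  [set th | (tau th <= t%:E)%E] `\` [set th | (tau th <= t%:E)%E /\ (tau th < v%:E)%E]).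
  by rewrite FtE; apply: measurableD; [exact: st_tau.2 | exact: tau_lt].
apply/seteqP; split => th /=; first by move=> [h1 h2]; split=> // -[_]; rewrite ltNge h2.
by move=> [h1 h2]; split=> //; rewrite leNgt; apply/negP => h3; exact: h2.
Qed.

Lemma tau_finE th : (tau th < +oo)%E -> tau th = (fine (tau th))%:E /\ 0 <= fine (tau th).
Proof.
move=> h; have h0 := st_tau.1 th; split; last exact: fine_ge0.
by rewrite fineK // ge0_fin_numE.
Qed.

Lemma truncn_tauP m j th : (tau th < +oo)%E -> Num.truncn (2 ^+ m * fine (tau th)) = j <->
  ((j%:R / 2 ^+ m)%:E <= tau th)%E /\ (tau th < (j.+1%:R / 2 ^+ m)%:E)%E.
Proof.
move=> /tau_finE[E r0]; have p0 : 0 < (2 : R) ^+ m by rewrite exprn_gt0.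
have x0 : 0 <= 2 ^+ m * fine (tau th) by rewrite mulr_ge0 // ltW.
rewrite E /= lee_fin lte_fin ler_pdivrMr // ltr_pdivlMr // [_ * 2 ^+ m]mulrC; split.
  by move=> <-; apply/andP; exact: truncn_itv.
by move=> [h1 h2]; apply: truncn_def; rewrite h1.
Qed.

(** Strictly later than a finite [tau], so that the event of a given value belongs to the past of
    that value. *)
Definition next_time m (th : pathsB) : R := (Num.truncn (2 ^+ m * fine (tau th))).+1%:R / 2 ^+ m.

Lemma next_time_cvg th : (0 <= fine (tau th)) -> next_time m th @[m --> \oo] --> fine (tau th).
Proof.
move=> r0; have E m : next_time m th = dyadic R m (fine (tau th)) + 2^-1 ^+ m.
  by rewrite /next_time /dyadic -natr1 mulrDl mul1r exprVn.
rewrite (_ : next_time^~ th = fun m => dyadic R m (fine (tau th)) + 2^-1 ^+ m); last by apply/funext.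
rewrite -[X in _ --> X]addr0; apply: cvgD; first exact: dyadic_cvg.
by apply: cvg_expr; rewrite ger0_norm //; lra.
Qed.

Lemma fine_tau_ge0 th : 0 <= fine (tau th).
Proof. exact: fine_ge0 (st_tau.1 th). Qed.

(** The stopping time is approximated from above, but the approximation is capped at [t]: this keeps
    the event in [Ft t] and does not change the limit when [tau] is at most [t]. *)
Lemma Xtau_cozero t (f : W -> R) : 0 <= t -> continuous f ->
  Ft t [set th | (tau th <= t%:E)%E /\ 0 < f (X (fine (tau th)) th)].
Proof.
move=> t0 cf.
pose E m j := [set th | (tau th <= t%:E)%E /\ Num.truncn (2 ^+ m * fine (tau th)) = j].
pose V m j p := [set th | p.+1%:R^-1 < f (X (Num.min t (j.+1%:R / 2 ^+ m)) th)].
have ltoo th : (tau th <= t%:E)%E -> (tau th < +oo)%E by move=> h; apply: (le_lt_trans h); rewrite ltry.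
have FE m j : Ft t (E m j).
  rewrite (_ : E m j = [set th | (tau th <= t%:E)%E /\ ((j%:R / 2 ^+ m)%:E <= tau th)%E] `&`
      [set th | (tau th <= t%:E)%E /\ (tau th < (j.+1%:R / 2 ^+ m)%:E)%E]).
    by rewrite FtE; apply: measurableI; [exact: tau_ge | exact: tau_lt].
  apply/seteqP; split => th /=.
    by move=> [h /(truncn_tauP _ _ _ (ltoo _ h))[]].
  by move=> [[h h1] [_ h2]]; split=> //; apply/(truncn_tauP _ _ _ (ltoo _ h)).
have FV m j p : Ft t (V m j p).
  have cfp : continuous (fun w => f w - p.+1%:R^-1).
    by apply: continuous_add_fun => //; exact: continuous_cst_fun.
  have oU : open [set w | 0 < f w - p.+1%:R^-1].
    rewrite (_ : [set _ | _] = (fun w => f w - p.+1%:R^-1) @^-1` `]0, +oo[%classic).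
      by move/continuousP : cfp; apply; exact: interval_open.
    by apply/seteqP; split=> w /=; rewrite in_itv /= andbT.
  rewrite (_ : V m j p = X (Num.min t (j.+1%:R / 2 ^+ m)) @^-1` [set w | 0 < f w - p.+1%:R^-1]).
    apply: Ft_adapted; [|by rewrite ge_min lexx|exact: sub_sigma_algebra].
    by rewrite le_min t0 divr_ge0 // exprn_ge0.
  by apply/seteqP; split=> th /=; rewrite subr_gt0.
(* Eventual lower bounds by some [1 / (p + 1)] express strict positivity in a form that survives the
   limit in [m]. *)
rewrite (_ : [set _ | _] = \bigcup_p \bigcup_m0 \bigcap_(m in [set m | (m0 <= m)%N]) \bigcup_j (E m j `&` V m j p)).
  rewrite FtE; apply: bigcupT_measurable => p; apply: bigcupT_measurable => m0.
  apply: bigcap_measurable => [|m _]; first by exists m0 => /=.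
  by apply: bigcupT_measurable => j; apply: measurableI; [exact: FE | exact: FV].
have lim_f th : (tau th <= t%:E)%E ->
    f (X (Num.min t (next_time m th)) th) @[m --> \oo] --> f (X (fine (tau th)) th).
  move=> h; have [Er r0] := tau_finE th (ltoo _ h).
  have rt : fine (tau th) <= t by rewrite -lee_fin -Er.
  apply: continuous_cvg; first exact: cf.
  have cmin : continuous (fun u : R => Num.min t u).
    by apply: continuous_min_fun; [exact: continuous_cst_fun | move=> u; exact: cvg_id].
  have cm := cvg_comp _ _ (next_time_cvg th r0) (cmin (fine (tau th))).
  by have := cvg_comp _ _ cm (X_continuous th (Num.min t (fine (tau th)))); rewrite (min_r rt).
apply/seteqP; split => th /=.
  move=> [h y0]; set y := f _ in y0.
  pose p := Num.truncn y^-1; have py : p.+1%:R^-1 < y.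
    by rewrite -[ltRHS]invrK ltf_pV2 ?posrE ?invr_gt0 // truncnS_gt.
  exists p => //; have d0 : 0 < y - p.+1%:R^-1 by rewrite subr_gt0.
  have /cvgrPdist_lt/(_ _ d0)[m0 _ H] := lim_f th h.
  exists m0 => // m /= /H /=; rewrite -/y ltr_norml => /andP[_ h1].
  by exists (Num.truncn (2 ^+ m * fine (tau th))) => //; split=> //; by move: h1; rewrite ltrD2l ltrN2.
move=> [p _ [m0 _ H]]; have h : (tau th <= t%:E)%E by have [j _ [[]]] := H m0 (leqnn m0).
split=> //; apply: (@lt_le_trans _ _ (p.+1%:R^-1)); first by rewrite invr_gt0.
apply: (cvgr_to_ge (lim_f th h)); exists m0 => // m /= m0m.
by have [j _ [[_ Ej] Vj]] := H m m0m; rewrite /next_time Ej ltW.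
Qed.

Lemma Xtau_F_tau B : <<s @open W >> B ->
  F_tau pathsB R Ft tau ([set th | (tau th < +oo)%E] `&` (fun th => X (fine (tau th)) th) @^-1` B).
Proof.
move=> mB.
have Ft_B t : 0 <= t -> Ft t ([set th | (tau th <= t%:E)%E] `&` (fun th => X (fine (tau th)) th) @^-1` B).
  move=> t0; pose S (A : set pathsB) := Ft t ([set th | (tau th <= t%:E)%E] `&` A).
  have mt : measurable ([set th | (tau th <= t%:E)%E] : set (FtT t)) by exact: st_tau.2.
  apply: (preimage_borel _ S) mB.
    split; rewrite /S.
    - by rewrite setI0 FtE.
    - move=> A SA; rewrite (_ : _ `&` _ = [set th | (tau th <= t%:E)%E] `\` ([set th | (tau th <= t%:E)%E] `&` A)).
        by rewrite FtE; apply: measurableD.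
      apply/seteqP; split=> th /= [h1 h2]; split=> //; first by move=> [_ h3]; case: h2.
      by split=> // h3; apply: h2.
    - by move=> A SA; rewrite setI_bigcupr FtE; apply: bigcupT_measurable.
  by apply: preimage_cozero => f cf; exact: Xtau_cozero.
have ltE : [set th | (tau th < +oo)%E] = \bigcup_n [set th | (tau th <= n%:R%:E)%E].
  apply/seteqP; split => th /=.
    move=> /tau_finE[E _]; exists (Num.truncn (fine (tau th))).+1 => //=.
    by rewrite E lee_fin ltW // truncnS_gt.
  by move=> [n _] /= h; apply: (le_lt_trans h); rewrite ltry.
split.
  rewrite ltE setI_bigcupl; apply: bigcupT_measurable => n.
  by apply: (Ft_measurable n%:R); exact: Ft_B.
move=> t t0; rewrite [X in Ft t X](_ : _ = [set th | (tau th <= t%:E)%E] `&` (fun th => X (fine (tau th)) th) @^-1` B).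
  exact: Ft_B.
apply/seteqP; split => th /= => [[[_ h1] h2]//|[h1 h2]]; split=> //; split=> //.
by apply: (le_lt_trans h1); rewrite ltry.
Qed.

End StoppingTime.

(* A pi-system containing [natural_gen t] whose indicators are limits of finitely supported functions,
   for which the Markov property is the definition of [mean]. *)
Definition product_gen (t : R) : set (set pathsB) := [set A | measurable A /\
  exists (F : nat -> paths -> R) (ts : nat -> seq R),
    (forall k, [/\ continuous (F k), supported (ts k) (F k), all (fun u => 0 <= u <= t) (ts k) &
       forall th, 0 <= F k th <= 1]) /\
    forall th : pathsB, (fun k => F k (Xpath th)) @ \oo --> (\1_A th : R)].

Lemma product_genI t : setI_closed (product_gen t).
Proof.
move=> A B [mA [F [ts [HF cF]]]] [mB [G [us [HG cG]]]]; split; first exact: measurableI.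
exists (fun k th => F k th * G k th), (fun k => ts k ++ us k); split => [k|th].
  have [c1 s1 a1 b1] := HF k; have [c2 s2 a2 b2] := HG k; split.
  - exact: continuous_mul_fun.
  - move=> th th' h; rewrite (s1 th th') ?(s2 th th') // => u uu; apply: h; rewrite mem_cat uu ?orbT //.
  - by rewrite all_cat a1.
  move=> th; have /andP[p1 p2] := b1 th; have /andP[p3 p4] := b2 th.
  by rewrite mulr_ge0 //= mulr_ile1.
by rewrite indicI; exact: cvgM (cF th) (cG th).
Qed.

Lemma natural_product_gen t : natural_gen t `<=` product_gen t.
Proof.
move=> _ [s [/andP[s0 st] [U oU ->]]].
have [f [cf f01 UE]] := open_cozero R W q U cW q_cont q_sep q_bound oU.
split; first by apply: measurable_X; exact: sub_sigma_algebra.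
exists (fun k th => Num.min 1 (k%:R * f (th s))), (fun=> [:: s]); split => [k|th].
  split.
  - apply: continuous_min_fun; first exact: continuous_cst_fun.
    apply: continuous_mul_fun; first exact: continuous_cst_fun.
    by move=> th; apply: (continuous_comp (eval_continuous s th)); exact: cf.
  - by move=> th th' h; rewrite h // inE.
  - by rewrite /= s0 st.
  - by move=> th; rewrite le_min ler01 ge_min lexx mulr_ge0 //; case/andP: (f01 (th s)).
rewrite /Xpath indicE; have /andP[f0 f1] := f01 (X s th).
case: (ltP 0 (f (X s th))) => h.
  rewrite mem_set; last by rewrite /= UE.
  apply: (@cvg_trans _ ((fun=> 1) @ \oo)); last exact: cvg_cst.
  apply: near_eq_cvg; exists (Num.truncn (f (X s th))^-1).+1 => // k /= hk.
  apply/esym/min_l; rewrite -ler_pdivrMr // div1r.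
  by apply: (le_trans (ltW (truncnS_gt _))); rewrite ler_nat.
rewrite memNset; last by rewrite /= UE /= => /(le_lt_trans h); rewrite ltxx.
have -> : f (X s th) = 0 by apply/eqP; rewrite eq_le h.
rewrite (_ : (fun k : nat => _) = fun=> 0); first exact: cvg_cst.
by apply/funext => k; rewrite mulr0 min_r.
Qed.

Section StrongMarkov.
Variables (mu : probability (g_sigma_algebraType (@open W)) R) (P : probability pathsB R).
Hypothesis HP : forall F, cylinder F -> (\int[P]_th (F th)%:E = (mean mu F)%:E)%E.

Lemma bounded_integrable (g : pathsB -> R) (D : set pathsB) (M : R) : measurable D ->
  measurable_fun setT g -> (forall th, `|g th| <= M) -> P.-integrable D (fun th => (g th)%:E).
Proof.
move=> mD mg gM; apply: (@le_integrable _ _ _ P _ _ _ (fun=> M%:E)) => //.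
- by apply/measurable_EFinP; exact: measurable_funTS.
- by move=> th _; rewrite /= lee_fin (le_trans (gM th)) // ler_norm.
- exact: finite_measure_integrable_cst.
Qed.

(** Indicators of generating events are limits of functions with finite support, where
    [markov_cylinder] applies; a Dynkin class argument reaches all of [Ft t]. *)
Lemma simple_markov (t s : R) (f : W -> R) (A : set pathsB) : 0 <= t -> 0 <= s -> continuous f -> Ft t A ->
  (\int[P]_(th in A) (f (X (t + s) th))%:E = \int[P]_(th in A) (T s f (X t th))%:E)%E.
Proof.
move=> t0 s0 cf FA.
have cTf : continuous (T s f) by exact: HTcont.
have [M fM] := continuous_bounded _ f cW cf; have [M' TM] := continuous_bounded _ _ cW cTf.
pose g th := f (X (t + s) th); pose h th := T s f (X t th).
have mg : measurable_fun setT (g : pathsB -> R) by exact: measurable_fX.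
have mh : measurable_fun setT (h : pathsB -> R) by exact: measurable_fX.
have ig D : measurable D -> P.-integrable D (fun th => (g th)%:E).
  by move=> mD; apply: (bounded_integrable g D M) => // th; exact: fM.
have ih D : measurable D -> P.-integrable D (fun th => (h th)%:E).
  by move=> mD; apply: (bounded_integrable h D M') => // th; exact: TM.
pose Q (D : set pathsB) := measurable D /\
  (\int[P]_(th in D) (g th)%:E = \int[P]_(th in D) (h th)%:E)%E.
have QT : Q setT.
  split=> //; have := markov_cylinder mu P HP (fun=> 1) [::] t s f (continuous_cst_fun _ _ 1) _ isT t0 s0 cf.
  move=> /(_ (fun _ _ _ => erefl)); rewrite /g /h.
  under eq_integral do rewrite mul1r.
  by move=> ->; apply: eq_integral => th _; rewrite mul1r.
have QG D : product_gen t D -> Q D.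
  move=> [mD [F [ts [HF cF]]]]; split=> //.
  have key (k : pathsB -> R) (Mk : R) : measurable_fun setT k -> (forall th, `|k th| <= Mk) ->
      (\int[P]_th (F n (Xpath th) * k th)%:E)%E @[n --> \oo] --> (\int[P]_(th in D) (k th)%:E)%E.
    move=> mk kM; rewrite integral_mkcond.
    rewrite (_ : (\int[P]_x _)%E = (\int[P]_th (\1_D th * k th)%:E)%E); last first.
      apply: eq_integral => th _; rewrite patchE indicE; case: (th \in D); by rewrite ?mul1r ?mul0r.
    apply: (bounded_cvg_integral mu P HP (fun n th => F n (Xpath th) * k th) _ setT Mk) => //.
    - move=> n; apply: measurable_funM => //; have [c1 s1 _ _] := HF n.
      exact: measurable_Xpath c1 s1.
    - by apply: measurable_funM => //; exact: measurable_indic.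
    - move=> n th; have [_ _ _ /(_ (Xpath th))/andP[F0 F1]] := HF n.
      rewrite normrM (ger0_norm F0); apply: le_trans (kM th).
      by rewrite ler_piMl.
    - by move=> th _; apply: cvgM (cF th) _; exact: cvg_cst.
  have Kg := key g M mg (fun th => fM _); have Kh := key h M' mh (fun th => TM _).
  have E : (fun n => \int[P]_th (F n (Xpath th) * g th)%:E)%E = (fun n => \int[P]_th (F n (Xpath th) * h th)%:E)%E.
    apply/funext => n; have [c1 s1 a1 _] := HF n.
    exact: markov_cylinder mu P HP _ _ _ _ _ c1 s1 a1 t0 s0 cf.
  rewrite E in Kg; exact: (@cvg_unique (\bar R) _ _ _ _ _ Kg Kh).
suff : Q A by case.
have : <<s product_gen t >> A.
  move: A FA; apply: smallest_sub; first exact: smallest_sigma_algebra.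
  by move=> A /natural_product_gen; exact: sub_sigma_algebra.
have QC D : Q D -> Q (~` D).
  move=> [mD QD]; split; first exact: measurableC.
  have split_int (k : pathsB -> R) : (forall D, measurable D -> P.-integrable D (fun th => (k th)%:E)) ->
      (\int[P]_(th in ~` D) (k th)%:E = \int[P]_th (k th)%:E - \int[P]_(th in D) (k th)%:E)%E.
    move=> ik; have fD : (\int[P]_(th in D) (k th)%:E \is a fin_num)%E.
      by apply: integrable_fin_num => //; exact: ik.
    rewrite -(setUv D) integral_setU_EFin //; last 3 first.
    - exact: measurableC.
    - by rewrite setUv; have /measurable_int/measurable_EFinP := ik setT measurableT.
    - by apply/disj_setPS; rewrite setICr.
    by rewrite addeAC subee // add0e.
  by rewrite (split_int g ig) (split_int h ih) QT.2 QD.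
apply: (@dynkin_induction _ (g_sigma_algebraType (product_gen t)) (product_gen t) Q erefl (product_genI t) QT QG).
- by move=> D _; exact: QC.
suff QU (F : nat -> set pathsB) : trivIset setT F -> (forall n, Q (F n)) -> Q (\bigcup_k F k).
  by move=> F _; exact: QU.
move=> tF QF; have mF n : measurable (F n) := (QF n).1.
have mU : measurable (\bigcup_k F k) by exact: bigcupT_measurable.
split=> //; rewrite !integral_bigcup //; [|exact: ih|exact: ig].
by apply: eq_eseriesr => n _; exact: (QF n).2.
Qed.

Variable tau : pathsB -> \bar R.
Hypothesis st_tau : stopping_time pathsB R Ft tau.

Let piece m j : set pathsB := [set th | Num.truncn (2 ^+ m * fine (tau th)) = j].

Lemma measurable_tau_lt v : measurable [set th | (tau th < v%:E)%E].
Proof.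
have [v0|v0] := ltP v 0.
  rewrite (_ : [set _ | _] = set0) //; apply/seteqP; split=> // th /= h.
  have := lt_trans (le_lt_trans (st_tau.1 th) h) (_ : v%:E < 0)%E; rewrite lte_fin => /(_ v0).
  by rewrite ltxx.
apply: (Ft_measurable v); rewrite (_ : [set _ | _] = [set th | (tau th <= v%:E)%E /\ (tau th < v%:E)%E]).
  exact: tau_lt.
by apply/seteqP; split=> th /= => [h|[]//]; split=> //; exact: ltW.
Qed.

Lemma measurable_tau_fin : measurable [set th | (tau th < +oo)%E].
Proof.
have := (Xtau_F_tau tau st_tau setT _).1; rewrite preimage_setT setIT; apply.
by have := @measurableT _ (g_sigma_algebraType (@open W)).
Qed.

Lemma measurable_piece m j : measurable (piece m j).
Proof.
have p0 : 0 < (2 : R) ^+ m by rewrite exprn_gt0.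
(* [fine] sends an infinite time to zero, so those paths all fall into piece zero and need a
   separate term. *)
rewrite (_ : piece m j = ([set th | (tau th < +oo)%E] `&`
    ([set th | (tau th < (j.+1%:R / 2 ^+ m)%:E)%E] `\` [set th | (tau th < (j%:R / 2 ^+ m)%:E)%E])) `|`
    (~` [set th | (tau th < +oo)%E] `&` [set th | j = 0%N])).
  apply: measurableU; apply: measurableI.
  - exact: measurable_tau_fin.
  - by apply: measurableD; exact: measurable_tau_lt.
  - by apply: measurableC; exact: measurable_tau_fin.
  - by case: (eqVneq j 0%N) => [->|/eqP j0]; [rewrite (_ : [set _ | _] = setT) | rewrite (_ : [set _ | _] = set0)] => //;
      apply/seteqP; split.
apply/seteqP; split => th; rewrite /piece /=.
  move=> E; have [h|h] := boolP (tau th < +oo)%E.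
    left; split=> //; have [h1 h2] := (truncn_tauP tau st_tau m j th h).1 E.
    by split=> //; apply/negP; rewrite -leNgt.
  right; split=> //; move: h; rewrite -leNgt leye_eq => /eqP h.
  by move: E; rewrite h /= mulr0 truncn0.
move=> [[h [h2 /negP h1]]|[/negP h j0]].
  by apply/(truncn_tauP tau st_tau m j th h); rewrite -leNgt in h1.
by move: h; rewrite -leNgt leye_eq => /eqP h; rewrite h /= mulr0 truncn0 j0.
Qed.

Lemma piece_cover m : \bigcup_j piece m j = setT.
Proof. by apply/seteqP; split=> // th _; exists (Num.truncn (2 ^+ m * fine (tau th))). Qed.

Lemma measurable_next m (s : R) (f : W -> R) : continuous f ->
  measurable_fun setT (fun th : pathsB => f (X (next_time tau m th + s) th)).
Proof.
move=> cf; rewrite -(piece_cover m); apply/measurable_fun_bigcup; first exact: measurable_piece.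
move=> j; apply: (eq_measurable_fun (fun th : pathsB => f (X (j.+1%:R / 2 ^+ m + s) th))).
  by move=> th; rewrite inE /piece /= /next_time => ->.
by apply: measurable_funTS; exact: measurable_fX.
Qed.

Lemma next_cvg (s : R) (f : W -> R) th : continuous f ->
  f (X (next_time tau m th + s) th) @[m --> \oo] --> f (X (fine (tau th) + s) th).
Proof.
move=> cf; have h : next_time tau m th + s @[m --> \oo] --> fine (tau th) + s.
  by apply: cvgD; [exact: next_time_cvg (fine_tau_ge0 tau st_tau th) | exact: cvg_cst].
apply: continuous_cvg; first exact: cf.
exact: (cvg_comp _ _ h (X_continuous th _)).
Qed.

Theorem strong_markov (A : set pathsB) (s : R) (f : W -> R) : F_tau pathsB R Ft tau A -> 0 <= s -> continuous f ->
  (\int[P]_(th in A `&` [set th | (tau th < +oo)%E]) (f (X (fine (tau th) + s) th))%:E =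
   \int[P]_(th in A `&` [set th | (tau th < +oo)%E]) (T s f (X (fine (tau th)) th))%:E)%E.
Proof.
move=> [mA FA] s0 cf; set D := A `&` _.
have mD : measurable D by apply: measurableI => //; exact: measurable_tau_fin.
have cTf : continuous (T s f) by exact: HTcont.
have [M fM] := continuous_bounded _ f cW cf; have [M' TM] := continuous_bounded _ _ cW cTf.
pose Y m th := f (X (next_time tau m th + s) th).
(* The added zero gives both integrands one shape, so that the same measurability and convergence
   lemmas serve. *)
pose Z m th := T s f (X (next_time tau m th + 0) th).
have mY m : measurable_fun setT (Y m : pathsB -> R) by exact: measurable_next.
have mZ m : measurable_fun setT (Z m : pathsB -> R) by exact: measurable_next.
have mYlim : measurable_fun setT (fun th : pathsB => f (X (fine (tau th) + s) th)).
  by apply: (measurable_fun_cvg mY) => th _; exact: next_cvg.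
have mZlim : measurable_fun setT (fun th : pathsB => T s f (X (fine (tau th) + 0) th)).
  by apply: (measurable_fun_cvg mZ) => th _; exact: next_cvg.
have cY := bounded_cvg_integral mu P HP Y _ D M mD mY mYlim (fun m th => fM _) (fun th _ => next_cvg s f th cf).
have cZ := bounded_cvg_integral mu P HP Z _ D M' mD mZ mZlim (fun m th => TM _) (fun th _ => next_cvg 0 _ th cTf).
have YZ m : (\int[P]_(th in D) (Y m th)%:E = \int[P]_(th in D) (Z m th)%:E)%E.
  have DE : D = \bigcup_j (D `&` piece m j) by rewrite -setI_bigcupr piece_cover setIT.
  have mDp j : measurable (D `&` piece m j) by apply: measurableI => //; exact: measurable_piece.
  have tDp : trivIset setT (fun j => D `&` piece m j).
    by apply/trivIsetP => i j _ _ ij; apply/seteqP; split=> // th [[_ Ei] [_ Ej]]; move: ij; rewrite -Ei -Ej eqxx.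
  have iY D' : measurable D' -> P.-integrable D' (fun th => (Y m th)%:E).
    by move=> mD'; apply: (bounded_integrable _ _ M) => // th; exact: fM.
  have iZ D' : measurable D' -> P.-integrable D' (fun th => (Z m th)%:E).
    by move=> mD'; apply: (bounded_integrable _ _ M') => // th; exact: TM.
  have mU : measurable (\bigcup_j (D `&` piece m j)) by rewrite -DE.
  rewrite {1 2}DE !integral_bigcup //; [|exact: iZ|exact: iY].
  apply: eq_eseriesr => j _; pose u : R := j.+1%:R / 2 ^+ m.
  have u0 : 0 <= u by rewrite divr_ge0 // exprn_ge0.
  (* On this piece [tau] is strictly less than [u], so the event is decided by time [u] and the
     Markov property at the fixed time [u] applies. *)
  have Fu : Ft u (D `&` piece m j).
    rewrite (_ : D `&` piece m j = (A `&` [set th | (tau th <= u%:E)%E]) `&`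
      ([set th | (tau th <= u%:E)%E /\ ((j%:R / 2 ^+ m)%:E <= tau th)%E] `&`
       [set th | (tau th <= u%:E)%E /\ (tau th < u%:E)%E])).
      rewrite FtE; apply: measurableI; first exact: FA.
      by apply: measurableI; [exact: tau_ge | exact: tau_lt].
    apply/seteqP; split=> th /=.
      move=> [[Ath h] /(truncn_tauP tau st_tau m j th h) [h1 h2]].
      by have h3 := ltW h2; split.
    move=> [[Ath h] [[_ h1] [_ h2]]].
    have hoo : (tau th < +oo)%E by apply: (lt_trans h2); rewrite ltry.
    by split=> //; apply/(truncn_tauP tau st_tau m j th hoo).
  transitivity (\int[P]_(th in D `&` piece m j) (f (X (u + s) th))%:E)%E.
    by apply: eq_integral => th; rewrite inE /piece => -[_ /= E]; rewrite /Y /next_time E.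
  rewrite (simple_markov u s f _ u0 s0 cf Fu).
  by apply: eq_integral => th; rewrite inE /piece => -[_ /= E]; rewrite /Z /next_time E addr0.
rewrite (_ : (fun m => _) = fun m => (\int[P]_(th in D) (Z m th)%:E)%E) in cY; last by apply/funext.
rewrite (@cvg_unique (\bar R) _ _ _ _ _ cY cZ); last exact: ereal_hausdorff.
by apply: eq_integral => th _; rewrite addr0.
Qed.

End StrongMarkov.

(** Recovers probabilities of open sets from integrals of continuous functions, by dominated
    convergence. *)
Lemma cozero_prob d (Y : measurableType d) (nu : probability Y R) (f : Y -> R) : measurable_fun setT f ->
  (forall y, 0 <= f y <= 1) ->
  (\int[nu]_y (Num.min 1 (k%:R * f y))%:E)%E @[k --> \oo] --> nu [set y | 0 < f y].
Proof.
move=> mf f01.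
have mU : measurable [set y | 0 < f y].
  have := mf measurableT `]0, +oo[%classic (measurable_itv _).
  by rewrite setTI; congr measurable; apply/seteqP; split=> y /=; rewrite in_itv /= andbT.
have := @dominated_convergence _ _ _ nu setT measurableT (fun k y => (Num.min 1 (k%:R * f y))%:E)
  (fun y => (\1_[set y | 0 < f y] y)%:E) (fun=> 1%E).
rewrite integral_indic // setIT; case => //.
- move=> k; apply/measurable_EFinP; apply: measurable_minr => //.
  by apply: measurable_funM.
- by apply/measurable_EFinP; exact: measurable_indic.
- apply: aeW => y _; apply: cvg_EFin; first exact: nearW.
  rewrite indicE; have /andP[f0 f1] := f01 y.
  case: (ltP 0 (f y)) => h.
    rewrite mem_set //; apply: (@cvg_trans _ ((fun=> 1) @ \oo)); last exact: cvg_cst.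
    apply: near_eq_cvg; exists (Num.truncn (f y)^-1).+1 => // k /= hk.
    apply/esym/min_l; rewrite -ler_pdivrMr // div1r.
    by apply: (le_trans (ltW (truncnS_gt _))); rewrite ler_nat.
  rewrite memNset; last by rewrite /= => /(le_lt_trans h); rewrite ltxx.
  rewrite (_ : _ \o _ = fun=> 0); first exact: cvg_cst.
  have -> : f y = 0 by apply/eqP; rewrite eq_le h.
  by apply/funext => k /=; rewrite mulr0 min_r.
- exact: finite_measure_integrable_cst.
- apply: aeW => y k _; have /andP[f0 f1] := f01 y.
  by rewrite lee_fin ger0_norm ?ge_min ?lexx // le_min ler01 mulr_ge0.
Qed.

Lemma initial_law (mu : probability (g_sigma_algebraType (@open W)) R) (P : probability pathsB R)
    (HP : forall F, cylinder F -> (\int[P]_th (F th)%:E = (mean mu F)%:E)%E) B :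
  <<s @open W >> B -> P (X 0 @^-1` B) = mu B.
Proof.
pose Q (B : set W) := P (X 0 @^-1` B) = mu B.
have mX A : <<s @open W >> A -> measurable (X 0 @^-1` A : set pathsB) by exact: measurable_X.
apply: (@dynkin_induction _ (g_sigma_algebraType (@open W)) (@open W) Q erefl).
- by move=> U V; exact: openI.
- by rewrite /Q preimage_setT !probability_setT.
- move=> U oU; rewrite /Q; have [f [cf f01 UE]] := open_cozero R W q U cW q_cont q_sep q_bound oU.
  have h1 := cozero_prob _ pathsB P (fun th => f (X 0 th)) (measurable_fX 0 f cf) (fun th => f01 _).
  have h2 := cozero_prob _ _ mu f (continuous_measurable f cf) f01.
  have E : (fun k => \int[P]_th (Num.min 1 (k%:R * f (X 0 th)))%:E)%E =
           (fun k : nat => \int[mu]_w (Num.min 1 (k%:R * f w))%:E)%E.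
    apply/funext => k; apply: (law_initial mu P HP (fun w => Num.min 1 (k%:R * f w))).
    apply: continuous_min_fun; first exact: continuous_cst_fun.
    by apply: continuous_mul_fun => //; exact: continuous_cst_fun.
  rewrite E in h1; rewrite UE; exact: (@cvg_unique (\bar R) (@ereal_hausdorff R) _ _ _ _ h1 h2).
- move=> A mA QA; rewrite /Q preimage_setC probability_setC; last exact: mX.
  by rewrite QA -probability_setC.
move=> F mF tF QF; rewrite /Q preimage_bigcup !measure_bigcup //.
- by apply: eq_eseriesr => n _; exact: QF.
- by move=> n _; apply: mX; exact: mF.
apply/trivIsetP => i j _ _ ij; rewrite -preimage_setI.
by move/trivIsetP : tF => /(_ i j I I ij) ->; rewrite preimage_set0.
Qed.

Theorem diffusion_process :
  exists (F : R -> set (set pathsB)) (Y : R -> pathsB -> W)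
         (P : probability (g_sigma_algebraType (@open W)) R -> probability pathsB R),
    [/\ filtration pathsB R F,
        (forall t : R, 0 <= t -> forall B, <<s @open W >> B -> F t (Y t @^-1` B)),
        (forall mu B, <<s @open W >> B -> P mu (Y 0 @^-1` B) = mu B),
        (forall th, continuous (fun t => Y t th)) &
        (forall mu (tau : pathsB -> \bar R), stopping_time pathsB R F tau ->
           (forall B, <<s @open W >> B ->
              F_tau pathsB R F tau ([set th | (tau th < +oo)%E] `&` (fun th => Y (fine (tau th)) th) @^-1` B)) /\
           (forall A s (f : W -> R), F_tau pathsB R F tau A -> 0 <= s -> continuous f ->
              (\int[P mu]_(th in A `&` [set th | (tau th < +oo)%E]) (f (Y (fine (tau th) + s) th))%:E
               = \int[P mu]_(th in A `&` [set th | (tau th < +oo)%E]) (T s f (Y (fine (tau th)) th))%:E)%E))].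
Proof.
have /choice[P HP] := path_law.
exists Ft, X, P; split.
- exact: Ft_filtration.
- by move=> t t0 B; exact: Ft_adapted.
- by move=> mu B; exact: initial_law (HP mu) B.
- exact: X_continuous.
move=> mu tau st; split; first by move=> B; exact: Xtau_F_tau.
by move=> A s f; exact: strong_markov (HP mu) tau st A s f.
Qed.

End FellerProcess.

Theorem theorem7p1 (R : realType) (z z' : complex.complex R)
  (Hzz : principal_or_complementary R z z')
  (T : R -> (Omega R -> R) -> (Omega R -> R))
  (* {T(t)} is a strongly continuous conservative Markov semigroup in C(Omega) *)
  (HTcont : forall (t : R) (f : Omega R -> R), 0 <= t -> continuous f -> continuous (T t f))
  (HTlin : forall (t a : R) (f g : Omega R -> R), 0 <= t -> continuous f -> continuous g ->
     T t (fun w => a * f w + g w) = (fun w => a * T t f w + T t g w))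
  (HTpos : forall (t : R) (f : Omega R -> R), 0 <= t -> continuous f -> (forall w, 0 <= f w) ->
     forall w, 0 <= T t f w)
  (HT1 : forall t : R, 0 <= t -> T t (fun _ => 1) = (fun _ => 1))
  (HT0 : forall f : Omega R -> R, continuous f -> T 0 f = f)
  (HTsg : forall (s t : R) (f : Omega R -> R), 0 <= s -> 0 <= t -> continuous f -> T (s + t) f = T s (T t f))
  (HTsc : forall f : Omega R -> R, continuous f -> forall e : R, 0 < e ->
     \forall s \near 0^'+, forall w, `|T s f w - f w| < e)
  (* {T(t)} is the limit of the up-down chains: || T_n^[n^2 t] pi_n f - pi_n (T(t) f) ||_n -> 0 *)
  (HTlim : forall (t : R) (f : Omega R -> R), 0 <= t -> continuous f ->
     (fun n : nat => \big[Num.max/0]_(l <- Yd n)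
        `| iter (Num.truncn ((n%:R) ^+ 2 * t)) (Tn R z z' n) (pi_n R n f) l
           - pi_n R n (T t f) l |) @ \oo --> 0) :
  exists (d : measure_display) (Th : measurableType d)
         (F : R -> set (set Th)) (X : R -> Th -> Omega R)
         (P : probability (OmegaB R) R -> probability Th R),
    [/\ filtration Th R F,
        (* X is adapted *)
        (forall t : R, 0 <= t -> forall B : set (OmegaB R), measurable B ->
           F t (X t @^-1` B)),
        (* it can start from any probability distribution mu on Omega *)
        (forall (mu : probability (OmegaB R) R) (B : set (OmegaB R)), measurable B ->
           P mu (X 0 @^-1` B) = mu B),
        (* sample paths are continuous almost surely *)
        (forall mu : probability (OmegaB R) R,
           {ae P mu, forall th, {within `[0, +oo[, continuous (fun t => X t th)}}) &
        (* strong Markov property with transition semigroup {T(t)} *)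
        (forall (mu : probability (OmegaB R) R) (tau : Th -> \bar R),
           stopping_time Th R F tau ->
           (forall B : set (OmegaB R), measurable B ->
              F_tau Th R F tau ([set th | (tau th < +oo)%E] `&`
                                (fun th => X (fine (tau th)) th) @^-1` B)) /\
           (forall (A : set Th) (s : R) (f : Omega R -> R),
              F_tau Th R F tau A -> 0 <= s -> continuous f ->
              (\int[P mu]_(th in A `&` [set th | (tau th < +oo)%E])
                 (f (X (fine (tau th) + s) th))%:E
               = \int[P mu]_(th in A `&` [set th | (tau th < +oo)%E])
                 (T s f (X (fine (tau th)) th))%:E)%E))].
Proof.
pose W : ptopologicalType := HB.pack (Topological.sort (Omega R)) (isPointed.Build (Omega R) (omega0 R)).
have [F [X [P [fF adF initF contX sm]]]] := @diffusion_process R W (Omega_compact R) T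
  HTcont HTlin HTpos HT1 HT0 HTsg (qmom R) (qmom_continuous R) (qmom_separates R)
  (semigroup_moment_bound R z z' Hzz T HTcont HTlim) (qmom_norm_le R) HTsc.
exists _, _, F, X, P; split=> //.
(* Continuity holds for every path, the exceptional ones having been made constant. *)
by move=> mu; apply: aeW => th; apply: continuous_subspaceT; exact: contX.
Qed.
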